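(* Let $T\ge 0$ and let $(X_t)_{0\le t\le T}$ be a solution of a stochastic differential equation $dX_t=\sigma(t,X_t)\,dW_t+m(t,X_t)\,dt$ ($W$ a standard one-dimensional Brownian motion) satisfying Assumptions A and B of the context, so that $X_t=f(t,x+B_{\rho(t)})$ with $x\in\mathbb{R}$. Let $$\eta(z)=\frac{1}{(e\kappa_{\min}^{-1}+1)\,F(2z^2+1)},\qquad z\in\mathbb{R},$$ and consider, for $\varepsilon>0$, the Brownian skeleton $(BS)_\eta$ (defined in the context) started from $x_0^\varepsilon=x$. Let $$y_t^\varepsilon=\sum_{n\ge0}f(\rho^{-1}(s_n^\varepsilon),x_n^\varepsilon)\,1_{\{s_n^\varepsilon\le\rho(t)<s_{n+1}^\varepsilon\}},\quad 0\le t\le T,$$ be the associated approximation of $(X_t)_{0\le t\le T}$ and let $\hat N_T^\varepsilon=\inf\{n\ge0:\ s_n^\varepsilon\ge\rho(T)\}$ be the random number of points needed to build it. Then there exists a constant $\mu>0$ such that $$\lim_{\varepsilon\to0}\varepsilon^2\,\mathbb{E}[\hat N_T^\varepsilon]=\mu\,\mathbb{E}\left[\int_0^{\rho(T)}\frac{1}{\eta^2(x+B_s)}\,ds\right],\qquad\forall(T,x)\in\mathbb{R}_+\times\mathbb{R},$$ where $(B_t)_{t\ge0}$ stands for a standard one-dimensional Brownian motion (the constant $\mu$ does not depend on $(T,x)$).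
   Context: Assumption A. $X_t=f(t,x+B_{\rho(t)})$, where $B$ is a standard one-dimensional Brownian motion, $x\in\mathbb{R}$, $\rho:\mathbb{R}_+\to\mathbb{R}_+$ is an increasing differentiable function with $\rho(0)=0$ and $\lim_{t\to\infty}\rho(t)=\infty$, and $f$ is a $\mathcal{C}^{1,1}(\mathbb{R}_+\times\mathbb{R},\mathbb{R})$ function (continuously differentiable in each variable). There exists a strictly increasing $\mathcal{C}^2(\mathbb{R})$ function $F$ such that $$\sup_{t\in[0,T]}\max\left\{\left|\frac{\partial f}{\partial t}(t,z)\right|,\left|\frac{\partial f}{\partial x}(t,z)\right|\right\}\le F(z^2),\quad\forall z\in\mathbb{R};$$ there exist constants $\kappa_1,\kappa_2>0$ such that $\max(F,F',F'')(z^2)\le\kappa_1e^{\kappa_2z}$ for all $z\ge0$; and $z\mapsto\frac{1}{F(2z^2+1)}$ is Lipschitz continuous. Assumption B. There exists $\kappa_{\min}>0$ such that $\rho'(\rho^{-1}(u))\ge\kappa_{\min}$ for all $u\ge0$. Brownian skeleton $(BS)_\eta$. For $\varepsilon>0$ let $\phi_\varepsilon(t)=\sqrt{t\ln(\varepsilon^2e/t)}$ for $t\in[0,r_\varepsilon]$, $r_\varepsilon=e\varepsilon^2$ (with $\phi_\varepsilon(0)=0$). Let $(A_n)_{n\ge1}$ be i.i.d. random variables with gamma distribution $\Gamma(3/2,2)$ (shape $3/2$, scale $2$, i.e. Laplace transform $s\mapsto(1+2s)^{-3/2}$), and $(Z_n)_{n\ge1}$ i.i.d. Rademacher variables (values $\pm1$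 with probability $1/2$), independent of $(A_n)$. For $\eta:\mathbb{R}\to\mathbb{R}_+$ and $x\in\mathbb{R}$, the skeleton is the family $((U_n^\varepsilon)_{n\ge1},(s_n^\varepsilon)_{n\ge1},(x_n^\varepsilon)_{n\ge0})$ defined by $x_0^\varepsilon=x$, $s_0^\varepsilon=0$ and, for $n\ge1$, $$U_n^\varepsilon=\varepsilon^2\eta^2(x_{n-1}^\varepsilon)e^{1-A_n},\quad s_n^\varepsilon=\sum_{k=1}^nU_k^\varepsilon,\quad x_n^\varepsilon=x_{n-1}^\varepsilon+Z_n\,\eta(x_{n-1}^\varepsilon)\,\phi_\varepsilon\!\left(\frac{U_n^\varepsilon}{\eta^2(x_{n-1}^\varepsilon)}\right).$$ *)

(* Defs.v *)
From HB Require Import structures.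
From mathcomp Require Import all_boot all_order all_algebra.
From mathcomp Require Import all_classical all_reals all_analysis.
Set Implicit Arguments.
Unset Strict Implicit.
Unset Printing Implicit Defensive.
Import Order.TTheory GRing.Theory Num.Theory numFieldNormedType.Exports.
Local Open Scope classical_set_scope.
Local Open Scope ring_scope.


Section calculus.
Context {R : realType}.
Implicit Types (D : set R) (g : R -> R) (t : R).

(* The increments h are restricted to t + h \in D, so that for D = [0, +oo[
   these are right derivatives at 0 and ordinary derivatives at t > 0. *)
Definition diff_quotient g t (h : R) : R := h^-1 * (g (t + h) - g t).
Definition derivable_on D g t : Prop :=
  cvg (diff_quotient g t @ within [set h | D (t + h)] 0^').
Definition derivative_on D g t : R :=
  lim (diff_quotient g t @ within [set h | D (t + h)] 0^').

Definition Rplus : set R := `[0, +oo[.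

Definition partial_t (f : R -> R -> R) (t z : R) : R :=
  derivative_on Rplus (fun s => f s z) t.
Definition partial_x (f : R -> R -> R) (t z : R) : R :=
  derivative_on setT (f t) z.

Definition class_C11 (f : R -> R -> R) : Prop :=
  [/\ forall t z, 0 <= t -> derivable_on Rplus (fun s => f s z) t,
      forall t z, 0 <= t -> derivable_on setT (f t) z,
      {within [set p : R * R | 0 <= p.1],
         continuous (fun p : R * R => partial_t f p.1 p.2)} &
      {within [set p : R * R | 0 <= p.1],
         continuous (fun p : R * R => partial_x f p.1 p.2)}].

Definition class_C2 (F : R -> R) : Prop :=
  [/\ forall z, derivable F z 1, forall z, derivable (derive1 F) z 1 &
      continuous (derive1n 2 F)].

(* rho^{-1}, specified only on the image of R_+ under rho *)
Definition time_inv (rho : R -> R) : R -> R := pinv Rplus rho.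

End calculus.


Section assumptions.
Context {R : realType}.

Definition time_change (rho : R -> R) : Prop :=
  [/\ {in Rplus &, {homo rho : s t / s < t}},
      forall t, 0 <= t -> derivable_on Rplus rho t,
      rho 0 = 0 &
      rho t @[t --> +oo] --> +oo].

Definition growth_function (F : R -> R) : Prop :=
  [/\ {homo F : a b / a < b},
      class_C2 F,
      exists k1 k2 : R, [/\ 0 < k1, 0 < k2 & forall z, 0 <= z ->
        Num.max (F (z ^+ 2)) (Num.max (derive1 F (z ^+ 2)) (derive1n 2 F (z ^+ 2)))
          <= k1 * expR (k2 * z)] &
      exists k : R, k.-lipschitz (fun z : R => (F (2 * z ^+ 2 + 1))^-1)].

Definition growth_bound (T : R) (f : R -> R -> R) (F : R -> R) : Prop :=
  forall t z, 0 <= t <= T ->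
    Num.max `|partial_t f t z| `|partial_x f t z| <= F (z ^+ 2).

Definition assumption_B (rho : R -> R) (kmin : R) : Prop :=
  0 < kmin /\
  forall u, 0 <= u -> kmin <= derivative_on Rplus rho (time_inv rho u).

End assumptions.


Section probability_notions.
Context {R : realType} {d : measure_display} {Omega : measurableType d}.
Variable P : probability Omega R.
Local Open Scope ereal_scope.

Definition mutually_independent (I : eqType) (Y : I -> Omega -> R) : Prop :=
  forall (J : seq I) (E : I -> set R), uniq J ->
    (forall i, measurable (E i)) ->
    P [set w | forall i, i \in J -> E i (Y i w)] =
    \prod_(i <- J) P (Y i @^-1` E i).

Definition Gamma_fun (k : R) : R :=
  (\int[lebesgue_measure]_(t in `]0%R, +oo[) (t `^ (k - 1) * expR (- t)))%R.

Definition gamma_density (k theta y : R) : R :=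
  (y `^ (k - 1) * expR (- y / theta) / (Gamma_fun k * theta `^ k))%R.

Definition gamma_law (k theta : R) (Y : Omega -> R) : Prop :=
  forall E : set R, measurable E ->
    P (Y @^-1` E) = \int[lebesgue_measure]_(y in E `&` `]0%R, +oo[)
                      (gamma_density k theta y)%:E.

Definition rademacher_law (Y : Omega -> R) : Prop :=
  P (Y @^-1` [set 1%R]) = (2^-1)%:E /\ P (Y @^-1` [set (-1)%R]) = (2^-1)%:E.

(* Only times t >= 0 are constrained. The second parameter of normal_prob is
   the standard deviation. *)
Definition brownian_motion (B : R -> {RV P >-> R}) : Prop :=
  [/\ forall w, B 0%R w = 0%R,
      forall t : nat -> R, (0 <= t 0%N)%R ->
        (forall i, (t i <= t i.+1)%R) ->
        mutually_independent (fun i w => (B (t i.+1) w - B (t i) w)%R),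
      forall s t : R, (0 <= s < t)%R -> forall E : set R, measurable E ->
        P [set w | E (B t w - B s w)%R] = normal_prob 0%R (Num.sqrt (t - s)) E &
      forall w, {within Rplus, continuous (fun t => B t w)}].

End probability_notions.


Section sde.
Context {R : realType} {d : measure_display} {Omega : measurableType d}.
Variable P : probability Omega R.
Implicit Types (Fil : R -> set (set Omega)) (W : R -> {RV P >-> R}).
Local Open Scope ereal_scope.

Definition filtration Fil : Prop :=
  [/\ forall t, (0 <= t)%R -> sigma_algebra setT (Fil t),
      forall t, (0 <= t)%R -> Fil t `<=` measurable &
      forall s t, (0 <= s <= t)%R -> Fil s `<=` Fil t].

Definition measurable_wrt (G : set (set Omega)) (Y : Omega -> R) : Prop :=
  forall E : set R, measurable E -> G (Y @^-1` E).

Definition brownian_wrt Fil W : Prop :=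
  [/\ brownian_motion W,
      forall t, (0 <= t)%R -> measurable_wrt (Fil t) (W t) &
      forall s t, (0 <= s <= t)%R -> forall (G : set Omega) (E : set R),
        Fil s G -> measurable E ->
        P (G `&` [set w | E (W t w - W s w)%R]) =
        P G * P [set w | E (W t w - W s w)%R]].

Definition cvg0_in_probability (Y : nat -> Omega -> \bar R) : Prop :=
  forall e : R, (0 < e)%R -> P [set w | e%:E <= `|Y n w|] @[n --> \oo] --> 0.

(* The process \sum_(i < N) xi_i 1_{]tau_i, tau_(i+1)]} *)
Definition simple_process Fil (N : nat) (tau : nat -> R)
    (xi : nat -> Omega -> R) : Prop :=
  [/\ (0 <= tau 0%N)%R, forall i, (tau i <= tau i.+1)%R,
      forall i, (i < N)%N -> measurable_wrt (Fil (tau i)) (xi i) &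
      forall i, (i < N)%N -> exists M : R, forall w, (`|xi i w| <= M)%R].

Definition simple_value (N : nat) (tau : nat -> R) (xi : nat -> Omega -> R)
    (s : R) (w : Omega) : R :=
  (\sum_(i < N) xi i w * \1_(`]tau i, tau i.+1] : set R) s)%R.

Definition simple_integral W (t : R) (N : nat) (tau : nat -> R)
    (xi : nat -> Omega -> R) (w : Omega) : R :=
  (\sum_(i < N) xi i w *
     (W (Num.min (tau i.+1) t) w - W (Num.min (tau i) t) w))%R.

(* I is (a version of) the Ito integral of H with respect to W over [0, t]:
   the limit in probability of the integrals of simple processes H_k such that
   the integral of (H_k - H)^2 over [0, t] tends to 0 in probability. *)
Definition ito_integral Fil W (t : R) (H : R -> Omega -> R)
    (I : Omega -> R) : Prop :=
  exists (N : nat -> nat) (tau : nat -> nat -> R)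
         (xi : nat -> nat -> Omega -> R),
    [/\ forall k, simple_process Fil (N k) (tau k) (xi k),
        cvg0_in_probability (fun k w =>
          \int[lebesgue_measure]_(s in `[0%R, t])
            ((simple_value (N k) (tau k) (xi k) s w - H s w) ^+ 2)%:E) &
        cvg0_in_probability (fun k w =>
          (simple_integral W t (N k) (tau k) (xi k) w - I w)%:E)].

Definition sde_solution Fil W (T : R) (sigma m : R -> R -> R)
    (X : R -> {RV P >-> R}) : Prop :=
  [/\ [/\ filtration Fil & brownian_wrt Fil W],
      [/\ measurable_fun ([set p | 0 <= p.1]%R : set (R * R))
            (fun p => sigma p.1 p.2) &
          measurable_fun ([set p | 0 <= p.1]%R : set (R * R))
            (fun p => m p.1 p.2)],
      [/\ forall t, (0 <= t <= T)%R -> measurable_wrt (Fil t) (X t) &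
          forall w, {within `[0%R, T], continuous (fun t => X t w)}],
      {ae P, forall w,
         lebesgue_measure.-integrable `[0%R, T]
           (fun s => (m s (X s w))%:E) /\
         lebesgue_measure.-integrable `[0%R, T]
           (fun s => (sigma s (X s w) ^+ 2)%:E)} &
      forall t, (0 <= t <= T)%R -> exists I : {RV P >-> R},
        ito_integral Fil W t (fun s w => sigma s (X s w)) I /\
        {ae P, forall w, X t w =
           (X 0 w + I w +
            \int[lebesgue_measure]_(s in `[0%R, t]) m s (X s w))%R}].

End sde.


Section skeleton.
Context {R : realType}.

(* Only used on [0, e eps^2], where the argument of sqrt is nonnegative. The
   value 0 at t = 0 is the required one. *)
Definition phi (eps t : R) : R :=
  Num.sqrt (t * ln (eps ^+ 2 * expR 1 / t)).

Definition skeleton_step (eta : R -> R) (eps y a : R) : R :=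
  eps ^+ 2 * eta y ^+ 2 * expR (1 - a).

(* The sequences a, z are indexed from 0: a n and z n stand for A_{n+1} and
   Z_{n+1}, and skeleton_U n for U_{n+1}. *)
Fixpoint skeleton_x (eta : R -> R) (eps x : R) (a z : nat -> R) (n : nat) : R :=
  if n is n'.+1 then
    let y := skeleton_x eta eps x a z n' in
    y + z n' * eta y * phi eps (skeleton_step eta eps y (a n') / eta y ^+ 2)
  else x.

Definition skeleton_U (eta : R -> R) (eps x : R) (a z : nat -> R) (n : nat) : R :=
  skeleton_step eta eps (skeleton_x eta eps x a z n) (a n).

Definition skeleton_s (eta : R -> R) (eps x : R) (a z : nat -> R) (n : nat) : R :=
  \sum_(k < n) skeleton_U eta eps x a z k.

Definition skeleton_approx (f : R -> R -> R) (rho : R -> R) (eta : R -> R)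
    (eps x : R) (a z : nat -> R) (t : R) : R :=
  let s := skeleton_s eta eps x a z in
  limn (series (fun n =>
    f (time_inv rho (s n)) (skeleton_x eta eps x a z n) *
    \1_(`[s n, s n.+1[ : set R) (rho t))).

(* The infimum is +oo when the skeleton never reaches the level rho(T). *)
Definition number_of_points (eta : R -> R) (eps x level : R) (a z : nat -> R)
    : \bar R :=
  ereal_inf [set (n%:R)%:E | n in
    [set n : nat | level <= skeleton_s eta eps x a z n]].

Definition eta_of (kmin : R) (F : R -> R) (z : R) : R :=
  ((expR 1 * kmin^-1 + 1) * F (2 * z ^+ 2 + 1))^-1.

Definition skeleton_noise {d : measure_display} {Omega : measurableType d}
    (P : probability Omega R) (A Z : nat -> {RV P >-> R}) : Prop :=
  [/\ forall n, gamma_law P (3 / 2) 2 (A n),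
      forall n, rademacher_law P (Z n) &
      mutually_independent P (fun i : nat + nat =>
        match i with inl n => A n : Omega -> R | inr n => Z n end)].

End skeleton.

(* Main.v *)
(** Rescale a step of the skeleton from (s, z): with th = eps * eta(z), time
    advances by b * th^2 and space moves by a * th with a random sign, where
    b = e^(1-A) and a^2 = A * e^(1-A). Integrating the derivative of
    y^(3/2) e^(-3y/2) over the half-line gives E b = E a^2 =: m, and mu = 1/m.
    Because these means agree, a step preserves solutions of the heat equation
    up to O(th^3). Let g = 1/eta^2 and W(r, z) = E g(z + B_r), and let I(T, z) be
    the integral of W(r, z) over dl < r <= T. Before the level L = rho(T) is
    passed, I evaluated at the remaining time L + 2 dl - s loses on average
    m * th^2 * g(z) = eps^2 * m at each step, up to an error of order
    sqrt(dl) * th^2 * e^(k|z|). Telescoping, eps^2 * m * E[N] is I(L + 2 dl, 0)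
    up to the sum of the errors, and that sum is O(sqrt(dl)) because
    e^(-cs) cosh(2kz) loses in mean at least th^2 times itself at each step.
    Letting dl tend to 0, I tends to the expected integral of g along Brownian
    motion. The steps form a Markov chain because the noise is independent, and
    g has the required exponential growth and regularity by the hypotheses on F. *)

Require Import Defs.
From HB Require Import structures.
From mathcomp Require Import all_boot all_order all_algebra.
From mathcomp Require Import all_classical all_reals all_analysis.
From mathcomp Require Import measurable_realfun ring lra.
Set Implicit Arguments.
Unset Strict Implicit.
Unset Printing Implicit Defensive.
Import Order.TTheory GRing.Theory Num.Theory numFieldNormedType.Exports.
Local Open Scope classical_set_scope.
Local Open Scope ring_scope.

(** * Calculus *)

Section mvt.
Context {R : realType}.
Implicit Types (f df : R -> R).

(** All derivatives are put on the heat kernel; [g] enters only through its exponential growth and a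
    local Lipschitz bound. Since the derivatives of the kernel blow up as the variance tends to 0,
    the potential is cut off at [dl], and this fixes the order of the limits. The third-order error
    of a step has a constant depending on [dl], but th is at most eps times the supremum of eta, so
    for fixed [dl] a small eps brings this error below sqrt(dl) * th^2; only then does [dl] tend to
    0. The rate sqrt(dl) is the mean of |B_r| for r up to [dl], which measures how far W(r, z) is
    from g(z).

    The second obstacle is that [g] is unbounded and 1/g may be arbitrarily small far away, so that
    neither the errors nor the number of steps is controlled step by step. Instead of stopping
    times, functions of the chain are set to 0 beyond the level, and the mass which the Lyapunov
    function loses on crossing pays for the potential discarded there. Everything is an inequality
    between integrals of nonnegative functions in the extended reals; the finiteness of the expected
    number of points comes out as a consequence. *)

Lemma abs_increment_le f df (B x y : R) :
  x <= y ->
  (forall t, x <= t <= y -> is_derive t 1 f (df t)) ->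
  (forall t, x <= t <= y -> `|df t| <= B) ->
  `|f y - f x| <= B * (y - x).
Proof.
move=> xy fdf dfB.
have [|c cxy ->] := MVT_segment xy (fun t txy => fdf t (subset_itv_oo_cc txy)).
  apply: derivable_within_continuous => t txy.
  by have [] := fdf t txy.
have yx : 0 <= y - x by rewrite subr_ge0.
by rewrite normrM (ger0_norm yx) ler_wpM2r// dfB.
Qed.

(** The remainder, as a function [q] of the step, vanishes at 0 together with its first two
    derivatives [q1] and [q2]; three uses of the mean value theorem give one factor [h] each.
    Symmetrization removes the odd terms. *)
Lemma symmetric_taylor2 f f1 f2 f3 (x h B : R) : 0 <= h ->
  (forall t, x - h <= t <= x + h -> is_derive t 1 f (f1 t)) ->
  (forall t, x - h <= t <= x + h -> is_derive t 1 f1 (f2 t)) ->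
  (forall t, x - h <= t <= x + h -> is_derive t 1 f2 (f3 t)) ->
  (forall t, x - h <= t <= x + h -> `|f3 t| <= B) ->
  `|(f (x + h) + f (x - h)) / 2 - f x - h ^+ 2 / 2 * f2 x| <= B * h ^+ 3.
Proof.
move=> h0 df df1 df2 f3B.
have B0 : 0 <= B.
  by apply: le_trans (f3B x _); rewrite ?normr_ge0// lerBlDr lerDl h0.
pose q2 t := (f2 (x + t) + f2 (x - t)) / 2 - f2 x.
pose q1 t := (f1 (x + t) - f1 (x - t)) / 2 - t * f2 x.
pose q t := (f (x + t) + f (x - t)) / 2 - f x - t ^+ 2 / 2 * f2 x.
have shiftp (k k' : R -> R) t : is_derive (x + t) 1 k (k' (x + t)) ->
    is_derive t 1 (fun t => k (x + t)) (k' (x + t)).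
  move=> kk'; rewrite -[k' _]mulr1.
  have dx : is_derive t 1 (fun t => x + t) 1 by apply: is_derive_eq; rewrite /GRing.scale/=; ring.
  exact: is_derive1_comp kk' dx.
have shiftm (k k' : R -> R) t : is_derive (x - t) 1 k (k' (x - t)) ->
    is_derive t 1 (fun t => k (x - t)) (- k' (x - t)).
  move=> kk'; rewrite -[k' _]mulr1 -mulrN.
  have dx : is_derive t 1 (fun t => x - t) (-1) by apply: is_derive_eq; rewrite /GRing.scale/=; ring.
  exact: (@is_derive1_comp _ k (fun t => x - t) t _ _ kk' dx).
have ip t : 0 <= t <= h -> x - h <= x + t <= x + h by lra.
have im t : 0 <= t <= h -> x - h <= x - t <= x + h by lra.
have q2B t : 0 <= t <= h -> `|q2 t| <= B * h.
  move=> th.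
  have xx : x - h <= x <= x + h by lra.
  have A1 : `|f2 (x + t) - f2 x| <= B * t.
    have -> : t = x + t - x by ring.
    rewrite {1}(_ : x + (x + t - x) = x + t); last by ring.
    apply: abs_increment_le; first by lra.
    - by move=> s sxt; apply: df2; lra.
    - by move=> s sxt; apply: f3B; lra.
  have A2 : `|f2 x - f2 (x - t)| <= B * t.
    have -> : t = x - (x - t) by ring.
    rewrite {1}(_ : x - (x - (x - t)) = x - t); last by ring.
    apply: abs_increment_le; first by lra.
    - by move=> s sxt; apply: df2; lra.
    - by move=> s sxt; apply: f3B; lra.
  have -> : q2 t = (f2 (x + t) - f2 x) / 2 - (f2 x - f2 (x - t)) / 2.
    by rewrite /q2; field.
  apply: (le_trans (ler_normB _ _)); have i2 : `|2^-1 : R| = 2^-1 by rewrite ger0_norm// invr_ge0.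
  rewrite !normrM !i2.
  have : B * t <= B * h by rewrite ler_wpM2l//; lra.
  by lra.
have q1B t : 0 <= t <= h -> `|q1 t| <= B * h * h.
  move=> th.
  have -> : q1 t = q1 t - q1 0 by rewrite /q1 addr0 subr0; ring.
  have bt : `|q1 t - q1 0| <= B * h * (t - 0).
    apply: (@abs_increment_le _ q2); first lra.
    - move=> s s0t; have s0h : 0 <= s <= h by lra.
      have D1 := shiftp _ _ _ (df1 _ (ip _ s0h)).
      have D2 := shiftm _ _ _ (df1 _ (im _ s0h)).
      rewrite /q1 /q2; apply: is_derive_eq.
      by rewrite /GRing.scale/=; ring.
    - by move=> s s0t; apply: q2B; lra.
  apply: (le_trans bt); rewrite ler_wpM2l ?mulr_ge0//; lra.
have -> : (f (x + h) + f (x - h)) / 2 - f x - h ^+ 2 / 2 * f2 x = q h - q 0.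
  by rewrite /q addr0 subr0; field.
have -> : B * h ^+ 3 = B * h * h * (h - 0) by ring.
apply: (@abs_increment_le _ q1) => //.
move=> s s0h.
have D1 := shiftp _ _ _ (df _ (ip _ s0h)).
have D2 := shiftm _ _ _ (df _ (im _ s0h)).
rewrite /q1 /q; apply: is_derive_eq.
by rewrite /GRing.scale/=; field.
Qed.

End mvt.

(** * Heat kernel *)

Section heat_kernel.
Context {R : realType}.
Implicit Types (r v M : R).

(* The centred normal density of variance [r] > 0. Writing [r^(-1/2)] as
   [expR (- ln r / 2)] lets the exponential rule compute the time derivatives;
   [heat1] to [heat4] are the space derivatives. *)
Definition heat r v : R :=
  (Num.sqrt (pi *+ 2))^-1 * expR (- (ln r / 2) - v ^+ 2 / (2 * r)).
Definition heat1 r v : R := - (v / r) * heat r v.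
Definition heat2 r v : R := (v ^+ 2 / r ^+ 2 - r^-1) * heat r v.
Definition heat3 r v : R := (3 * v / r ^+ 2 - v ^+ 3 / r ^+ 3) * heat r v.
Definition heat4 r v : R :=
  (v ^+ 4 / r ^+ 4 - 6 * v ^+ 2 / r ^+ 3 + 3 / r ^+ 2) * heat r v.

Lemma heat_ge0 r v : 0 <= heat r v.
Proof. by rewrite mulr_ge0 ?expR_ge0// invr_ge0 sqrtr_ge0. Qed.

Lemma heatE r v z : 0 < r -> heat r (v - z) = normal_pdf z (Num.sqrt r) v.
Proof.
move=> r0; rewrite normal_pdfE ?gt_eqF ?sqrtr_gt0// /heat.
rewrite /normal_peak /normal_fun sqr_sqrtr ?ltW// -mulrnAr sqrtrM ?ltW//.
have -> : expR (- (ln r / 2) - (v - z) ^+ 2 / (2 * r)) =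
    (Num.sqrt r)^-1 * expR (- (v - z) ^+ 2 / (r *+ 2)).
  rewrite expRD mulNr -[r *+ 2]mulr_natl expRN; congr (_^-1 * _).
  rewrite -[RHS]lnK ?posrE ?sqrtr_gt0//; congr expR.
  rewrite -[in LHS](sqr_sqrtr (ltW r0)) lnXn ?sqrtr_gt0//.
  by rewrite -mulr_natr; field.
by rewrite invfM mulrA [_^-1 * _^-1]mulrC.
Qed.

Lemma is_derive_heat_space r v : 0 < r -> is_derive v 1 (heat r) (heat1 r v).
Proof.
move=> r0; rewrite /heat1 /heat; move: (Num.sqrt _)^-1 => c; apply: is_derive_eq.
by rewrite /GRing.scale/=; field; rewrite gt_eqF.
Qed.

Lemma is_derive_heat1_space r v : 0 < r -> is_derive v 1 (heat1 r) (heat2 r v).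
Proof.
move=> r0; have D := is_derive_heat_space v r0.
rewrite /heat1; apply: is_derive_eq.
by rewrite /GRing.scale/= /heat1 /heat2; field; rewrite gt_eqF.
Qed.

Lemma is_derive_heat2_space r v : 0 < r -> is_derive v 1 (heat2 r) (heat3 r v).
Proof.
move=> r0; have D := is_derive_heat_space v r0.
rewrite /heat2; apply: is_derive_eq.
by rewrite /GRing.scale/= /heat1 /heat3; field; rewrite gt_eqF.
Qed.

Lemma is_derive_heat_time r v : 0 < r ->
  is_derive r 1 (heat^~ v) (heat2 r v / 2).
Proof.
move=> r0; have Dl := is_derive1_ln r0.
have r1 : r != 0 by rewrite gt_eqF.
have Di := is_deriveV r1 (is_derive_id r 1).
rewrite /heat2 /heat; move: (Num.sqrt _)^-1 => c.
have -> : (fun r => c * expR (- (ln r / 2) - v ^+ 2 / (2 * r)))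
  = (fun r => c * expR (- (ln r / 2) - (v ^+ 2 / 2) * r^-1)).
  by apply/funext => s; rewrite invfM mulrA.
apply: is_derive_eq; rewrite /GRing.scale/=.
have -> : v ^+ 2 / (2 * r) = v ^+ 2 / 2 / r by rewrite invfM mulrA.
by field.
Qed.

Lemma is_derive_heat2_time r v : 0 < r ->
  is_derive r 1 (heat2^~ v) (heat4 r v / 2).
Proof.
move=> r0; have D := is_derive_heat_time v r0.
have r1 : r != 0 by rewrite gt_eqF.
have Di := is_deriveV r1 (is_derive_id r 1).
have -> : (heat2^~ v) = (fun r => (v ^+ 2 * (r^-1 * r^-1) - r^-1) * heat r v).
  by apply/funext => s; rewrite /heat2 -expr2 exprVn.
apply: is_derive_eq; rewrite /GRing.scale/= /heat2 /heat4.
by field.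
Qed.

(** Half of the Gaussian exponent absorbs the polynomial factor: with x = v^2 / (4M), the bound x^2
    / 2 <= e^x gives (1 + v^4) e^(-x) <= 1 + 32 M^2. The other half is kept. The lower bound [r0]
    controls the powers of 1/r. *)
Lemma heat34_bound r0 M : 0 < r0 -> exists2 C, 0 <= C & forall r v, r0 <= r <= M ->
  `|heat3 r v| <= C * expR (- (v ^+ 2 / (4 * M))) /\
  `|heat4 r v| <= C * expR (- (v ^+ 2 / (4 * M))).
Proof.
move=> r00.
pose c := (Num.sqrt (pi *+ 2))^-1 * expR (- (ln r0 / 2)).
have c0 : 0 <= c by rewrite mulr_ge0 ?expR_ge0// invr_ge0 sqrtr_ge0.
pose j := r0^-1.
have j0 : 0 <= j by rewrite invr_ge0 ltW.
(* Coefficients large enough for the polynomials of both [heat3] and [heat4], with 1/r replaced by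
   1/r0. *)
pose Q := 3 * j ^+ 2 + 10 * j ^+ 3 + j ^+ 4.
have Q0 : 0 <= Q by rewrite /Q !addr_ge0 ?mulr_ge0 ?exprn_ge0.
exists (Q * c * (1 + 32 * M ^+ 2)).
  by rewrite !mulr_ge0// addr_ge0// mulr_ge0 ?sqr_ge0.
move=> r v /andP[r0r rM].
have rp : 0 < r by exact: lt_le_trans r0r.
have Mp : 0 < M by exact: lt_le_trans rM.
set x := v ^+ 2 / (4 * M).
have x0 : 0 <= x by rewrite divr_ge0 ?sqr_ge0// mulr_ge0// ltW.
have heatB : heat r v <= c * expR (- x) * expR (- x).
  rewrite -mulrA -expRD /heat /c -mulrA -expRD ler_wpM2l ?invr_ge0 ?sqrtr_ge0//.
  rewrite ler_expR lerD//.
    by rewrite lerN2 ler_pM2r ?invr_gt0// ler_ln ?posrE.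
  have -> : - x - x = - (v ^+ 2 / (2 * M)) by rewrite /x; field; rewrite gt_eqF.
  rewrite lerN2 ler_wpM2l ?sqr_ge0// lef_pV2 ?posrE ?mulr_gt0//.
  by rewrite ler_pM2l.
have v4 : (1 + v ^+ 4) * expR (- x) <= 1 + 32 * M ^+ 2.
  rewrite expRN ler_pdivrMr ?expR_gt0//.
  have := expR_ge1Dxn 1 x0; rewrite (_ : 2`!%:R = 2)// => e2.
  have -> : v ^+ 4 = 32 * M ^+ 2 * (x ^+ 2 / 2) by rewrite /x; field; rewrite gt_eqF.
  have x2 : 0 <= x ^+ 2 by rewrite sqr_ge0.
  have M2 : 0 <= M ^+ 2 by rewrite sqr_ge0.
  have e1 : 1 <= expR x by rewrite -expR0 ler_expR.
  have : 32 * M ^+ 2 * (x ^+ 2 / 2) <= 32 * M ^+ 2 * expR x.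
    by rewrite ler_wpM2l ?mulr_ge0//; lra.
  by move=> ?; rewrite [leRHS]mulrDl mul1r lerD.
have rj : r^-1 <= j by rewrite lef_pV2 ?posrE.
have ri0 : 0 <= r^-1 by rewrite invr_ge0 ltW.
have ij k : r ^- k <= j ^+ k by rewrite -exprVn lerXn2r ?nnegrE.
have w0 : 0 <= `|v| by [].
have e4 : v ^+ 4 = `|v| ^+ 4 by rewrite -[RHS]normrX ger0_norm// -[4%N]/(2*2)%N exprM sqr_ge0.
have w1 : `|v| <= 1 + v ^+ 4.
  rewrite e4; case: (leP `|v| 1) => w; first by rewrite (le_trans w)// lerDl exprn_ge0.
  by rewrite (le_trans (ler_eXnr (n := 4) _ (ltW w)))// lerDr.
have w3 : `|v| ^+ 3 <= 1 + v ^+ 4.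
  rewrite e4; case: (leP `|v| 1) => w.
    by rewrite (le_trans (exprn_ile1 _ w0 w))// lerDl exprn_ge0.
  by rewrite (le_trans (ler_weXn2l (ltW w) (isT : (3 <= 4)%N)))// lerDr.
have w2 : `|v| ^+ 2 <= 1 + v ^+ 4.
  rewrite e4; case: (leP `|v| 1) => w.
    by rewrite (le_trans (exprn_ile1 _ w0 w))// lerDl exprn_ge0.
  by rewrite (le_trans (ler_weXn2l (ltW w) (isT : (2 <= 4)%N)))// lerDr.
have main p : `|p| <= Q * (1 + v ^+ 4) ->
    `|p * heat r v| <= Q * c * (1 + 32 * M ^+ 2) * expR (- x).
  move=> pQ; rewrite normrM (ger0_norm (heat_ge0 _ _)).
  apply: le_trans (ler_pM _ (heat_ge0 _ _) pQ heatB) _ => //.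
  have -> : Q * (1 + v ^+ 4) * (c * expR (- x) * expR (- x)) =
    Q * c * expR (- x) * ((1 + v ^+ 4) * expR (- x)) by ring.
  by rewrite [leRHS]mulrAC ler_wpM2l// !mulr_ge0// expR_ge0.
have t1 k l (cc : R) : 0 <= cc -> `|v| ^+ k <= 1 + v ^+ 4 ->
   `|cc * v ^+ k / r ^+ l| <= cc * j ^+ l * (1 + v ^+ 4).
  move=> cc0 vk; rewrite !normrM normfV !normrX (ger0_norm cc0) (ger0_norm (ltW rp)).
  rewrite -!mulrA ler_wpM2l// mulrC ler_pM ?exprn_ge0 ?invr_ge0 ?exprn_ge0// ltW//.
have vv0 : 0 <= 1 + v ^+ 4 by rewrite (le_trans _ w1).
split; apply: main.
  have -> : 3 * v / r ^+ 2 - v ^+ 3 / r ^+ 3 = 3 * v ^+ 1 / r ^+ 2 - 1 * v ^+ 3 / r ^+ 3.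
    by rewrite expr1 mul1r.
  apply: le_trans (ler_normB _ _) _.
  apply: le_trans (lerD (t1 1%N 2%N 3 _ _) (t1 3%N 3%N 1 _ _)) _ => //.
  rewrite -mulrDl ler_wpM2r// /Q.
  have : 0 <= j ^+ 3 by rewrite exprn_ge0.
  have : 0 <= j ^+ 4 by rewrite exprn_ge0.
  lra.
have -> : v ^+ 4 / r ^+ 4 - 6 * v ^+ 2 / r ^+ 3 + 3 / r ^+ 2 =
   1 * v ^+ 4 / r ^+ 4 - 6 * v ^+ 2 / r ^+ 3 + 3 * v ^+ 0 / r ^+ 2.
  by rewrite expr0 mul1r mulr1.
apply: le_trans (ler_normD _ _) _.
have v40 : 0 <= v ^+ 4 by rewrite e4 exprn_ge0.
apply: le_trans (lerD (le_trans (ler_normB _ _) (lerD (t1 4%N 4%N 1 _ _) (t1 2%N 3%N 6 _ _))) (t1 0%N 2%N 3 _ _)) _ => //.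
  by rewrite e4 lerDr.
  by rewrite expr0 lerDl.
rewrite -!mulrDl ler_wpM2r// /Q.
have : 0 <= j ^+ 3 by rewrite exprn_ge0.
have : 0 <= j ^+ 4 by rewrite exprn_ge0.
lra.
Qed.

(** The expansion is made in space at variance [r - U], then in time from [r - U] to [r]. By the
    heat equation the time term is U/2 times [heat2], so it combines with the second-order space
    term into the single factor h^2 - U. *)
Lemma heat_symmetric_step r0 M : 0 < r0 -> exists2 C, 0 <= C &
  forall r v h U, r0 <= r - U -> r <= M -> 0 <= U -> 0 <= h <= 1 ->
  `|(heat (r - U) (v + h) + heat (r - U) (v - h)) / 2 - heat r v
    - (h ^+ 2 - U) / 2 * heat2 r v|
  <= C * (h ^+ 3 + h ^+ 2 * U + U ^+ 2) * expR (- (v ^+ 2 / (8 * M))).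
Proof.
move=> r00; have [C C0 CB] := heat34_bound M r00.
(* If |t - v| <= 1 then v^2 <= 2 t^2 + 2: recentring the Gaussian bound from t to v doubles the
   variance and costs this factor. *)
exists (C * expR (4 * M)^-1); first by rewrite mulr_ge0 ?expR_ge0.
move=> r v h U r0rU rM U0 /andP[h0 h1].
have rp : 0 < r by lra.
have Mp : 0 < M by lra.
set E := expR (- (v ^+ 2 / (8 * M))).
set C' := C * expR (4 * M)^-1.
have nearE t : `|t - v| <= h -> C * expR (- (t ^+ 2 / (4 * M))) <= C' * E.
  move=> tv; rewrite /C' -mulrA ler_wpM2l// /E -expRD ler_expR.
  have -> : (4 * M)^-1 - v ^+ 2 / (8 * M) = - ((v ^+ 2 / 2 - 1) / (4 * M)).
    by field; rewrite gt_eqF.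
  rewrite lerN2 ler_wpM2r ?invr_ge0 ?mulr_ge0 ?(ltW Mp)//.
  have tv2 : (t - v) ^+ 2 <= 1.
    rewrite -real_normK ?num_real// (le_trans _ (_ : h ^+ 2 <= 1))//.
      by rewrite lerXn2r ?nnegrE.
    by rewrite exprn_ile1.
  have : 0 <= (v + 2 * (t - v)) ^+ 2 by rewrite sqr_ge0.
  move: tv2; rewrite !expr2 => tv2; nra.
have C'E0 : 0 <= C' * E by rewrite !mulr_ge0 ?expR_ge0.
have T1 : `|(heat (r - U) (v + h) + heat (r - U) (v - h)) / 2 - heat (r - U) v
     - h ^+ 2 / 2 * heat2 (r - U) v| <= C' * E * h ^+ 3.
  have rU : 0 < r - U by lra.
  apply: (@symmetric_taylor2 R (heat (r - U)) (heat1 (r - U)) (heat2 (r - U)) (heat3 (r - U))) => //.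
  - by move=> t _; exact: is_derive_heat_space.
  - by move=> t _; exact: is_derive_heat1_space.
  - by move=> t _; exact: is_derive_heat2_space.
  - move=> t tvh; have [|B _] := CB (r - U) t; first by lra.
    apply: le_trans B _; apply: nearE; rewrite ler_norml; lra.
have T2 s : r - U <= s <= r -> `|heat2 r v - heat2 s v| <= C' * E * (r - s).
  move=> sr; apply: (@abs_increment_le _ (heat2^~ v) (fun s => heat4 s v / 2)); first lra.
  - by move=> t tsr; apply: is_derive_heat2_time; lra.
  - move=> t tsr; have [|_ B] := CB t v; first by lra.
    have i2 : `|2^-1 : R| = 2^-1 by rewrite ger0_norm// invr_ge0.
    rewrite normrM i2; have := nearE v; rewrite subrr normr0 => /(_ h0).
    by move: B; have := normr_ge0 (heat4 t v); lra.
(* The tangent at [r] is subtracted from the time dependence; the slope left over is bounded by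
   [T2]. *)
have T3 : `|(heat r v - r * (heat2 r v / 2)) - (heat (r - U) v - (r - U) * (heat2 r v / 2))|
    <= C' * E * U * (r - (r - U)).
  apply: (@abs_increment_le _ (fun s => heat s v - s * (heat2 r v / 2))
    (fun s => heat2 s v / 2 - heat2 r v / 2)); first lra.
  - move=> t tsr; have t0 : 0 < t by lra.
    have D := is_derive_heat_time v t0.
    by apply: is_derive_eq; rewrite /GRing.scale/=; ring.
  - move=> t tsr; have -> : heat2 t v / 2 - heat2 r v / 2 = - ((heat2 r v - heat2 t v) / 2) by ring.
    have i2 : `|2^-1 : R| = 2^-1 by rewrite ger0_norm// invr_ge0.
    rewrite normrN normrM i2; have := T2 _ tsr.
    have : C' * E * (r - t) <= C' * E * U by rewrite ler_wpM2l//; lra.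
    have := normr_ge0 (heat2 r v - heat2 t v); lra.
have {}T2 : `|h ^+ 2 / 2 * (heat2 r v - heat2 (r - U) v)| <= C' * E * (h ^+ 2 * U).
  have h2 : 0 <= h ^+ 2 by rewrite sqr_ge0.
  rewrite normrM ger0_norm ?divr_ge0//.
  have -> : C' * E * (h ^+ 2 * U) = h ^+ 2 * (C' * E * (r - (r - U))) by ring.
  apply: ler_pM; rewrite ?divr_ge0//; first lra.
  by apply: T2; lra.
set X := (X in `|X| <= _).
have -> : X = ((heat (r - U) (v + h) + heat (r - U) (v - h)) / 2 - heat (r - U) v
     - h ^+ 2 / 2 * heat2 (r - U) v) - (h ^+ 2 / 2 * (heat2 r v - heat2 (r - U) v)) -
   ((heat r v - r * (heat2 r v / 2)) - (heat (r - U) v - (r - U) * (heat2 r v / 2))).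
  by rewrite /X; ring.
apply: le_trans (ler_normB _ _) _.
apply: le_trans (lerD (le_trans (ler_normB _ _) (lerD T1 T2)) T3) _.
by rewrite le_eqVlt; apply/orP; left; apply/eqP; ring.
Qed.

End heat_kernel.

(** * Measurability of elementary functions *)

Section measurability.
Context d (T : measurableType d) {R : realType}.
Implicit Types f g : T -> R.

(** On nonnegative reals the inverse is the power of exponent -1, a measurable function; negative
    values follow by oddness. *)
Lemma measurable_fun_inv f : measurable_fun setT f ->
  measurable_fun setT (fun x => (f x)^-1).
Proof.
move=> mf.
have -> : (fun x => (f x)^-1) =
    (fun x => if 0 <= f x then f x `^ (-1) else - ((- f x) `^ (-1))).
  apply/funext => x; case: leP => fx; first by rewrite powR_inv1.
  by rewrite powR_inv1 ?oppr_ge0 ?ltW// invrN opprK.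
apply: measurable_fun_ifT.
- by apply: measurable_fun_ler => //; exact: measurable_cst.
- exact: (@measurableT_comp _ _ _ T _ _ _ setT f (measurable_powR (-1)) mf).
- apply: measurable_funN; have mNf := measurable_funN mf.
  exact: (@measurableT_comp _ _ _ T _ _ _ setT _ (measurable_powR (-1)) mNf).
Qed.

Lemma measurable_fun_expR f : measurable_fun setT f ->
  measurable_fun setT (fun x => expR (f x)).
Proof. by move=> mf; exact: measurableT_comp. Qed.

Lemma measurable_fun_ln f : measurable_fun setT f ->
  measurable_fun setT (fun x => ln (f x)).
Proof. by move=> mf; exact: measurableT_comp. Qed.

Lemma measurable_fun_norm f : measurable_fun setT f ->
  measurable_fun setT (fun x => `|f x|).
Proof. exact: measurableT_comp. Qed.

Lemma measurable_fun_sqrt f : measurable_fun setT f ->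
  measurable_fun setT (fun x => Num.sqrt (f x)).
Proof.
move=> mf.
have -> : (fun x => Num.sqrt (f x)) = (fun x => if 0 <= f x then f x `^ (2^-1) else 0).
  apply/funext => x; case: leP => fx; first by rewrite powR12_sqrt.
  by rewrite ltr0_sqrtr.
apply: measurable_fun_ifT; last exact: measurable_cst.
- by apply: measurable_fun_ler => //; exact: measurable_cst.
- exact: (@measurableT_comp _ _ _ T _ _ _ setT f (measurable_powR (2^-1)) mf).
Qed.

End measurability.

Ltac measurability := repeat
  match goal with
  | |- measurable_fun _ (fun x => (_)%:E) => apply/measurable_EFinP
  | |- measurable_fun _ (EFin \o _) => apply/measurable_EFinP
  | |- measurable_fun _ (fun x => _ - _) => apply: measurable_funB
  | |- measurable_fun _ (fun x => _ + _) => apply: measurable_funD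
  | |- measurable_fun _ (fun x => _ * _) => apply: measurable_funM
  | |- measurable_fun _ (fun x => - _) => apply: measurable_funN
  | |- measurable_fun _ (fun x => _ ^+ _) => apply: measurable_funX
  | |- measurable_fun _ (fun x => _^-1) => apply: measurable_fun_inv
  | |- measurable_fun _ (fun x => expR _) => apply: measurable_fun_expR
  | |- measurable_fun _ (fun x => ln _) => apply: measurable_fun_ln
  | |- measurable_fun _ (fun x => `|_|) => apply: measurable_fun_norm
  | |- measurable_fun _ (fun x => Num.sqrt _) => apply: measurable_fun_sqrt
  | |- _ => first [assumption | exact: measurable_cst | exact: measurable_id
        | exact: measurable_fst | exact: measurable_snd ]
  end.

Lemma measurable_heat d (T : measurableType d) {R : realType} (f g : T -> R) :
  measurable_fun setT f -> measurable_fun setT g ->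
  measurable_fun setT (fun x => heat (f x) (g x)).
Proof. by move=> mf mg; rewrite /heat; measurability. Qed.

(** * Gaussian domination *)

Section gaussian_bounds.
Context {R : realType}.
Implicit Types (r v k M y z : R).
Local Notation mu := (@lebesgue_measure R).

(** Splits off half of the exponent: this half absorbs exponential and polynomial weights, while the
    rest is again a probability density, of variance 2r. *)
Lemma heat_double r v : 0 < r ->
  heat r v = expR (ln 2 / 2) * expR (- (v ^+ 2 / (4 * r))) * heat (2 * r) v.
Proof.
move=> r0; rewrite /heat lnM ?posrE// mulrCA mulrA -mulrA -!expRD.
by congr (_ * expR _); field; rewrite gt_eqF.
Qed.

(** Completing the square, k|v| <= v^2 / (4r) + k^2 r, and the first term is the half exponent split
    off by [heat_double]. *)
Lemma expR_heat_le k M : exists2 C, 0 <= C &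
  forall r v, 0 < r <= M -> expR (k * `|v|) * heat r v <= C * heat (2 * r) v.
Proof.
exists (expR (ln 2 / 2 + k ^+ 2 * M)) => [|r v /andP[r0 rM]]; first exact: expR_ge0.
rewrite heat_double//; move: (heat (2 * r) v) (heat_ge0 (2 * r) v) => h h0.
rewrite !mulrA ler_wpM2r// -!expRD ler_expR.
have k2 : k ^+ 2 * r <= k ^+ 2 * M by rewrite ler_wpM2l ?sqr_ge0.
suff : k * `|v| <= v ^+ 2 / (4 * r) + k ^+ 2 * r by lra.
rewrite -subr_ge0 -[v ^+ 2]real_normK ?num_real//.
have -> : `|v| ^+ 2 / (4 * r) + k ^+ 2 * r - k * `|v| =
    (`|v| - 2 * k * r) ^+ 2 / (4 * r) by field; rewrite gt_eqF.
by rewrite divr_ge0 ?sqr_ge0// mulr_ge0// ltW.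
Qed.

(** Put |v| = q sqrt(r). Of the available exponent q^2 / 4, one part q^2 / 8 absorbs k|v| and
    another q^2 / 16 absorbs q itself; what remains of |v| is the factor sqrt(r), the source of the
    rate sqrt(dl). *)
Lemma norm_expR_heat_le k M : exists2 C, 0 <= C &
  forall r v, 0 < r <= M ->
    `|v| * expR (k * `|v|) * heat r v <= C * Num.sqrt r * heat (2 * r) v.
Proof.
exists (4 * expR (ln 2 / 2 + 2 * k ^+ 2 * M)) => [|r v /andP[r0 rM]].
  by rewrite mulr_ge0 ?expR_ge0.
have s0 : 0 < Num.sqrt r by rewrite sqrtr_gt0.
rewrite heat_double//; move: (heat (2 * r) v) (heat_ge0 (2 * r) v) => h h0.
rewrite !mulrA ler_wpM2r//.
pose q := `|v| / Num.sqrt r.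
have q0 : 0 <= q by rewrite divr_ge0// ltW.
have -> : `|v| = q * Num.sqrt r by rewrite /q divfK// gt_eqF.
have -> : v ^+ 2 / (4 * r) = q ^+ 2 / 4.
  rewrite -[v ^+ 2]real_normK ?num_real// -[in LHS](sqr_sqrtr (ltW r0)) /q.
  by field; rewrite gt_eqF.
clearbody q.
have qe : q <= 4 * expR (q ^+ 2 / 16).
  have := expR_ge1Dx (q ^+ 2 / 16).
  have : 0 <= (q / 2 - 1) ^+ 2 by rewrite sqr_ge0.
  rewrite !expr2; nra.
have k2 : k ^+ 2 * r <= k ^+ 2 * M by rewrite ler_wpM2l ?sqr_ge0.
have ke : k * (q * Num.sqrt r) <= q ^+ 2 / 8 + 2 * (k ^+ 2 * r).
  have -> : k ^+ 2 * r = k ^+ 2 * Num.sqrt r ^+ 2 by rewrite sqr_sqrtr ?ltW.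
  rewrite -subr_ge0.
  have -> : q ^+ 2 / 8 + 2 * (k ^+ 2 * Num.sqrt r ^+ 2) - k * (q * Num.sqrt r) =
    (q - 4 * k * Num.sqrt r) ^+ 2 / 8 by field.
  by rewrite divr_ge0 ?sqr_ge0.
rewrite -!mulrA -!expRD [X in _ <= 4 * X]mulrC mulrA -[q * _]mulrC -!mulrA.
rewrite [leRHS]mulrCA ler_wpM2l ?(ltW s0)//.
apply: le_trans (_ : 4 * expR (q ^+ 2 / 16) * _ <= _).
  by apply: ler_wpM2r qe; exact: expR_ge0.
rewrite -mulrA -expRD ler_wpM2l// ler_expR.
have := sqr_ge0 q; rewrite !expr2; lra.
Qed.

(** Rewrites the Gaussian remainder of the Taylor step, weighted by the growth of [g], as a multiple
    of a density, so that it can be integrated over the line. *)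
Lemma expR_gauss_le k M : 0 < M -> exists2 C, 0 <= C &
  forall v, expR (k * `|v|) * expR (- (v ^+ 2 / (8 * M))) <= C * heat (8 * M) v.
Proof.
move=> M0; pose s := Num.sqrt (pi *+ 2 : R).
have s0 : 0 < s by rewrite sqrtr_gt0 mulrn_wgt0// pi_gt0.
exists (s * expR (ln (8 * M) / 2 + 4 * k ^+ 2 * M)) => [|v].
  by rewrite mulr_ge0 ?expR_ge0 ?ltW.
rewrite /heat -/s mulrACA divff ?gt_eqF// mul1r -!expRD ler_expR.
suff : k * `|v| <= v ^+ 2 / (16 * M) + 4 * k ^+ 2 * M.
  have -> : v ^+ 2 / (2 * (8 * M)) = v ^+ 2 / (16 * M) by rewrite mulrA; congr (_ / (_ * _)); ring.
  have -> : v ^+ 2 / (8 * M) = 2 * (v ^+ 2 / (16 * M)) by field; rewrite gt_eqF.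
  lra.
rewrite -subr_ge0 -[v ^+ 2]real_normK ?num_real//.
have -> : `|v| ^+ 2 / (16 * M) + 4 * k ^+ 2 * M - k * `|v| =
    (`|v| - 8 * k * M) ^+ 2 / (16 * M) by field; rewrite gt_eqF.
by rewrite divr_ge0 ?sqr_ge0// mulr_ge0// ltW.
Qed.

Lemma integral_heat r z (c : R) : 0 < r -> 0 <= c ->
  (\int[mu]_y (c * heat r (y - z))%:E = c%:E)%E.
Proof.
move=> r0 c0.
under eq_integral do rewrite EFinM heatE//.
rewrite ge0_integralZl_EFin//=.
- by rewrite integral_normal_pdf mule1.
- by move=> y _; rewrite lee_fin normal_pdf_ge0.
- by apply/measurable_EFinP; exact: measurable_normal_pdf.
Qed.

End gaussian_bounds.

(** * Heat semigroup and potential *)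

Section smoothing.
Context {R : realType}.
Local Notation mu := (@lebesgue_measure R).
Variables (g : R -> R) (K k : R).
Hypotheses (mg : measurable_fun setT g) (g_ge0 : forall y, 0 <= g y).
Hypotheses (K_ge0 : 0 <= K) (k_ge0 : 0 <= k).
Hypothesis g_growth : forall y, g y <= K * expR (k * `|y|).
Hypothesis g_lip : forall y z,
  `|g y - g z| <= K * `|y - z| * expR (k * (`|z| + `|y - z|)).

(* E g(z + B_r) for a Brownian motion B. *)
Definition smooth (r z : R) : \bar R := (\int[mu]_y (g y * heat r (y - z))%:E)%E.

Lemma smooth_ge0 r z : (0 <= smooth r z)%E.
Proof. by apply: integral_ge0 => y _; rewrite lee_fin mulr_ge0 ?heat_ge0. Qed.

Lemma measurable_smooth d (T : measurableType d) (f h : T -> R) :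
  measurable_fun setT f -> measurable_fun setT h ->
  measurable_fun setT (fun x => smooth (f x) (h x)).
Proof.
move=> mf mh.
apply: (@measurable_fun_fubini_tonelli_F _ _ _ _ _ mu
  (fun p : T * R => (g p.2 * heat (f p.1) (p.2 - h p.1))%:E)).
  measurability; first by exact: measurableT_comp.
  apply: measurable_heat; first exact: measurableT_comp.
  by measurability; exact: measurableT_comp.
by move=> p; rewrite lee_fin mulr_ge0 ?heat_ge0.
Qed.

Lemma measurable_smooth_integrand r z :
  measurable_fun setT (fun y => (g y * heat r (y - z))%:E).
Proof. by measurability => //; apply: measurable_heat; measurability. Qed.

Lemma growth_shift y z : g y <= K * expR (k * `|z|) * expR (k * `|y - z|).
Proof.
apply: le_trans (g_growth y) _.
rewrite -mulrA -expRD ler_wpM2l// ler_expR -mulrDr ler_wpM2l//.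
by rewrite -[X in `|X| <= _](subrK z) addrC ler_normD.
Qed.

Lemma smooth_growth M : exists2 C, 0 <= C &
  forall r z, 0 < r <= M -> (smooth r z <= (C * expR (k * `|z|))%:E)%E.
Proof.
have [C C0 CB] := expR_heat_le k M.
exists (K * C) => [|r z rM]; first by rewrite mulr_ge0.
have r0 : 0 < r by case/andP: rM.
rewrite -(@integral_heat _ (2 * r) z); last 2 first.
- by rewrite mulr_gt0.
- by rewrite !mulr_ge0 ?expR_ge0.
apply: ge0_le_integral => //.
- by move=> y _; rewrite lee_fin mulr_ge0 ?heat_ge0.
- exact: measurable_smooth_integrand.
- by measurability; apply: measurable_heat; measurability.
- move=> y _; rewrite lee_fin.
  apply: le_trans (ler_wpM2r (heat_ge0 _ _) (growth_shift y z)) _.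
  rewrite -[leLHS]mulrA (_ : K * C * _ * _ = K * expR (k * `|z|) * (C * heat (2 * r) (y - z)));
    last by ring.
  by rewrite ler_wpM2l ?mulr_ge0 ?expR_ge0// CB.
Qed.

(** Moving from z to z + B_r costs E|B_r| by the local Lipschitz bound, hence sqrt(r). The estimate
    is stated as two additive inequalities, as are the later ones, because the values are extended
    reals and are not yet known to be finite. *)
Lemma smooth_approx M : exists2 C, 0 <= C &
  forall r z, 0 < r <= M ->
    (smooth r z <= (g z + C * Num.sqrt r * expR (k * `|z|))%:E)%E /\
    ((g z)%:E <= smooth r z + (C * Num.sqrt r * expR (k * `|z|))%:E)%E.
Proof.
have [C C0 CB] := norm_expR_heat_le k M.
exists (K * C) => [|r z rM]; first by rewrite mulr_ge0.
have r0 : 0 < r by case/andP: rM.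
pose e := K * C * Num.sqrt r * expR (k * `|z|).
have e0 : 0 <= e by rewrite !mulr_ge0 ?expR_ge0 ?sqrtr_ge0.
have diff y : `|g y * heat r (y - z) - g z * heat r (y - z)| <= e * heat (2 * r) (y - z).
  rewrite -mulrBl normrM (ger0_norm (heat_ge0 _ _)).
  apply: le_trans (ler_wpM2r (heat_ge0 _ _) (g_lip y z)) _.
  rewrite mulrDr expRD (_ : K * _ * _ * _ = K * expR (k * `|z|) *
    (`|y - z| * expR (k * `|y - z|) * heat r (y - z))); last by ring.
  rewrite /e (_ : K * C * _ * _ * _ = K * expR (k * `|z|) *
    (C * Num.sqrt r * heat (2 * r) (y - z))); last by ring.
  by rewrite ler_wpM2l ?mulr_ge0 ?expR_ge0// CB.
have r20 : 0 < 2 * r by rewrite mulr_gt0.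
have mh (s c : R) : measurable_fun setT (fun y : R => (c * heat s (y - z))%:E).
  by measurability; apply: measurable_heat; measurability.
have mI := measurable_smooth_integrand r z.
split.
- rewrite EFinD -(integral_heat z r0 (g_ge0 z)) -(integral_heat z r20 e0).
  rewrite -ge0_integralD//; try exact: mh; try exact: mI;
    try by move=> y _; rewrite lee_fin mulr_ge0 ?heat_ge0.
  apply: ge0_le_integral => //; try exact: mh; try exact: mI.
  + by move=> y _; rewrite lee_fin mulr_ge0 ?heat_ge0.
  + by apply: emeasurable_funD; [first [exact: mh|exact: mI]|exact: mh].
  + move=> y _; rewrite -EFinD lee_fin.
    have := diff y; rewrite ler_norml => /andP[_]; lra.
- rewrite -(integral_heat z r0 (g_ge0 z)) -(integral_heat z r20 e0).
  rewrite /smooth -ge0_integralD//; try exact: mh; try exact: mI;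
    try by move=> y _; rewrite lee_fin mulr_ge0 ?heat_ge0.
  apply: ge0_le_integral => //; try exact: mh; try exact: mI.
  + by move=> y _; rewrite lee_fin mulr_ge0 ?heat_ge0.
  + by apply: emeasurable_funD; [first [exact: mh|exact: mI]|exact: mh].
  + move=> y _; rewrite -EFinD lee_fin.
    have := diff y; rewrite ler_norml => /andP[+ _].
    lra.
Qed.

End smoothing.

(** * Averaging the heat semigroup over one random step *)

Section noise_step.
Context {R : realType} {d} {Xi : measurableType d} (Q : probability Xi R).
Local Notation mu := (@lebesgue_measure R).
Implicit Types (f h : Xi -> R).

Lemma integrable_of_bound f B : measurable_fun setT f ->
  (forall x, `|f x| <= B) -> Q.-integrable setT (EFin \o f).
Proof.
move=> mf fB; apply: measurable_bounded_integrable => //.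
  by rewrite (le_lt_trans (probability_le1 Q _)) ?ltry.
by exists B; split; [exact: num_real|move=> y By x _; exact: le_trans (fB x) (ltW By)].
Qed.

Lemma integral_cst_add h B c : measurable_fun setT h ->
  (forall x, `|h x| <= B) -> (\int[Q]_x (h x)%:E = 0)%E ->
  (\int[Q]_x (c + h x)%:E = c%:E)%E.
Proof.
move=> mh hB h0.
rewrite (_ : \int[Q]_x (c + h x)%:E = \int[Q]_x ((EFin \o cst c) x + (EFin \o h) x))%E//.
have ic : Q.-integrable setT (EFin \o cst c) by apply: (@integrable_of_bound _ `|c|).
rewrite integralD_EFin//; last exact: integrable_of_bound hB.
rewrite h0 adde0 (eq_integral (cst c%:E))//.
rewrite integral_cst//. rewrite [X in (_ * X)%E]probability_setT ?mule1.
by []. 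
Qed.

(** A centred term [h] disappears under the integral. It will be the second-order term of the
    expansion, proportional to a^2 - b. *)
Lemma le_integral_cst_add f h B B' c : measurable_fun setT f -> measurable_fun setT h ->
  (forall x, `|f x| <= B) -> (forall x, `|h x| <= B') ->
  (\int[Q]_x (h x)%:E = 0)%E -> (forall x, f x <= c + h x) ->
  (\int[Q]_x (f x)%:E <= c%:E)%E.
Proof.
move=> mf mh fB hB h0 fch.
rewrite -(integral_cst_add c mh hB h0); apply: le_integral => //.
- exact: integrable_of_bound fB.
- apply: (@integrable_of_bound (fun x => c + h x) (`|c| + B')).
    by measurability.
  by move=> x; rewrite (le_trans (ler_normD _ _))// lerD2l.
- by move=> x _; rewrite lee_fin.
Qed.

Lemma ge_integral_cst_add f h B B' c : measurable_fun setT f -> measurable_fun setT h ->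
  (forall x, `|f x| <= B) -> (forall x, `|h x| <= B') ->
  (\int[Q]_x (h x)%:E = 0)%E -> (forall x, c + h x <= f x) ->
  (c%:E <= \int[Q]_x (f x)%:E)%E.
Proof.
move=> mf mh fB hB h0 fch.
rewrite -(integral_cst_add c mh hB h0); apply: le_integral => //.
- apply: (@integrable_of_bound (fun x => c + h x) (`|c| + B')).
    by measurability.
  by move=> x; rewrite (le_trans (ler_normD _ _))// lerD2l.
- exact: integrable_of_bound fB.
- by move=> x _; rewrite lee_fin.
Qed.

Variables (a b : Xi -> R).
Hypotheses (ma : measurable_fun setT a) (mb : measurable_fun setT b).
Hypotheses (a01 : forall x, 0 <= a x <= 1) (b03 : forall x, 0 <= b x <= 3).
Hypothesis ab : (\int[Q]_x (a x ^+ 2)%:E = \int[Q]_x (b x)%:E)%E.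

Lemma integral_variance_defect (c : R) :
  (\int[Q]_x ((a x ^+ 2 - b x) * c)%:E = 0)%E.
Proof.
have a1 x : `|a x ^+ 2| <= 1.
  by rewrite ger0_norm ?sqr_ge0// exprn_ile1//; case/andP: (a01 x).
have b3 x : `|b x| <= 3 by rewrite ger0_norm; case/andP: (b03 x).
have i1 : Q.-integrable setT (EFin \o (fun x => a x ^+ 2)).
  by apply: integrable_of_bound a1; measurability.
have i2 : Q.-integrable setT (EFin \o b) by exact: integrable_of_bound b3.
have i12 : Q.-integrable setT (EFin \o (fun x => a x ^+ 2 - b x)).
  exact: (integrableB measurableT i1 i2).
under eq_integral do rewrite EFinM muleC.
rewrite integralZl//= (_ : \int[Q]_x (a x ^+ 2 - b x)%:E = 0)%E ?mule0//.
under eq_integral do rewrite EFinB.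
rewrite integralB_EFin// ab subee//.
exact: integrable_fin_num.
Qed.

(** Here [v] stands for y - z, so that a move of z to the right shifts [v] to the left; the average
    over the two signs is unaffected. *)
Definition heat_average (r v th : R) (x : Xi) : R :=
  (heat (r - b x * th ^+ 2) (v + a x * th) + heat (r - b x * th ^+ 2) (v - a x * th)) / 2.

Lemma heat_average_ge0 r v th x : 0 <= heat_average r v th x.
Proof. by rewrite divr_ge0 ?addr_ge0 ?heat_ge0. Qed.

Lemma heat_average_le r0 M : 0 < r0 -> exists2 C, 0 <= C &
  forall r v th, r0 <= r - 3 * th ^+ 2 -> r <= M -> 0 <= th <= 1 ->
  let e := C * th ^+ 3 * expR (- (v ^+ 2 / (8 * M))) in
  (\int[Q]_x (heat_average r v th x)%:E <= (heat r v + e)%:E)%E /\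
  ((heat r v)%:E <= \int[Q]_x (heat_average r v th x)%:E + e%:E)%E.
Proof.
move=> r00; have [C C0 CB] := heat_symmetric_step M r00.
(* 13 = 1 + 3 + 9 collects the bounds of a^3, a^2 b and b^2, for a <= 1, b <= 3 and th^4 <= th^3. *)
exists (C * 13) => [|r v th r0r rM /andP[th0 th1] e]; first by rewrite mulr_ge0.
have t2 : 0 <= th ^+ 2 by rewrite sqr_ge0.
pose h x := (a x ^+ 2 - b x) * (th ^+ 2 / 2 * heat2 r v).
have key x : `|heat_average r v th x - heat r v - h x| <= e.
  have /andP[a0 a1] := a01 x; have /andP[b0 b3] := b03 x.
  have bth : b x * th ^+ 2 <= 3 * th ^+ 2 by rewrite ler_wpM2r.
  have := CB r v (a x * th) (b x * th ^+ 2).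
  rewrite (_ : ((a x * th) ^+ 2 - b x * th ^+ 2) / 2 * heat2 r v = h x); last by rewrite /h; ring.
  move=> /(_ _ rM) H; apply: le_trans (H _ _ _) _ => //.
  - lra.
  - by rewrite mulr_ge0.
  - by rewrite mulr_ge0//= mulr_ile1.
  rewrite /e ler_wpM2r ?expR_ge0// -mulrA ler_wpM2l//.
  have th3 : 0 <= th ^+ 3 by rewrite exprn_ge0.
  have th4 : th ^+ 4 <= th ^+ 3 by rewrite exprS ler_piMl.
  have a2 : 0 <= a x ^+ 2 <= 1 by rewrite sqr_ge0 exprn_ile1.
  have a3 : a x ^+ 3 <= 1 by rewrite exprn_ile1.
  have b2 : b x ^+ 2 <= 9 by rewrite (_ : 9 = 3 ^+ 2 :> R) ?lerXn2r ?nnegrE// -natrX.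
  have ab3 : a x ^+ 2 * b x <= 3.
    case/andP: a2 => _ a2; have := ler_wpM2r b0 a2; lra.
  have -> : (a x * th) ^+ 3 + (a x * th) ^+ 2 * (b x * th ^+ 2) + (b x * th ^+ 2) ^+ 2 =
    a x ^+ 3 * th ^+ 3 + a x ^+ 2 * b x * th ^+ 4 + b x ^+ 2 * th ^+ 4 by ring.
  have th40 : 0 <= th ^+ 4 by rewrite exprn_ge0.
  have := ler_wpM2r th3 a3; have := ler_wpM2r th40 ab3; have := ler_wpM2r th40 b2.
  lra.
have mh : measurable_fun setT h by rewrite /h; measurability.
have mA : measurable_fun setT (heat_average r v th).
  rewrite /heat_average; measurability; apply: measurable_heat; measurability.
pose B := 4 * (th ^+ 2 / 2 * `|heat2 r v|).
have hB x : `|h x| <= B.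
  rewrite /h normrM /B (normrM _ (heat2 _ _)) (ger0_norm (divr_ge0 t2 _))//.
  rewrite ler_wpM2r ?mulr_ge0//.
  have /andP[a0 a1] := a01 x; have /andP[b0 b3] := b03 x.
  have a2 : 0 <= a x ^+ 2 <= 1 by rewrite sqr_ge0 exprn_ile1.
  by rewrite ler_norml; lra.
have e0 : 0 <= e by rewrite /e !mulr_ge0 ?expR_ge0 ?exprn_ge0.
have AB x : `|heat_average r v th x| <= e + heat r v + B.
  have h2 := hB x; have := key x.
  by rewrite !ler_norml in h2 *; have := heat_average_ge0 r v th x; have := heat_ge0 r v; lra.
have h0 := integral_variance_defect (th ^+ 2 / 2 * heat2 r v).
split.
- apply: le_integral_cst_add mA mh AB hB h0 _ => x.
  by have := key x; rewrite ler_norml; lra.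
- have : ((heat r v - e)%:E <= \int[Q]_x (heat_average r v th x)%:E)%E.
    apply: ge_integral_cst_add mA mh AB hB h0 _ => x.
    by have := key x; rewrite ler_norml; lra.
  by rewrite EFinB leeBlDr.
Qed.

Variables (g : R -> R) (K k : R).
Hypotheses (mg : measurable_fun setT g) (g_ge0 : forall y, 0 <= g y).
Hypotheses (K_ge0 : 0 <= K) (k_ge0 : 0 <= k).
Hypothesis g_growth : forall y, g y <= K * expR (k * `|y|).

Definition smooth_average (r z th : R) : \bar R :=
  (\int[Q]_x ((2^-1)%:E * (smooth g (r - b x * th ^+ 2) (z + a x * th) +
                          smooth g (r - b x * th ^+ 2) (z - a x * th))))%E.

(** Tonelli's theorem moves the random step from the argument z on to the kernel, to which Taylor's
    formula applies. *)
Lemma smooth_averageE r z th : smooth_average r z th =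
  (\int[mu]_y ((g y)%:E * \int[Q]_x (heat_average r (y - z) th x)%:E))%E.
Proof.
pose F (p : Xi * R) := (g p.2 * heat_average r (p.2 - z) th p.1)%:E.
have F0 p : (0 <= F p)%E by rewrite lee_fin mulr_ge0// heat_average_ge0.
have mA : measurable_fun setT (fun p : Xi * R => heat_average r (p.2 - z) th p.1).
  rewrite /heat_average.
  have ma' : measurable_fun setT (fun p : Xi * R => a p.1) by exact: measurableT_comp.
  have mb' : measurable_fun setT (fun p : Xi * R => b p.1) by exact: measurableT_comp.
  by measurability; apply: measurable_heat; measurability.
have mF : measurable_fun setT F.
  have mg' : measurable_fun setT (fun p : Xi * R => g p.2) by exact: measurableT_comp.
  by rewrite /F; measurability.
transitivity (\int[Q]_x \int[mu]_y F (x, y))%E.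
  apply: eq_integral => x _.
  have mI s w : measurable_fun setT (fun y : R => (g y * heat s (y - w))%:E).
    exact: measurable_smooth_integrand.
  have I0 s w y : (0 <= (g y * heat s (y - w))%:E)%E by rewrite lee_fin mulr_ge0 ?heat_ge0.
  rewrite /smooth -ge0_integralD//; try exact: mI.
  rewrite -ge0_integralZl_EFin//; last 2 first.
  - by move=> y _; rewrite adde_ge0.
  - by apply: emeasurable_funD; exact: mI.
  apply: eq_integral => y _; rewrite -EFinD -EFinM /F /heat_average/=; congr EFin.
  have -> : y - (z + a x * th) = y - z - a x * th by ring.
  have -> : y - (z - a x * th) = y - z + a x * th by ring.
  by field.
etransitivity; first exact: (@fubini_tonelli _ _ _ _ _ Q mu F mF F0).
apply: eq_integral => y _.
rewrite -ge0_integralZl_EFin//.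
  by move=> x _; rewrite lee_fin heat_average_ge0.
apply/measurable_EFinP.
rewrite /heat_average.
by measurability; apply: measurable_heat; measurability.
Qed.

Lemma smooth_average_le r0 M : 0 < r0 -> 0 < M -> exists2 C, 0 <= C &
  forall r z th, r0 <= r - 3 * th ^+ 2 -> r <= M -> 0 <= th <= 1 ->
  let e := C * th ^+ 3 * expR (k * `|z|) in
  (smooth_average r z th <= smooth g r z + e%:E)%E /\
  (smooth g r z <= smooth_average r z th + e%:E)%E.
Proof.
move=> r00 M0; have [C C0 CB] := heat_average_le M r00.
have [D D0 DB] := expR_gauss_le k M0.
exists (K * C * D) => [|r z th r0r rM th01 e]; first by rewrite !mulr_ge0.
have th3 : 0 <= th ^+ 3 by rewrite exprn_ge0//; case/andP: th01.
have e0 : 0 <= e.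
  by apply: mulr_ge0; [apply: mulr_ge0 => //; rewrite !mulr_ge0|exact: expR_ge0].
have M80 : 0 < 8 * M by rewrite mulr_gt0.
have mh (c s : R) : measurable_fun setT (fun y : R => (c * heat s (y - z))%:E).
  by measurability; apply: measurable_heat; measurability.
have mA : measurable_fun setT
   (fun y : R => (g y)%:E * \int[Q]_x (heat_average r (y - z) th x)%:E)%E.
  apply: emeasurable_funM; first exact/measurable_EFinP.
  apply: (@measurable_fun_fubini_tonelli_G _ _ _ _ _ Q
    (fun p : Xi * R => (heat_average r (p.2 - z) th p.1)%:E)).
    rewrite /heat_average.
    have ma' : measurable_fun setT (fun p : Xi * R => a p.1) by exact: measurableT_comp.
    have mb' : measurable_fun setT (fun p : Xi * R => b p.1) by exact: measurableT_comp.
    by measurability; apply: measurable_heat; measurability.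
  by move=> p; rewrite lee_fin heat_average_ge0.
have mI := measurable_smooth_integrand mg r z.
have A0 y : (0 <= \int[Q]_x (heat_average r (y - z) th x)%:E)%E.
  by apply: integral_ge0 => x _; rewrite lee_fin heat_average_ge0.
have eB y : g y * (C * th ^+ 3 * expR (- ((y - z) ^+ 2 / (8 * M)))) <= e * heat (8 * M) (y - z).
  apply: le_trans (ler_wpM2r _ (growth_shift K_ge0 k_ge0 g_growth y z)) _.
    by rewrite mulr_ge0 ?expR_ge0// mulr_ge0.
  rewrite [leLHS](_ : _ = K * C * th ^+ 3 * expR (k * `|z|) *
    (expR (k * `|y - z|) * expR (- ((y - z) ^+ 2 / (8 * M))))); last by ring.
  rewrite /e (_ : K * C * D * _ * _ * _ = K * C * th ^+ 3 * expR (k * `|z|) *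
    (D * heat (8 * M) (y - z))); last by ring.
  by rewrite ler_wpM2l ?DB// mulr_ge0 ?expR_ge0// mulr_ge0// mulr_ge0.
rewrite smooth_averageE -(integral_heat z M80 e0).
split.
- rewrite /smooth -ge0_integralD//; try exact: mh; try exact: mI;
    try by move=> y _; rewrite lee_fin mulr_ge0 ?heat_ge0.
  apply: ge0_le_integral => //; try exact: mA.
  + by move=> y _; rewrite mule_ge0 ?lee_fin.
  + by apply: emeasurable_funD; [exact: mI|exact: mh].
  + move=> y _; have [H _] := CB r (y - z) th r0r rM th01.
    apply: le_trans (lee_pmul _ _ (lexx (g y)%:E) H) _ => //; first by rewrite lee_fin.
    by rewrite -EFinM -EFinD lee_fin mulrDr lerD2l eB.
- rewrite /smooth -ge0_integralD//; try exact: mh; try exact: mA;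
    [| by move=> y _; rewrite mule_ge0 ?lee_fin
     | by move=> y _; rewrite lee_fin mulr_ge0 ?heat_ge0].
  apply: ge0_le_integral => //; try exact: mI.
  + by move=> y _; rewrite lee_fin mulr_ge0 ?heat_ge0.
  + by apply: emeasurable_funD; [exact: mA|exact: mh].
  + move=> y _; have [_ H] := CB r (y - z) th r0r rM th01.
    rewrite EFinM; apply: le_trans (lee_pmul _ _ (lexx (g y)%:E) H) _ => //; rewrite ?lee_fin ?heat_ge0//.
    rewrite ge0_muleDr//; last by rewrite lee_fin mulr_ge0 ?expR_ge0// mulr_ge0.
    by rewrite leeD2l// -EFinM lee_fin eB.
Qed.

End noise_step.

Section translation.
Context {R : realType}.
Local Notation mu := (@lebesgue_measure R).

(** The translated measure agrees with Lebesgue measure on half-open intervals, which determine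
    it. *)
Lemma lebesgue_measure_shift (c : R) (A : set R) : measurable A ->
  pushforward mu ((fun x => x - c) : measurableTypeR R -> measurableTypeR R) A = mu A.
Proof.
move=> mA; apply/esym/lebesgue_measure_unique => //=.
  by move=> _; apply: measurable_funB => //; exact: measurable_cst.
move=> mf _ [[a b]] _ <-.
rewrite /pushforward/= (_ : _ @^-1` _ = `]a + c, b + c]%classic); last first.
  by apply/seteqP; split => x /=; rewrite !in_itv/= ltrBrDr lerBlDr.
rewrite !lebesgue_measure_itv/= !lte_fin ltrD2r -!EFinB.
by rewrite (_ : b + c - (a + c) = b - a)//; ring.
Qed.

Lemma ge0_integral_shift (f : R -> \bar R) (a b c : R) :
  measurable_fun setT f -> (forall r, 0 <= f r)%E ->
  (\int[mu]_(r in `]a, b]) f (r - c)%R = \int[mu]_(r in `](a - c)%R, (b - c)%R]) f r)%E.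
Proof.
move=> mf f0.
have mphi : measurable_fun setT ((fun x => x - c) : measurableTypeR R -> measurableTypeR R).
  by apply: measurable_funB => //; exact: measurable_cst.
rewrite (_ : `]a, b]%classic = ((fun x => x - c) : measurableTypeR R -> measurableTypeR R)
    @^-1` `](a - c), (b - c)]); last first.
  by apply/seteqP; split => x /=; rewrite !in_itv/= ltrD2r lerD2r.
rewrite -(@ge0_integral_pushforward _ _ (measurableTypeR R) (measurableTypeR R) R _ mphi mu _ f)//.
  by apply: eq_measure_integral => //= A mA AS; exact: lebesgue_measure_shift.
exact: measurable_funTS.
Qed.

Lemma integral_cst_itvoc (a b c : R) : a <= b ->
  (\int[mu]_(r in `]a, b]) c%:E = ((b - a) * c)%:E)%E.
Proof.
move=> ab; rewrite integral_cst//= lebesgue_measure_itv/= lte_fin.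
rewrite le_eqVlt in ab; case/orP: ab => [/eqP ->|ab].
  by rewrite ltxx subrr mule0 mul0r.
by rewrite ab -EFinB -EFinM mulrC.
Qed.

End translation.

Section potential.
Context {R : realType}.
Local Notation mu := (@lebesgue_measure R).
Variables (g : R -> R) (K k : R).
Hypotheses (mg : measurable_fun setT g) (g_ge0 : forall y, 0 <= g y).
Hypotheses (K_ge0 : 0 <= K) (k_ge0 : 0 <= k).
Hypothesis g_growth : forall y, g y <= K * expR (k * `|y|).
Hypothesis g_lip : forall y z,
  `|g y - g z| <= K * `|y - z| * expR (k * (`|z| + `|y - z|)).

(* The cutoff [dl] keeps the heat kernel away from its singularity at [r = 0];
   for [dl = 0] and [z = 0] this is the expected integral of [g] along Brownian
   motion up to time [T]. *)
Definition potential (dl T z : R) : \bar R := (\int[mu]_(r in `]dl, T]) smooth g r z)%E.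

Lemma potential_ge0 dl T z : (0 <= potential dl T z)%E.
Proof. by apply: integral_ge0 => r _; exact: smooth_ge0. Qed.

Lemma potential_empty dl T z : T <= dl -> potential dl T z = 0%E.
Proof. by move=> Tdl; rewrite /potential set_itv_ge ?integral_set0// bnd_simp -leNgt. Qed.

Lemma measurable_smooth_time z : measurable_fun setT (fun r : R => smooth g r z).
Proof. by apply: measurable_smooth => //; exact: measurable_cst. Qed.

Lemma measurable_potential d (T : measurableType d) dl (f h : T -> R) :
  measurable_fun setT f -> measurable_fun setT h ->
  measurable_fun setT (fun x => potential dl (f x) (h x)).
Proof.
move=> mf mh.
(* The variable bounds of integration go into the integrand, so that measurability in the parameters
   follows from Tonelli's theorem. *)
pose F (p : T * R) := if (dl < p.2) && (p.2 <= f p.1) then smooth g p.2 (h p.1) else 0%E.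
have -> : (fun x => potential dl (f x) (h x)) = (fun x => \int[mu]_r F (x, r))%E.
  apply/funext => x; rewrite /potential integral_mkcond; apply: eq_integral => r _.
  by rewrite patchE /F mem_setE in_itv.
apply: measurable_fun_fubini_tonelli_F.
  have mf1 : measurable_fun setT (fun p : T * R => f p.1) by exact: measurableT_comp.
  have mh1 : measurable_fun setT (fun p : T * R => h p.1) by exact: measurableT_comp.
  apply: measurable_fun_ifT; last exact: measurable_cst.
    apply: measurable_and.
      by apply: measurable_fun_ltr => //; exact: measurable_cst.
    exact: measurable_fun_ler.
  exact: measurable_smooth.
by move=> p; rewrite /F; case: ifP => // _; exact: smooth_ge0.
Qed.

Lemma potential_growth M : exists2 C, 0 <= C & forall dl T z, 0 < dl -> dl <= T -> T <= M ->
  (potential dl T z <= ((T - dl) * (C * expR (k * `|z|)))%:E)%E.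
Proof.
have [C C0 CB] := smooth_growth mg g_ge0 K_ge0 k_ge0 g_growth M.
exists C => // dl T z dl0 dlT TM; rewrite -integral_cst_itvoc//.
apply: ge0_le_integral => //.
- by move=> r _; exact: smooth_ge0.
- by apply: measurable_funTS; exact: measurable_smooth_time.
- move=> r /=; rewrite in_itv/= => /andP[dlr rT]; apply: CB.
  by rewrite (lt_trans dl0)//= (le_trans rT).
Qed.

(* Spending the time [U] moves the interval of integration of [potential] to
   the left, which lets this part of the integral in at the cutoff. *)
Definition window (dl U z : R) : \bar R :=
  (\int[mu]_(r in `](dl - U)%R, dl]) smooth g r z)%E.

Lemma window_ge0 dl U z : (0 <= window dl U z)%E.
Proof. by apply: integral_ge0 => r _; exact: smooth_ge0. Qed.

(** Translation by [U] turns ]dl, T] into ]dl - U, T - U], which is then cut at [dl]. *)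
Lemma potential_shift dl T U z : 0 <= U -> dl <= T - U ->
  (potential dl (T - U)%R z + window dl U z =
   \int[mu]_(r in `]dl, T]) smooth g (r - U)%R z)%E.
Proof.
move=> U0 dlTU; rewrite (ge0_integral_shift dl T U (measurable_smooth_time z))//; last first.
  by move=> r; exact: smooth_ge0.
rewrite addeC /potential /window.
have -> : `](dl - U), (T - U)]%classic = `](dl - U), dl] `|` `]dl, (T - U)] :> set R.
  by rewrite -itv_bndbnd_setU// bnd_simp// lerBlDr lerDl.
rewrite ge0_integral_setU//.
- by apply: measurable_funTS; exact: measurable_smooth_time.
- by move=> r _; exact: smooth_ge0.
- apply/disj_setPS => r /=; rewrite !in_itv/= => -[/andP[_ ?] /andP[? _]]; lra.
Qed.

(** The window has length [U], and U <= dl / 2 keeps its variances positive. On it W(r, z') differs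
    from g(z') by O(sqrt(dl)), and g(z') from g(z) by O(th). *)
Lemma window_approx : exists2 C, 0 <= C & forall dl U z z' th,
  0 < dl <= 1 -> 0 <= U <= dl / 2 -> `|z' - z| <= th -> th <= 1 ->
  let e := (C * Num.sqrt dl + C * th) * expR (k * `|z|) in
  (window dl U z' <= (U * (g z + e))%:E)%E /\
  ((U * g z)%:E <= window dl U z' + (U * e)%:E)%E.
Proof.
have [C C0 CB] := smooth_approx mg g_ge0 K_ge0 g_lip 1.
(* [C] comes from the smoothing, [K] from passing from z' to z, and [expR k] from |z'| <= |z| +
   1. *)
exists ((C + K) * expR k) => [|dl U z z' th /andP[dl0 dl1] /andP[U0 Udl] zz' th1 e].
  by rewrite mulr_ge0 ?expR_ge0// addr_ge0.
have th0 : 0 <= th by apply: le_trans zz'.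
pose f := C * Num.sqrt dl * (expR k * expR (k * `|z|)).
have zz1 : `|z'| <= `|z| + 1.
  by rewrite -[X in `|X|](subrK z) addrC (le_trans (ler_normD _ _))// lerD2l; lra.
have ez : expR (k * `|z'|) <= expR k * expR (k * `|z|).
  by rewrite -expRD ler_expR -[X in X + _]mulr1 -mulrDr ler_wpM2l// addrC.
have ekz : 0 <= expR k * expR (k * `|z|) by rewrite mulr_ge0 ?expR_ge0.
have gzz' : `|g z' - g z| <= K * th * (expR k * expR (k * `|z|)).
  apply: le_trans (g_lip _ _) _; apply: ler_pM; rewrite ?mulr_ge0 ?expR_ge0//.
    by rewrite ler_wpM2l.
  by rewrite -expRD ler_expR mulrDr addrC lerD2r -[leRHS]mulr1 ler_wpM2l//; lra.
have fe : f + K * th * (expR k * expR (k * `|z|)) <= e.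
  have s0 : 0 <= Num.sqrt dl by rewrite sqrtr_ge0.
  rewrite (_ : e = (C + K) * (Num.sqrt dl + th) * (expR k * expR (k * `|z|))); last first.
    by rewrite /e; ring.
  rewrite /f -mulrDl ler_wpM2r// -subr_ge0.
  rewrite (_ : _ - _ = C * th + K * Num.sqrt dl); last by ring.
  by rewrite addr_ge0 ?mulr_ge0.
have sB r : dl - U < r <= dl -> (smooth g r z' <= (g z + e)%:E)%E /\
   ((g z)%:E <= smooth g r z' + e%:E)%E.
  move=> /andP[r1 r2]; have r01 : 0 < r <= 1 by lra.
  have [H1 H2] := CB r z' r01.
  have fB : C * Num.sqrt r * expR (k * `|z'|) <= f.
    apply: ler_pM; rewrite ?mulr_ge0 ?expR_ge0 ?sqrtr_ge0//.
    by rewrite ler_wpM2l// ler_wsqrtr.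
  move: gzz'; rewrite ler_norml => gzz'.
  split.
    by apply: le_trans H1 _; rewrite lee_fin; lra.
  have : (g z)%:E = ((g z')%:E + (g z - g z')%:E)%E by rewrite -EFinD; congr EFin; ring.
  move=> ->; apply: le_trans (leeD2r _ H2) _.
  by rewrite -addeA leeD2l// -EFinD lee_fin; lra.
have e0 : 0 <= e.
  apply: le_trans fe; rewrite addr_ge0// /f.
  by rewrite mulr_ge0// mulr_ge0// sqrtr_ge0.
  by rewrite mulr_ge0// mulr_ge0.
have dd : dl - (dl - U) = U by ring.
have dUd : dl - U <= dl by lra.
have ms : measurable_fun `](dl - U), dl] (fun r : R => smooth g r z').
  by apply: measurable_funTS; exact: measurable_smooth_time.
split.
- rewrite -[X in (X * _)%:E]dd -integral_cst_itvoc//.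
  apply: ge0_le_integral => //.
  + by move=> r _; exact: smooth_ge0.
  + by move=> r /=; rewrite in_itv/= => /sB[].
- rewrite -[X in ((X * g z)%:E <= _)%E]dd -[X in (_ <= _ + (X * e)%:E)%E]dd -!integral_cst_itvoc//.
  rewrite /window -ge0_integralD//; last by move=> r _; exact: smooth_ge0.
  apply: ge0_le_integral => //.
  + by move=> r _; rewrite lee_fin.
  + by apply: emeasurable_funD => //; exact: measurable_cst.
  + by move=> r /=; rewrite in_itv/= => /sB[].
Qed.

End potential.

Section potential_step.
Context {R : realType} {d} {Xi : measurableType d} (Q : probability Xi R).
Local Notation mu := (@lebesgue_measure R).
Variables (a b : Xi -> R).
Hypotheses (ma : measurable_fun setT a) (mb : measurable_fun setT b).
Hypotheses (a01 : forall x, 0 <= a x <= 1) (b03 : forall x, 0 <= b x <= 3).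
Variable m : R.
Hypothesis am : (\int[Q]_x (a x ^+ 2)%:E = m%:E)%E.
Hypothesis bm : (\int[Q]_x (b x)%:E = m%:E)%E.
Variables (g : R -> R) (K k : R).
Hypotheses (mg : measurable_fun setT g) (g_ge0 : forall y, 0 <= g y).
Hypotheses (K_ge0 : 0 <= K) (k_ge0 : 0 <= k).
Hypothesis g_growth : forall y, g y <= K * expR (k * `|y|).
Hypothesis g_lip : forall y z,
  `|g y - g z| <= K * `|y - z| * expR (k * (`|z| + `|y - z|)).

(* One step of the skeleton from [z], with [th = eps * eta z], [a^2 = A e^(1-A)]
   and [b = e^(1-A)]; the first argument of [phi] is the time spent. *)
Definition average_step (phi : R -> R -> \bar R) (z th : R) : \bar R :=
  (\int[Q]_x ((2^-1)%:E * (phi (b x * th ^+ 2)%R (z + a x * th)%R +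
                          phi (b x * th ^+ 2)%R (z - a x * th)%R)))%E.

Lemma measurable_average_integrand (phi : R -> R -> \bar R) z th :
  (forall f h : Xi -> R, measurable_fun setT f -> measurable_fun setT h ->
     measurable_fun setT (fun x => phi (f x) (h x))) ->
  measurable_fun setT (fun x => (2^-1)%:E * (phi (b x * th ^+ 2)%R (z + a x * th)%R +
                          phi (b x * th ^+ 2)%R (z - a x * th)%R))%E.
Proof.
move=> mphi; apply: emeasurable_funM; first exact: measurable_cst.
by apply: emeasurable_funD; apply: mphi; measurability.
Qed.

Lemma average_step_ge0 (phi : R -> R -> \bar R) z th :
  (forall U z, 0 <= phi U z)%E -> (0 <= average_step phi z th)%E.
Proof.
by move=> phi0; apply: integral_ge0 => x _; rewrite mule_ge0 ?adde_ge0// lee_fin.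
Qed.

Let mpot dl T : forall f h : Xi -> R, measurable_fun setT f -> measurable_fun setT h ->
  measurable_fun setT (fun x => potential g dl (T - f x) (h x)).
Proof.
move=> f h mf mh; apply: measurable_potential => //; measurability.
Qed.

Let mwin dl : forall f h : Xi -> R, measurable_fun setT f -> measurable_fun setT h ->
  measurable_fun setT (fun x => window g dl (f x) (h x)).
Proof.
move=> f h mf mh.
have -> : (fun x => window g dl (f x) (h x)) = 
   (fun x => \int[mu]_r (if (dl - f x < r)%R && (r <= dl)%R then smooth g r (h x) else 0))%E.
  apply/funext => x; rewrite /window integral_mkcond; apply: eq_integral => r _.
  by rewrite patchE mem_setE in_itv.
apply: (@measurable_fun_fubini_tonelli_F _ _ _ _ _ mu
  (fun p : Xi * R => if (dl - f p.1 < p.2) && (p.2 <= dl) then smooth g p.2 (h p.1) else 0%E)).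
  have mf1 : measurable_fun setT (fun p : Xi * R => f p.1) by exact: measurableT_comp.
  have mh1 : measurable_fun setT (fun p : Xi * R => h p.1) by exact: measurableT_comp.
  apply: measurable_fun_ifT; last exact: measurable_cst.
    apply: measurable_and.
      by apply: measurable_fun_ltr => //; measurability.
    by apply: measurable_fun_ler => //; exact: measurable_cst.
  exact: measurable_smooth.
by move=> p; case: ifP => // _; exact: smooth_ge0.
Qed.

Local Opaque smooth potential window.

(** For each outcome of the noise, [potential_shift] completes the potential after the step to an
    integral over the fixed interval ]dl, T], and the noise can be integrated first. The conditions
    on [T] and [th] ensure that the remaining time is still at least [dl]. *)
Lemma average_step_potential_window dl T z th : 0 < dl -> 2 * dl <= T -> 6 * th ^+ 2 <= dl ->
  (average_step (fun U z => potential g dl (T - U)%R z) z th +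
   average_step (window g dl) z th =
   \int[mu]_(r in `]dl, T]) smooth_average Q a b g r z th)%E.
Proof.
move=> dl0 dlT thdl.
have t2 : 0 <= th ^+ 2 by rewrite sqr_ge0.
have U0 x : 0 <= b x * th ^+ 2 by rewrite mulr_ge0//; case/andP: (b03 x).
have Udl x : b x * th ^+ 2 <= 3 * th ^+ 2 by rewrite ler_wpM2r//; case/andP: (b03 x).
rewrite /average_step -ge0_integralD//; last 4 first.
- by move=> x _; apply: mule_ge0; rewrite ?lee_fin//; apply: adde_ge0; exact: potential_ge0.
- apply: (@measurable_average_integrand (fun U z => potential g dl (T - U) z)); exact: mpot.
- by move=> x _; apply: mule_ge0; rewrite ?lee_fin//; apply: adde_ge0; exact: window_ge0.
- by apply: measurable_average_integrand; exact: mwin.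
pose F (p : Xi * R) := (if (dl < p.2)%R && (p.2 <= T)%R then
  (2^-1)%:E * (smooth g (p.2 - b p.1 * th ^+ 2)%R (z + a p.1 * th)%R +
               smooth g (p.2 - b p.1 * th ^+ 2)%R (z - a p.1 * th)%R) else 0)%E.
have F0 p : (0 <= F p)%E.
  by rewrite /F; case: ifP => // _; apply: mule_ge0; rewrite ?lee_fin//; apply: adde_ge0; exact: smooth_ge0.
have mF : measurable_fun setT F.
  have ma' : measurable_fun setT (fun p : Xi * R => a p.1) by exact: measurableT_comp.
  have mb' : measurable_fun setT (fun p : Xi * R => b p.1) by exact: measurableT_comp.
  apply: measurable_fun_ifT; last exact: measurable_cst.
    apply: measurable_and.
      by apply: measurable_fun_ltr => //; exact: measurable_cst.
    by apply: measurable_fun_ler => //; exact: measurable_cst.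
  apply: emeasurable_funM; first exact: measurable_cst.
  by apply: emeasurable_funD; apply: measurable_smooth => //; measurability.
transitivity (\int[Q]_x \int[mu]_r F (x, r))%E.
  apply: eq_integral => x _.
  have msm w : measurable_fun setT (fun r : R => smooth g (r - b x * th ^+ 2) w).
    by apply: measurable_smooth => //; measurability.
  rewrite -ge0_muleDr; [|by apply: adde_ge0; exact: potential_ge0
    |by apply: adde_ge0; exact: window_ge0].
  have dlx : dl <= T - b x * th ^+ 2 by have := Udl x; lra.
  rewrite (addeACA (potential g dl (T - b x * th ^+ 2) (z + a x * th))).
  have E1 := potential_shift mg g_ge0 (z + a x * th) (U0 x) dlx.
  have E2 := potential_shift mg g_ge0 (z - a x * th) (U0 x) dlx.
  etransitivity; first exact: (congr2 (fun u v => (2^-1)%:E * (u + v))%E E1 E2).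
  have mD : measurable (`]dl, T] : set R) by exact: measurable_itv.
  have s0 w r : (0 <= smooth g (r - b x * th ^+ 2)%R w)%E by exact: smooth_ge0.
  rewrite -(ge0_integralD mu mD (fun r _ => s0 _ r) (measurable_funTS (msm _))
    (fun r _ => s0 _ r) (measurable_funTS (msm _))).
  rewrite -(ge0_integralZl_EFin mu mD (fun r _ => adde_ge0 (s0 _ r) (s0 _ r))
    (measurable_funTS (emeasurable_funD (msm _) (msm _))))//.
  rewrite integral_mkcond; apply: eq_integral => r _.
  by rewrite patchE mem_setE in_itv/= /F/=.
etransitivity; first exact: (@fubini_tonelli _ _ _ _ _ Q mu F mF F0).
rewrite [RHS]integral_mkcond; apply: eq_integral => r _.
rewrite patchE mem_setE in_itv/= /F/=; case: ifP => // _.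
by rewrite integral0.
Qed.

(** The mean length of the window is m * th^2, and the integrand there is close to g(z): this is the
    loss of potential in one step. *)
Lemma average_window : exists2 C, 0 <= C & forall dl z th,
  0 < dl <= 1 -> 0 <= th <= 1 -> 6 * th ^+ 2 <= dl ->
  let e := (C * Num.sqrt dl + C * th) * expR (k * `|z|) in
  (average_step (window g dl) z th <= (m * th ^+ 2 * (g z + e))%:E)%E /\
  ((m * th ^+ 2 * g z)%:E <= average_step (window g dl) z th + (m * th ^+ 2 * e)%:E)%E.
Proof.
have [C C0 CB] := window_approx mg g_ge0 K_ge0 k_ge0 g_lip.
exists C => // dl z th dl01 /andP[th0 th1] thdl e.
have t2 : 0 <= th ^+ 2 by rewrite sqr_ge0.
have U0 x : 0 <= b x * th ^+ 2 by rewrite mulr_ge0//; case/andP: (b03 x).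
have Udl x : b x * th ^+ 2 <= dl / 2.
  have : b x * th ^+ 2 <= 3 * th ^+ 2 by rewrite ler_wpM2r//; case/andP: (b03 x).
  lra.
have e0 : 0 <= e by rewrite mulr_ge0 ?expR_ge0// addr_ge0 ?mulr_ge0 ?sqrtr_ge0.
have bint c : 0 <= c -> (\int[Q]_x (b x * th ^+ 2 * c)%:E = (m * th ^+ 2 * c)%:E)%E.
  move=> c0; under eq_integral do rewrite -mulrA EFinM.
  rewrite ge0_integralZr//=.
  - by rewrite bm -EFinM mulrA.
  - exact/measurable_EFinP.
  - by move=> x _; rewrite lee_fin; case/andP: (b03 x).
  - by rewrite lee_fin mulr_ge0.
have mB c : measurable_fun setT (fun x => (b x * th ^+ 2 * c)%:E).
  by measurability.
have ath x : `|a x * th| <= th.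
  have /andP[a0 a1] := a01 x.
  by rewrite ger0_norm ?mulr_ge0// ler_piMl.
have zp x : `|z + a x * th - z| <= th by rewrite addrC addKr.
have zm x : `|z - a x * th - z| <= th by rewrite addrC addKr normrN.
have half (u v w : \bar R) : (0 <= u)%E -> (0 <= v)%E -> (u <= w)%E -> (v <= w)%E -> ((2^-1)%:E * (u + v) <= w)%E.
  move=> u0 v0 uw vw; rewrite -[leRHS]mul1e (_ : 1%E = (2^-1)%:E * 2%:E)%E; last first.
    by rewrite -EFinM mulVf.
  rewrite -muleA lee_pmul2l// ?lte_fin// (_ : 2%:E = 1 + 1)%E; last by rewrite -EFinD.
  by rewrite ge0_muleDl// !mul1e leeD.
have mA : measurable_fun setT (fun x : Xi => (2^-1)%:E * (window g dl (b x * th ^+ 2)%R (z + a x * th)%R +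
                          window g dl (b x * th ^+ 2)%R (z - a x * th)%R))%E.
  by apply: measurable_average_integrand; exact: mwin.
have A0 x : (0 <= (2^-1)%:E * (window g dl (b x * th ^+ 2)%R (z + a x * th)%R +
                          window g dl (b x * th ^+ 2)%R (z - a x * th)%R))%E.
  by apply: mule_ge0; rewrite ?lee_fin//; apply: adde_ge0; exact: window_ge0.
split.
- rewrite -(bint _ (addr_ge0 (g_ge0 z) e0)) /average_step; apply: (ge0_le_integral Q measurableT (fun x _ => A0 x) mA (mB _)).
  move=> x _; apply: half; try exact: window_ge0.
  + by have [] := CB dl (b x * th ^+ 2) z (z + a x * th) th dl01 _ (zp x) th1; rewrite ?U0 ?Udl.
  + by have [] := CB dl (b x * th ^+ 2) z (z - a x * th) th dl01 _ (zm x) th1; rewrite ?U0 ?Udl.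
- have B0 c x : 0 <= c -> (0 <= (b x * th ^+ 2 * c)%:E)%E.
    by move=> c0; rewrite lee_fin mulr_ge0.
  rewrite -(bint _ (g_ge0 z)) -(bint _ e0) /average_step.
  rewrite -(ge0_integralD Q measurableT (fun x _ => A0 x) mA (fun x _ => B0 e x e0) (mB e)).
  apply: (ge0_le_integral Q measurableT (fun x _ => B0 _ x (g_ge0 z)) (mB _)
    (emeasurable_funD mA (mB e))).
  move=> x _.
  have [|_ H1] := CB dl (b x * th ^+ 2) z (z + a x * th) th dl01 _ (zp x) th1; first by rewrite U0 Udl.
  have [|_ H2] := CB dl (b x * th ^+ 2) z (z - a x * th) th dl01 _ (zm x) th1; first by rewrite U0 Udl.
  have := window_ge0 g_ge0 dl (b x * th ^+ 2) (z + a x * th).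
  have := window_ge0 g_ge0 dl (b x * th ^+ 2) (z - a x * th).
  move: (window _ _ _ (z + _)) (window _ _ _ (z - _)) H1 H2 => w1 w2.
  set E := (b x * th ^+ 2 * e)%R; set G := (b x * th ^+ 2 * g z)%R.
  move=> H1 H2 W2 W1.
  have E0 : (0 <= E%:E)%E by rewrite lee_fin mulr_ge0.
  have -> : E%:E = ((2^-1)%:E * (E%:E + E%:E))%E.
    by rewrite -EFinD -EFinM; congr EFin; field.
  have -> : G%:E = ((2^-1)%:E * (G%:E + G%:E))%E.
    by rewrite -EFinD -EFinM; congr EFin; field.
  rewrite -ge0_muleDr; [|exact: adde_ge0|exact: adde_ge0].
  rewrite (addeACA w1).
  by apply: lee_wpmul2l; [rewrite lee_fin|exact: leeD].
Qed.

Let m_ge0 : 0 <= m.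
Proof.
rewrite -lee_fin -bm; apply: integral_ge0 => x _.
by rewrite lee_fin; case/andP: (b03 x).
Qed.

Let measurable_smooth_average z th :
  measurable_fun setT (fun r : R => smooth_average Q a b g r z th).
Proof.
pose F (p : R * Xi) := ((2^-1)%:E *
  (smooth g (p.1 - b p.2 * th ^+ 2)%R (z + a p.2 * th)%R +
   smooth g (p.1 - b p.2 * th ^+ 2)%R (z - a p.2 * th)%R))%E.
have mF : measurable_fun setT F.
  have ma' : measurable_fun setT (fun p : R * Xi => a p.2) by exact: measurableT_comp.
  have mb' : measurable_fun setT (fun p : R * Xi => b p.2) by exact: measurableT_comp.
  apply: emeasurable_funM; first exact: measurable_cst.
  by apply: emeasurable_funD; apply: measurable_smooth => //; measurability.
have F0 p : (0 <= F p)%E.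
  by apply: mule_ge0; rewrite ?lee_fin//; apply: adde_ge0; exact: smooth_ge0.
rewrite /smooth_average.
exact: (@measurable_fun_fubini_tonelli_F _ _ _ _ _ Q F mF F0).
Qed.

Lemma integral_smooth_average dl M : 0 < dl -> 0 < M -> exists2 C, 0 <= C &
  forall T z th, dl <= T -> T <= M -> 0 <= th <= 1 -> 6 * th ^+ 2 <= dl ->
  let e := C * th ^+ 3 * expR (k * `|z|) in
  (\int[mu]_(r in `]dl, T]) smooth_average Q a b g r z th <=
     potential g dl T z + e%:E)%E /\
  (potential g dl T z <=
     \int[mu]_(r in `]dl, T]) smooth_average Q a b g r z th + e%:E)%E.
Proof.
move=> dl0 M0; have dl20 : 0 < dl / 2 by rewrite divr_gt0.
have ab : (\int[Q]_x (a x ^+ 2)%:E = \int[Q]_x (b x)%:E)%E by rewrite am bm.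
have [C C0 CB] := smooth_average_le ma mb a01 b03 ab mg g_ge0 K_ge0 k_ge0 g_growth dl20 M0.
exists (M * C) => [|T z th dlT TM th01 thdl e]; first by rewrite mulr_ge0// ltW.
(* Whatever the noise, the variance after the step is at least dl / 2, away from the singularity of
   the kernel. *)
have rB r : `]dl, T]%classic r -> dl / 2 <= r - 3 * th ^+ 2 /\ r <= M.
  by rewrite /= in_itv/= => /andP[? ?]; split; lra.
pose e' := C * th ^+ 3 * expR (k * `|z|).
have th3 : 0 <= th ^+ 3 by rewrite exprn_ge0//; case/andP: th01.
have e'0 : 0 <= e' by apply: mulr_ge0; [exact: mulr_ge0|exact: expR_ge0].
have e'e : (T - dl) * e' <= e.
  rewrite (_ : e = M * e'); last by rewrite /e /e'; ring.
  by rewrite ler_wpM2r//; lra.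
have mS := measurable_funTS (measurable_smooth_average z th).
have ms := measurable_funTS (measurable_smooth_time mg g_ge0 z).
have mD : measurable (`]dl, T] : set R) by exact: measurable_itv.
have S0 r : (0 <= smooth_average Q a b g r z th)%E.
  by apply: integral_ge0 => x _; apply: mule_ge0; rewrite ?lee_fin//; apply: adde_ge0; exact: smooth_ge0.
have s0 r : (0 <= smooth g r z)%E by exact: smooth_ge0.
have mc : measurable_fun `]dl, T] (fun _ : R => e'%:E) by exact: measurable_cst.
have c0 (r : R) : (0 <= e'%:E)%E by rewrite lee_fin.
have eB (u v : \bar R) : (u <= v + ((T - dl) * e')%:E)%E -> (u <= v + e%:E)%E.
  by move=> uv; apply: le_trans uv _; rewrite leeD2l// lee_fin.
split; apply: eB; rewrite -integral_cst_itvoc//.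
- rewrite -(ge0_integralD mu mD (fun r _ => s0 r) (ms _) (fun r _ => c0 r) mc).
  apply: (ge0_le_integral mu mD (fun r _ => S0 r) (mS _) (emeasurable_funD (ms _) mc)).
  by move=> r /rB[rdl rM]; have [] := CB r z th rdl rM th01.
- rewrite -(ge0_integralD mu mD (fun r _ => S0 r) (mS _) (fun r _ => c0 r) mc).
  apply: (ge0_le_integral mu mD (fun r _ => s0 r) (ms _) (emeasurable_funD (mS _) mc)).
  by move=> r /rB[rdl rM]; have [] := CB r z th rdl rM th01.
Qed.

(** The order of the quantifiers matters. [C] is fixed before [dl], so that the term in sqrt(dl)
    tends to 0 with [dl]; [D], which depends on the kernel near variance dl / 2, comes after and is
    compensated by taking [th] small. *)
Lemma potential_step : exists2 C, 0 <= C & forall dl M, 0 < dl <= 1 -> 0 < M ->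
  exists2 D, 0 <= D & forall T z th,
  2 * dl <= T -> T <= M -> 0 <= th <= 1 -> 6 * th ^+ 2 <= dl ->
  let e := th ^+ 2 * (C * Num.sqrt dl + D * th) * expR (k * `|z|) in
  let A := average_step (fun U z => potential g dl (T - U) z) z th in
  (A + (m * th ^+ 2 * g z)%:E <= potential g dl T z + e%:E)%E /\
  (potential g dl T z <= A + (m * th ^+ 2 * g z)%:E + e%:E)%E.
Proof.
have [C C0 CB] := average_window.
exists (m * C) => [|dl M dl01 M0]; first by rewrite mulr_ge0.
have dl0 : 0 < dl by case/andP: dl01.
have [D D0 DB] := integral_smooth_average dl0 M0.
exists (D + m * C) => [|T z th dlT TM th01 thdl e A].
  by rewrite addr_ge0// mulr_ge0.
have dlT' : dl <= T by lra.
have [] := DB T z th dlT' TM th01 thdl.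
rewrite -average_step_potential_window// -/A.
have [] := CB dl z th dl01 th01 thdl.
set e1 := (_ * expR _); set e2 := D * _ * _.
set w := average_step (window g dl) z th.
set p := potential g dl T z.
have -> : e = m * th ^+ 2 * e1 + e2 by rewrite /e /e1 /e2; ring.
move=> H1 H2 H3 H4; clearbody A w p; split.
- apply: (@le_trans _ _ (A + (w + (m * th ^+ 2 * e1)%:E))%E); first exact: leeD2l.
  by rewrite addeA EFinD [X in (_ <= p + X)%E]addeC [leRHS]addeA leeD2r.
- apply: le_trans H4 _; rewrite EFinD addeA leeD2r// -addeA leeD2l//.
  by rewrite -EFinD -mulrDr.
Qed.

End potential_step.

(** * Lyapunov function *)

Section lyapunov.
Context {R : realType} {d} {Xi : measurableType d} (Q : probability Xi R).
Variables (a b : Xi -> R).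
Hypotheses (ma : measurable_fun setT a) (mb : measurable_fun setT b).
Hypotheses (a01 : forall x, 0 <= a x <= 1) (b03 : forall x, 0 <= b x <= 3).
Variable m : R.
Hypothesis am : (\int[Q]_x (a x ^+ 2)%:E = m%:E)%E.
Hypothesis bm : (\int[Q]_x (b x)%:E = m%:E)%E.

Lemma integral_affine (u v w : R) :
  (\int[Q]_x (u * a x ^+ 2 + v * b x + w)%:E = ((u + v) * m + w)%:E)%E.
Proof.
have a1 x : `|a x ^+ 2| <= 1.
  by rewrite ger0_norm ?sqr_ge0// exprn_ile1//; case/andP: (a01 x).
have b3 x : `|b x| <= 3 by rewrite ger0_norm; case/andP: (b03 x).
have i1 : Q.-integrable setT (EFin \o (fun x => a x ^+ 2)).
  by apply: integrable_of_bound a1; measurability.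
have i2 : Q.-integrable setT (EFin \o b) by exact: integrable_of_bound b3.
have i3 : Q.-integrable setT (EFin \o cst w) by apply: (@integrable_of_bound _ _ _ _ _ `|w|).
have j1 := integrableZl measurableT u i1.
have j2 := integrableZl measurableT v i2.
under eq_integral do rewrite !EFinD !EFinM.
rewrite (integralD measurableT (integrableD measurableT j1 j2) i3) (integralD measurableT j1 j2).
rewrite (integralZl measurableT i1) (integralZl measurableT i2) am bm.
rewrite (_ : \int[Q]_x (EFin \o cst w) x = w%:E)%E.
  by rewrite -!EFinM -!EFinD mulrDl.
rewrite (eq_integral (cst w%:E))// integral_cst//.
by rewrite [X in (_ * X)%E]probability_setT ?mule1.
Qed.

(** Invert e^(-y) >= 1 - y, using (1 + y + 2 y^2)(1 - y) = 1 + y^2 (1 - 2y) >= 1. *)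
Lemma expR_le_quadratic (y : R) : `|y| <= 2^-1 -> expR y <= 1 + y + 2 * y ^+ 2.
Proof.
rewrite ler_norml => /andP[y1 y2].
have e0 : 0 < expR (- y) by exact: expR_gt0.
rewrite -[y in leLHS]opprK expRN -div1r ler_pdivrMr//.
have := expR_ge1Dx (- y) => e1.
have q0 : 0 <= 1 + y + 2 * y ^+ 2 by have := sqr_ge0 y; lra.
apply: le_trans (ler_wpM2l q0 e1).
have : 0 <= y ^+ 2 * (1 - 2 * y) by rewrite mulr_ge0 ?sqr_ge0//; lra.
by rewrite -subr_ge0 (_ : y ^+ 2 * _ = (1 + y + 2 * y ^+ 2) * (1 - y) - 1)  ?subr_ge0//; ring.
Qed.

Definition cosh (y : R) : R := (expR y + expR (- y)) / 2.

Lemma cosh_gt0 y : 0 < cosh y.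
Proof. by rewrite divr_gt0// addr_gt0 ?expR_gt0. Qed.

Lemma cosh_ge_expR y : expR `|y| / 2 <= cosh y.
Proof.
rewrite ler_pM2r ?invr_gt0//; case: (lerP 0 y) => y0.
  by rewrite ger0_norm// lerDl expR_ge0.
by rewrite ltr0_norm// lerDr expR_ge0.
Qed.

Lemma cosh_le_quadratic y : `|y| <= 2^-1 -> cosh y <= 1 + 2 * y ^+ 2.
Proof.
move=> y2; rewrite /cosh; have := expR_le_quadratic y2.
have : `|- y| <= 2^-1 by rewrite normrN.
move/expR_le_quadratic; rewrite sqrrN; lra.
Qed.

(** A symmetric step multiplies [cosh] by a factor independent of the position. This makes the
    Lyapunov inequality uniform in z, and is why [cosh] replaces e^(k|z|). *)
Lemma coshDB y h : (cosh (y + h) + cosh (y - h)) / 2 = cosh y * cosh h.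
Proof. by rewrite /cosh !opprD !expRD opprK; field. Qed.

Definition lyapunov (c k s z : R) : R := expR (- (c * s)) * cosh (k * z).

Lemma lyapunov_gt0 c k s z : 0 < lyapunov c k s z.
Proof. by rewrite mulr_gt0 ?expR_gt0 ?cosh_gt0. Qed.

Lemma lyapunov00 c k : lyapunov c k 0 0 = 1.
Proof. by rewrite /lyapunov /cosh !mulr0 !oppr0 !expR0; field. Qed.

Lemma lyapunov_ge c k s z s1 : 0 <= c -> 0 <= k -> s <= s1 ->
  expR (k * `|z|) <= 2 * expR (c * s1) * lyapunov c k s z.
Proof.
move=> c0 k0 ss1; rewrite /lyapunov.
have := cosh_ge_expR (k * z); rewrite normrM (ger0_norm k0) => H.
have e1 : 1 <= expR (c * s1) * expR (- (c * s)).
  rewrite -expRD -expR0 ler_expR -mulrBr mulr_ge0// subr_ge0//.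
have : expR (k * `|z|) <= 2 * cosh (k * z) by lra.
move/le_trans; apply.
by rewrite -mulrA ler_wpM2l// mulrA ler_peMl// ltW// cosh_gt0.
Qed.

Lemma measurable_lyapunov c k d' (T : measurableType d') (f h : T -> R) :
  measurable_fun setT f -> measurable_fun setT h ->
  measurable_fun setT (fun x => lyapunov c k (f x) (h x)).
Proof.
move=> mf mh; rewrite /lyapunov /cosh.
by measurability.
Qed.

(* The time factor beats the growth of the [cosh] because [b] has positive mean. *)
Lemma lyapunov_step k : 0 < m -> 0 <= k -> exists2 c, 0 <= c &
  exists2 th0, 0 < th0 & forall s z th, 0 <= th <= th0 ->
  (average_step Q a b (fun U z => (lyapunov c k (s + U) z)%:E) z th +
   (th ^+ 2 * lyapunov c k s z)%:E <= (lyapunov c k s z)%:E)%E.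
Proof.
move=> m0 k0.
(* In the mean, 2 k^2 offsets the growth of [cosh] and 2 / m yields a loss of 2 th^2; one th^2 pays
   for the second-order terms in [fB], the other is the announced dissipation. *)
pose c := 2 * k ^+ 2 + 2 / m.
have c0 : 0 < c by rewrite ltr_wpDl ?mulr_ge0 ?sqr_ge0// divr_gt0.
exists c; first exact: ltW.
(* Ensures th <= 1, k th <= 1/2 and 6 c th <= 1: the quadratic bounds then apply to both factors,
   and the square of the time term is at most of order th^2. *)
pose th0 := (1 + 2 * k + 6 * c)^-1.
have d0 : 0 < 1 + 2 * k + 6 * c by lra.
exists th0; first by rewrite invr_gt0.
move=> s z th /andP[t0 tth0].
have thle : th * (1 + 2 * k + 6 * c) <= 1 by rewrite -ler_pdivlMr// div1r.
have kth : 0 <= k * th by rewrite mulr_ge0.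
have cth : 0 <= c * th by rewrite mulr_ge0// ltW.
have kt : k * th <= 2^-1 by lra.
have ct : 6 * (c * th) <= 1 by lra.
have t1 : th <= 1 by lra.
have t2 : 0 <= th ^+ 2 by rewrite sqr_ge0.
have thk : 0 <= th * k by rewrite mulr_ge0.
have c2t2 : 27 * (c * th ^+ 2) ^+ 2 <= th ^+ 2.
  rewrite [leLHS](_ : _ = (27 / 36) * (6 * (c * th)) ^+ 2 * th ^+ 2); last by field.
  rewrite ler_piMl//.
  have : (6 * (c * th)) ^+ 2 <= 1 by rewrite exprn_ile1// mulr_ge0.
  lra.
have ct2 : c * th ^+ 2 <= 6^-1.
  have : c * th ^+ 2 <= c * th by rewrite ler_wpM2l ?(ltW c0)// expr2 ler_piMl.
  lra.
pose V := lyapunov c k s z.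
have V0 : 0 < V by exact: lyapunov_gt0.
pose f x := expR (- (c * (b x * th ^+ 2))) * cosh (k * (a x * th)).
have fE x : ((2^-1)%:E * ((lyapunov c k (s + b x * th ^+ 2) (z + a x * th))%:E +
     (lyapunov c k (s + b x * th ^+ 2) (z - a x * th))%:E))%E = (V * f x)%:E.
  rewrite -EFinD -EFinM; congr EFin.
  rewrite /V /f /lyapunov [in RHS]mulrACA -expRD -coshDB mulrBr !mulrDr opprD; ring.
have f0 x : 0 <= f x by rewrite mulr_ge0 ?expR_ge0// ltW// cosh_gt0.
have mf : measurable_fun setT f by rewrite /f /cosh; measurability.
rewrite /average_step; under eq_integral do rewrite fE EFinM.
rewrite ge0_integralZl_EFin ?(ltW V0)//; last 2 first.
- by move=> x _; rewrite lee_fin.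
- exact/measurable_EFinP.
have fB x : f x <= 2 * k ^+ 2 * th ^+ 2 * a x ^+ 2 + - (c * th ^+ 2) * b x + (1 + th ^+ 2).
  have /andP[a0 a1] := a01 x; have /andP[b0 b3] := b03 x.
  pose q := c * (b x * th ^+ 2); pose p := (k * (a x * th)) ^+ 2.
  have q0 : 0 <= q by rewrite mulr_ge0 ?(ltW c0)// mulr_ge0.
  have q3 : q <= 3 * (c * th ^+ 2).
    by rewrite /q mulrCA ler_wpM2r// mulr_ge0// ltW.
  have kat : 0 <= k * (a x * th) <= 2^-1.
    rewrite !mulr_ge0//=; apply: le_trans kt; rewrite ler_wpM2l//.
    by rewrite ler_piMl.
  have p0 : 0 <= p by rewrite sqr_ge0.
  have p4 : p <= 4^-1.
    case/andP: kat => ka kb.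
    have : p <= (2^-1) ^+ 2 by rewrite lerXn2r ?nnegrE.
    by rewrite expr2; lra.
  have H1 : expR (- q) <= 1 - q + 2 * q ^+ 2.
    by rewrite -(sqrrN q); apply: expR_le_quadratic; rewrite normrN ger0_norm//; lra.
  have H2 : cosh (k * (a x * th)) <= 1 + 2 * p.
    by apply: cosh_le_quadratic; case/andP: kat => ka kb; rewrite ger0_norm.
  have H3 : f x <= (1 - q + 2 * q ^+ 2) * (1 + 2 * p).
    by apply: ler_pM; rewrite ?expR_ge0// ltW// cosh_gt0.
  apply: le_trans H3 _.
  have qq : 3 * q ^+ 2 <= 27 * (c * th ^+ 2) ^+ 2.
    have : q ^+ 2 <= (3 * (c * th ^+ 2)) ^+ 2.
      by rewrite lerXn2r ?nnegrE// mulr_ge0// mulr_ge0// ltW.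
    rewrite exprMn; lra.
  have pq : 0 <= 2 * (p * q) by rewrite mulr_ge0// mulr_ge0.
  have pq2 : p * q ^+ 2 <= 4^-1 * q ^+ 2 by rewrite ler_wpM2r ?sqr_ge0.
  have -> : 2 * k ^+ 2 * th ^+ 2 * a x ^+ 2 + - (c * th ^+ 2) * b x + (1 + th ^+ 2)
     = 2 * p - q + 1 + th ^+ 2 by rewrite /p /q; ring.
  lra.
have IB : (\int[Q]_x (f x)%:E <= (1 - th ^+ 2)%:E)%E.
  apply: (@le_trans _ _ (\int[Q]_x (2 * k ^+ 2 * th ^+ 2 * a x ^+ 2 + - (c * th ^+ 2) * b x + (1 + th ^+ 2))%R%:E)%E).
    apply: ge0_le_integral => //.
    - by move=> x _; rewrite lee_fin.
    - exact/measurable_EFinP.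
    - by measurability.
    - by move=> x _; rewrite lee_fin.
  rewrite integral_affine lee_fin.
  have -> : (2 * k ^+ 2 * th ^+ 2 + - (c * th ^+ 2)) * m = - 2 * th ^+ 2.
    by rewrite /c; field; rewrite gt_eqF.
  lra.
apply: (@le_trans _ _ (V%:E * (1 - th ^+ 2)%:E + (th ^+ 2 * V)%:E)%E).
  by apply: leeD => //; apply: lee_wpmul2l => //; rewrite lee_fin ltW.
by rewrite -/V -EFinM -EFinD lee_fin; lra.
Qed.

End lyapunov.

(** * Telescoping along the chain *)

(* The sequences stand for the mean values, after [n] steps, of: the Lyapunov
   function [e], its part [c] beyond the level after the next step, the
   dissipation [t], the potential [u], and the indicator [p] of being below the
   level; [q] is [eps^2 m]. *)
Section telescoping.
Context {R : realType}.
Variables (e c t u p : nat -> R) (q w D : R).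
Hypotheses (e0 : forall n, 0 <= e n) (c0 : forall n, 0 <= c n).
Hypotheses (t0 : forall n, 0 <= t n) (u0 : forall n, 0 <= u n) (p0 : forall n, 0 <= p n).
Hypotheses (q0 : 0 <= q) (w0 : 0 <= w) (D0 : 0 <= D).
Hypothesis decr : forall n, e n.+1 + c n + t n <= e n.
Hypothesis upper : forall n, u n.+1 + q * p n <= u n + w * t n.
Hypothesis lower : forall n, u n <= u n.+1 + q * p n + w * t n + w * c n.
Hypothesis dom : forall n, u n <= D * t n.

(** The quantity u_N + q (p_0 + ... + p_(N-1)) + w e_N does not increase with N, the dissipation in
    [decr] paying for the error in [upper]. *)
Lemma telescope_upper N : q * (\sum_(0 <= n < N) p n) <= u 0%N + w * e 0%N.
Proof.
suff H : u N + q * (\sum_(0 <= n < N) p n) + w * e N <= u 0%N + w * e 0%N.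
  by have := u0 N; have := mulr_ge0 w0 (e0 N); lra.
elim: N => [|N IH]; first by rewrite big_geq// mulr0 addr0.
rewrite big_nat_recr//= mulrDr.
have := upper N; have := ler_wpM2l w0 (decr N).
have := mulr_ge0 w0 (c0 N); lra.
Qed.

(** The dissipations have total at most e_0, so some t_N, and with it u_N <= D t_N, is as small as
    desired. This stands in for the fact that the chain eventually passes the level. *)
Lemma telescope_lower (h : R) : 0 < h -> exists N,
  u 0%N <= q * (\sum_(0 <= n < N) p n) + w * e 0%N + h.
Proof.
move=> h0.
have H N : u 0%N + w * e N <= u N + q * (\sum_(0 <= n < N) p n) + w * e 0%N.
  elim: N => [|N IH]; first by rewrite big_geq// mulr0 addr0.
  rewrite big_nat_recr//= mulrDr.
  by have := lower N; have := ler_wpM2l w0 (decr N); lra.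
have tsum N : \sum_(0 <= n < N) t n + e N <= e 0%N.
  elim: N => [|N IH]; first by rewrite big_geq// add0r.
  by rewrite big_nat_recr//=; have := decr N; have := c0 N; lra.
suff [N tN] : exists N, D * t N <= h.
  by exists N; have := H N; have := dom N; have := mulr_ge0 w0 (e0 N); lra.
apply: contrapT => /forallNP tbig.
have e00 : 0 <= e 0%N by [].
(* More than D e_0 / h indices, each contributing at least [h] to the sum of D t_n, would exceed D
   e_0. *)
pose N := (Num.truncn (D * e 0%N / h)).+1.
have Dt n : h <= D * t n by rewrite ltW// ltNge; apply/negP; exact: tbig.
have : h * N%:R <= D * e 0%N.
  have tN : \sum_(0 <= n < N) t n <= e 0%N by have := tsum N; have := e0 N; lra.
  apply: le_trans (ler_wpM2l D0 tN).
  rewrite mulr_sumr mulr_natr -[X in _ *+ X]subn0 -sumr_const_nat.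
  by apply: ler_sum => n _.
rewrite mulrC -ler_pdivlMr// leNgt => /negP; apply.
by have /andP[] := truncn_itv (divr_ge0 (mulr_ge0 D0 e00) (ltW h0)).
Qed.

End telescoping.

(** * Transition operator of the chain *)

Section one_step_operator.
Context {R : realType} {d} {Xi : measurableType d} (Q : probability Xi R).
Variables (a b : Xi -> R).
Hypotheses (ma : measurable_fun setT a) (mb : measurable_fun setT b).
Hypotheses (a01 : forall x, 0 <= a x <= 1) (b03 : forall x, 0 <= b x <= 3).
Implicit Types phi psi : R -> R -> \bar R.

Definition jointly_measurable phi := measurable_fun setT (fun p : R * R => phi p.1 p.2).

Lemma jointly_measurable_comp phi d' (T : measurableType d') (f h : T -> R) :
  jointly_measurable phi -> measurable_fun setT f -> measurable_fun setT h ->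
  measurable_fun setT (fun x => phi (f x) (h x)).
Proof.
move=> mphi mf mh.
exact: (measurableT_comp mphi (measurable_fun_pair mf mh)).
Qed.

Lemma jointly_measurable_shift phi s : jointly_measurable phi ->
  jointly_measurable (fun U => phi (s + U)).
Proof. by move=> mphi; apply: jointly_measurable_comp mphi _ _; measurability. Qed.

Lemma jointly_measurable_average phi z th : jointly_measurable phi ->
  measurable_fun setT (fun x => (2^-1)%:E * (phi (b x * th ^+ 2)%R (z + a x * th)%R +
                          phi (b x * th ^+ 2)%R (z - a x * th)%R))%E.
Proof.
move=> mphi; apply: measurable_average_integrand => // f h mf mh.
exact: jointly_measurable_comp.
Qed.

Lemma average_stepD phi psi z th :
  jointly_measurable phi -> jointly_measurable psi ->
  (forall U z, 0 <= phi U z)%E -> (forall U z, 0 <= psi U z)%E ->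
  (average_step Q a b (fun U z => phi U z + psi U z) z th =
   average_step Q a b phi z th + average_step Q a b psi z th)%E.
Proof.
move=> mphi mpsi phi0 psi0.
have p0 (f : R -> R -> \bar R) : (forall U z, 0 <= f U z)%E -> forall x,
  (0 <= (2^-1)%:E * (f (b x * th ^+ 2)%R (z + a x * th)%R + f (b x * th ^+ 2)%R (z - a x * th)%R))%E.
  by move=> f0 x; apply: mule_ge0; rewrite ?lee_fin//; exact: adde_ge0.
rewrite /average_step.
rewrite -(ge0_integralD Q measurableT (fun x _ => p0 _ phi0 x) (jointly_measurable_average z th mphi)
  (fun x _ => p0 _ psi0 x) (jointly_measurable_average z th mpsi)).
apply: eq_integral => x _.
rewrite -ge0_muleDr; [|exact: adde_ge0|exact: adde_ge0].
by rewrite addeACA.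
Qed.

Lemma average_stepZ phi z th (l : R) : 0 <= l ->
  jointly_measurable phi -> (forall U z, 0 <= phi U z)%E ->
  (average_step Q a b (fun U z => l%:E * phi U z) z th =
   l%:E * average_step Q a b phi z th)%E.
Proof.
move=> l0 mphi phi0; rewrite /average_step.
have p0 x : (0 <= (2^-1)%:E * (phi (b x * th ^+ 2)%R (z + a x * th)%R +
    phi (b x * th ^+ 2)%R (z - a x * th)%R))%E.
  by apply: mule_ge0; rewrite ?lee_fin//; exact: adde_ge0.
rewrite -(ge0_integralZl_EFin Q measurableT (fun x _ => p0 x)
  (jointly_measurable_average z th mphi))//.
apply: eq_integral => x _.
by rewrite -ge0_muleDr// muleCA.
Qed.

Lemma average_step_le phi psi z th :
  jointly_measurable phi -> jointly_measurable psi -> (forall U z, 0 <= phi U z)%E ->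
  (forall U z, (0 <= U <= 3 * th ^+ 2)%R -> (phi U z <= psi U z)%E) ->
  (average_step Q a b phi z th <= average_step Q a b psi z th)%E.
Proof.
move=> mphi mpsi phi0 phipsi; apply: ge0_le_integral => //.
- by move=> x _; apply: mule_ge0; rewrite ?lee_fin//; exact: adde_ge0.
- exact: jointly_measurable_average.
- exact: jointly_measurable_average.
- move=> x _; apply: lee_wpmul2l; first by rewrite lee_fin.
  have U0 : 0 <= b x * th ^+ 2 <= 3 * th ^+ 2.
    by have /andP[b0 b3] := b03 x; rewrite mulr_ge0 ?sqr_ge0//= ler_wpM2r ?sqr_ge0.
  by apply: leeD; exact: phipsi.
Qed.

Lemma average_step_eq0 phi z th : (forall U z, (0 <= U)%R -> phi U z = 0%E) ->
  average_step Q a b phi z th = 0%E.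
Proof.
move=> phi0; apply: integral0_eq => x _.
have U0 : 0 <= b x * th ^+ 2.
  by have /andP[b0 b3] := b03 x; rewrite mulr_ge0 ?sqr_ge0.
by rewrite !phi0// adde0 mule0.
Qed.

Variables (eta : R -> R) (eps : R).
Hypothesis meta : measurable_fun setT eta.

Definition chain_step phi (s z : R) : \bar R :=
  average_step Q a b (fun U => phi (s + U)) z (eps * eta z).

Lemma chain_step_ge0 phi s z : (forall s z, 0 <= phi s z)%E -> (0 <= chain_step phi s z)%E.
Proof. by move=> phi0; apply: average_step_ge0 => U z'; exact: phi0. Qed.

Lemma jointly_measurable_chain_step phi : jointly_measurable phi ->
  (forall s z, 0 <= phi s z)%E -> jointly_measurable (chain_step phi).
Proof.
move=> mphi phi0.
pose F (q : (R * R) * Xi) :=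
  ((2^-1)%:E * (phi (q.1.1 + b q.2 * (eps * eta q.1.2) ^+ 2)%R (q.1.2 + a q.2 * (eps * eta q.1.2))%R +
     phi (q.1.1 + b q.2 * (eps * eta q.1.2) ^+ 2)%R (q.1.2 - a q.2 * (eps * eta q.1.2))%R))%E.
have F0 q : (0 <= F q)%E by apply: mule_ge0; rewrite ?lee_fin//; exact: adde_ge0.
have m1 : measurable_fun setT (fun q : (R * R) * Xi => q.1.1) by exact: measurableT_comp.
have m2 : measurable_fun setT (fun q : (R * R) * Xi => q.1.2) by exact: measurableT_comp.
have m3 : measurable_fun setT (fun q : (R * R) * Xi => eta q.1.2) by exact: measurableT_comp.
have m4 : measurable_fun setT (fun q : (R * R) * Xi => a q.2) by exact: measurableT_comp.
have m5 : measurable_fun setT (fun q : (R * R) * Xi => b q.2) by exact: measurableT_comp.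
have mF : measurable_fun setT F.
  apply: emeasurable_funM; first exact: measurable_cst.
  by apply: emeasurable_funD; apply: jointly_measurable_comp mphi _ _; measurability.
exact: (@measurable_fun_fubini_tonelli_F _ _ _ _ _ Q F mF F0).
Qed.

End one_step_operator.

Section occupation_step.
Context {R : realType} {d} {Xi : measurableType d} (Q : probability Xi R).
Variables (a b : Xi -> R).
Hypotheses (ma : measurable_fun setT a) (mb : measurable_fun setT b).
Hypotheses (a01 : forall x, 0 <= a x <= 1) (b03 : forall x, 0 <= b x <= 3).
Variable m : R.
Hypothesis m_gt0 : 0 < m.
Hypothesis am : (\int[Q]_x (a x ^+ 2)%:E = m%:E)%E.
Hypothesis bm : (\int[Q]_x (b x)%:E = m%:E)%E.
Variables (g eta : R -> R) (K k H L : R).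
Hypotheses (mg : measurable_fun setT g) (meta : measurable_fun setT eta).
Hypotheses (K_ge0 : 0 <= K) (k_ge0 : 0 <= k) (L_ge0 : 0 <= L).
Hypotheses (eta_gt0 : forall z, 0 < eta z) (eta_le : forall z, eta z <= H).
Hypothesis gE : forall z, g z = (eta z ^+ 2)^-1.
Hypothesis g_growth : forall y, g y <= K * expR (k * `|y|).
Hypothesis g_lip : forall y z,
  `|g y - g z| <= K * `|y - z| * expR (k * (`|z| + `|y - z|)).

Let g_gt0 y : 0 < g y.
Proof. by rewrite gE invr_gt0 exprn_gt0. Qed.

Let g_ge0 y : 0 <= g y. Proof. exact: ltW. Qed.

Let H_gt0 : 0 < H. Proof. exact: lt_le_trans (eta_gt0 0) (eta_le 0). Qed.

(** The exponent is 2k: one e^(k|z|) bounds the potential, and a second one is spent in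
    [potential_alive_dissipation] to bound eta^2 from below through the growth of [g]. *)
Definition lyapunov_alive c (s z : R) : \bar R :=
  if s < L then (lyapunov c (2 * k) s z)%:E else 0%E.
Definition lyapunov_dead c (s z : R) : \bar R :=
  if s < L then 0%E else (lyapunov c (2 * k) s z)%:E.
(* Of the extra time [2 * dl], a step crossing the level leaves at least [dl],
   so that [potential_step] applies up to the last step. *)
Definition potential_alive dl (s z : R) : \bar R :=
  if s < L then potential g dl (2 * dl + L - s) z else 0%E.
(** The mean Lyapunov mass that the next step carries beyond the level; it pays for the potential
    dropped at that moment. *)
Definition crossing c eps (s z : R) : \bar R :=
  if s < L then chain_step Q a b eta eps (lyapunov_dead c) s z else 0%E.
Definition dissipation c eps (s z : R) : \bar R :=
  if s < L then ((eps * eta z) ^+ 2 * lyapunov c (2 * k) s z)%:E else 0%E.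
Definition alive (s z : R) : \bar R := if s < L then 1%E else 0%E.

Let measurable_level : measurable_fun setT (fun p : R * R => p.1 < L).
Proof. by apply: measurable_fun_ltr => //; exact: measurable_cst. Qed.

Lemma jointly_measurable_lyapunov c : jointly_measurable (fun s z : R => (lyapunov c (2 * k) s z)%:E).
Proof. by apply/measurable_EFinP; apply: measurable_lyapunov; measurability. Qed.

Lemma jointly_measurable_lyapunov_alive c : jointly_measurable (lyapunov_alive c).
Proof.
apply: measurable_fun_ifT measurable_level _ _; last exact: measurable_cst.
exact: jointly_measurable_lyapunov.
Qed.

Lemma jointly_measurable_lyapunov_dead c : jointly_measurable (lyapunov_dead c).
Proof.
apply: measurable_fun_ifT measurable_level _ _; first exact: measurable_cst.
exact: jointly_measurable_lyapunov.
Qed.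

Lemma jointly_measurable_potential_alive dl : jointly_measurable (potential_alive dl).
Proof.
apply: measurable_fun_ifT measurable_level _ _; last exact: measurable_cst.
by apply: measurable_potential => //; measurability.
Qed.

Lemma lyapunov_alive_ge0 c s z : (0 <= lyapunov_alive c s z)%E.
Proof. by rewrite /lyapunov_alive; case: ifP => // _; rewrite lee_fin ltW// lyapunov_gt0. Qed.

Lemma lyapunov_dead_ge0 c s z : (0 <= lyapunov_dead c s z)%E.
Proof. by rewrite /lyapunov_dead; case: ifP => // _; rewrite lee_fin ltW// lyapunov_gt0. Qed.

Lemma potential_alive_ge0 dl s z : (0 <= potential_alive dl s z)%E.
Proof. by rewrite /potential_alive; case: ifP => // _; exact: potential_ge0. Qed.

Lemma crossing_ge0 c eps s z : (0 <= crossing c eps s z)%E.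
Proof. by rewrite /crossing; case: ifP => // _; apply: chain_step_ge0 => ? ?; exact: lyapunov_dead_ge0. Qed.

Lemma dissipation_ge0 c eps s z : (0 <= dissipation c eps s z)%E.
Proof.
rewrite /dissipation; case: ifP => // _.
by rewrite lee_fin mulr_ge0 ?sqr_ge0// ltW// lyapunov_gt0.
Qed.

Lemma alive_ge0 s z : (0 <= alive s z)%E.
Proof. by rewrite /alive; case: ifP => // _; rewrite lee_fin. Qed.

Lemma jointly_measurable_crossing c eps : jointly_measurable (crossing c eps).
Proof.
apply: measurable_fun_ifT measurable_level _ _; last exact: measurable_cst.
apply: jointly_measurable_chain_step => //; first exact: jointly_measurable_lyapunov_dead.
by move=> s z; exact: lyapunov_dead_ge0.
Qed.

Lemma jointly_measurable_dissipation c eps : jointly_measurable (dissipation c eps).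
Proof.
apply: measurable_fun_ifT measurable_level _ _; last exact: measurable_cst.
have m2 : measurable_fun setT (fun p : R * R => eta p.2) by exact: measurableT_comp.
have m3 : measurable_fun setT (fun p : R * R => lyapunov c (2 * k) p.1 p.2).
  by apply: measurable_lyapunov; measurability.
by measurability.
Qed.

Lemma jointly_measurable_alive : jointly_measurable alive.
Proof. by apply: measurable_fun_ifT measurable_level _ _; exact: measurable_cst. Qed.

(** Time never runs backwards, so a level once passed stays passed. *)
Lemma chain_step_dead phi eps s z : (forall s z, L <= s -> phi s z = 0%E) -> L <= s ->
  chain_step Q a b eta eps phi s z = 0%E.
Proof.
move=> phi0 Ls; apply: average_step_eq0 => // U z' U0; apply: phi0.
by rewrite (le_trans Ls)// lerDl.
Qed.

(** After the step the Lyapunov function is the sum of its alive and dead parts, so [lyapunov_step]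
    splits into the next alive value and the crossing term. *)
Lemma lyapunov_alive_step : exists2 c, 0 <= c & exists2 th0, 0 < th0 &
  forall eps, 0 < eps -> H * eps <= th0 -> forall s z,
  (chain_step Q a b eta eps (lyapunov_alive c) s z + crossing c eps s z +
    dissipation c eps s z <= lyapunov_alive c s z)%E.
Proof.
have k20 : 0 <= 2 * k by rewrite mulr_ge0.
have [c c0 [th0 th00 cB]] := lyapunov_step ma mb a01 b03 am bm m_gt0 k20.
exists c => //; exists th0 => // eps eps0 Heps s z.
have th : 0 <= eps * eta z <= th0.
  rewrite mulr_ge0 ?(ltW eps0) ?(ltW (eta_gt0 z))//=.
  by apply: le_trans Heps; rewrite mulrC ler_wpM2r// ltW.
have [sL|Ls] := ltP s L; last first.
  rewrite chain_step_dead//; last by move=> ? ? h; rewrite /lyapunov_alive ltNge h.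
  by rewrite /crossing /dissipation /lyapunov_alive !ltNge Ls/= !adde0.
have := cB s z _ th.
rewrite /crossing /dissipation /lyapunov_alive !sL; apply: le_trans.
apply: leeD => //.
rewrite /chain_step -average_stepD//.
- apply: average_step_le => //.
  + rewrite /jointly_measurable; apply: emeasurable_funD.
    * exact: jointly_measurable_shift (jointly_measurable_lyapunov_alive c).
    * exact: jointly_measurable_shift (jointly_measurable_lyapunov_dead c).
  + exact: jointly_measurable_shift (jointly_measurable_lyapunov c).
  + by move=> U z'; apply: adde_ge0; [exact: lyapunov_alive_ge0|exact: lyapunov_dead_ge0].
  + move=> U z' _; rewrite /lyapunov_alive /lyapunov_dead.
    by case: ifP => _; rewrite ?adde0 ?add0e.
- exact: jointly_measurable_shift (jointly_measurable_lyapunov_alive c).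
- exact: jointly_measurable_shift (jointly_measurable_lyapunov_dead c).
- by move=> U z'; exact: lyapunov_alive_ge0.
- by move=> U z'; exact: lyapunov_dead_ge0.
Qed.

Local Opaque potential.

(** Killing the potential beyond the level only helps the upper bound; in the lower bound the part
    killed is charged to [crossing]. As in [potential_step], the constant [W] is fixed before
    [dl]. *)
Lemma potential_alive_step c : 0 <= c -> exists2 W, 0 <= W & forall dl, 0 < dl <= 1 ->
  exists2 eps0, 0 < eps0 & forall eps, 0 < eps <= eps0 -> forall s z, 0 <= s ->
  let w := W * Num.sqrt dl in
  (chain_step Q a b eta eps (potential_alive dl) s z + (eps ^+ 2 * m)%:E * alive s z <=
    potential_alive dl s z + w%:E * dissipation c eps s z)%E /\
  (potential_alive dl s z <=
    chain_step Q a b eta eps (potential_alive dl) s z + (eps ^+ 2 * m)%:E * alive s z +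
    w%:E * dissipation c eps s z + w%:E * crossing c eps s z)%E.
Proof.
move=> c0.
have k20 : 0 <= 2 * k by rewrite mulr_ge0.
have [C C0 CB] := potential_step ma mb a01 b03 am bm mg g_ge0 K_ge0 k_ge0 g_growth g_lip.
have [P P0 PB] := potential_growth mg g_ge0 K_ge0 k_ge0 g_growth (3 + L).
(* Undoes the time discount of the Lyapunov function up to L + 1. Later times do not occur here: a
   step beyond L + dl leaves an empty potential. *)
pose X := 2 * expR (c * (L + 1)).
have X0 : 0 <= X by rewrite mulr_ge0 ?expR_ge0.
(* [C] for the window, [P] for the potential dropped at the crossing, 1 for the third-order error
   once D * th <= sqrt(dl). *)
exists (X * (C + P + 1)) => [|dl dl01].
  by rewrite mulr_ge0// !addr_ge0.
have L0 := L_ge0.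
have /andP[dl0 dl1] := dl01.
have M0 : 0 < 3 + L by lra.
have [D D0 DB] := CB dl (3 + L) dl01 M0.
pose q := Num.sqrt dl.
have q0 : 0 < q by rewrite sqrtr_gt0.
have qq : q ^+ 2 = dl by rewrite sqr_sqrtr// ltW.
have q1 : q <= 1 by rewrite -sqrtr1 ler_wsqrtr.
have dlq : dl <= q by rewrite -qq expr2 ler_piMl// ltW.
have DH0 : 0 < (D + 6) * H by rewrite mulr_gt0//; lra.
(* Gives (D + 6) * th <= sqrt(dl), hence both D * th <= sqrt(dl) and 6 * th^2 <= dl. *)
exists (q / ((D + 6) * H)); first by rewrite divr_gt0.
move=> eps /andP[eps0 epsq] s z s0 w.
pose th := eps * eta z.
have th0 : 0 < th by rewrite mulr_gt0.
have thq : th * (D + 6) <= q.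
  rewrite -ler_pdivlMr; last by lra.
  apply: (@le_trans _ _ (eps * H)); first by rewrite ler_wpM2l// ltW.
  rewrite ler_pdivlMr; last by lra.
  by rewrite -mulrA [H * _]mulrC -ler_pdivlMr.
have thD : 0 <= th * D by rewrite mulr_ge0// ltW.
have th6 : 6 * th <= q by lra.
have th1 : th <= 1 by lra.
have th2 : 6 * th ^+ 2 <= dl.
  rewrite -qq !expr2 mulrA; apply: ler_pM => //; rewrite ?mulr_ge0 ?ltW//; lra.
have t20 : 0 <= th ^+ 2 by rewrite sqr_ge0.
have thg : m * th ^+ 2 * g z = eps ^+ 2 * m.
  by rewrite gE /th; field; rewrite gt_eqF.
have w0 : 0 <= w by rewrite mulr_ge0 ?mulr_ge0 ?sqrtr_ge0// !addr_ge0.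
have [sL|Ls] := ltP s L; last first.
  rewrite chain_step_dead//; last by move=> ? ? h; rewrite /potential_alive ltNge h.
  rewrite /crossing /dissipation /potential_alive /alive !ltNge Ls/=.
  by rewrite !mule0 !adde0.
pose T := 2 * dl + L - s.
have T2 : 2 * dl <= T by rewrite /T; lra.
have TM : T <= 3 + L by rewrite /T; lra.
have th01 : 0 <= th <= 1 by rewrite (ltW th0).
have := DB T z th T2 TM th01 th2.
set e := th ^+ 2 * _ * _; set A := average_step _ _ _ _ _ _.
rewrite thg => -[H1 H2].
have ee : e <= w * (th ^+ 2 * lyapunov c (2 * k) s z).
  have ekz : expR (k * `|z|) <= X * lyapunov c (2 * k) s z.
    apply: le_trans (lyapunov_ge (s1 := L + 1) z c0 k20 _); last by lra.
    by rewrite ler_expR ler_wpM2r//; lra.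
  have l0 := lyapunov_gt0 c (2 * k) s z.
  have e0 := expR_ge0 (k * `|z|).
  apply: (@le_trans _ _ (th ^+ 2 * ((C + P + 1) * q) * (X * lyapunov c (2 * k) s z))).
    apply: ler_pM => //.
      by apply: mulr_ge0 => //; apply: addr_ge0; apply: mulr_ge0 => //; exact: ltW.
    rewrite ler_wpM2l// -/q.
    have : 0 <= P * q by rewrite mulr_ge0// ltW.
    by lra.
  by rewrite le_eqVlt; apply/orP; left; apply/eqP; rewrite /w -/q; ring.
have mpa := jointly_measurable_shift s (jointly_measurable_potential_alive dl).
have mp : jointly_measurable (fun U z => potential g dl (T - U) z).
  by apply: measurable_potential => //; measurability.
have mld := jointly_measurable_shift s (jointly_measurable_lyapunov_dead c).
rewrite /alive /dissipation /crossing /potential_alive sL -/(potential_alive dl) mule1 -/T -/th.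
split.
- apply: (@le_trans _ _ (A + (eps ^+ 2 * m)%:E)%E).
    rewrite leeD2r//; apply: average_step_le => //.
      by move=> U z'; exact: potential_alive_ge0.
    move=> U z' _; rewrite /potential_alive; case: ifP => _; last exact: potential_ge0.
    by rewrite /T opprD addrA.
  by apply: le_trans H1 _; rewrite leeD2l// -EFinM lee_fin.
- have AB : (A <= chain_step Q a b eta eps (potential_alive dl) s z +
     w%:E * chain_step Q a b eta eps (lyapunov_dead c) s z)%E.
    rewrite /chain_step -average_stepZ//; last by move=> U z'; exact: lyapunov_dead_ge0.
    have wl0 U z' : (0 <= w%:E * lyapunov_dead c U z')%E.
      by apply: mule_ge0; [rewrite lee_fin|exact: lyapunov_dead_ge0].
    have mwl : jointly_measurable (fun U z => w%:E * lyapunov_dead c (s + U)%R z)%E.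
      by apply: emeasurable_funM; [exact: measurable_cst|exact: mld].
    rewrite -average_stepD//; last by move=> U z'; exact: potential_alive_ge0.
    apply: average_step_le => //.
    + by apply: emeasurable_funD; [exact: mpa|exact: mwl].
    + by move=> U z'; exact: potential_ge0.
    + move=> U z' /andP[U0 U3]; rewrite /potential_alive /lyapunov_dead.
      have [sUL|LsU] := ltP (s + U) L.
        by rewrite mule0 adde0 /T opprD addrA.
      (* Past the level at most 2 * dl of time remains, so the dropped potential is an integral over
         a length of at most [dl], and dl <= sqrt(dl). *)
      rewrite add0e; have [TU|TU] := leP (T - U) dl.
        by rewrite potential_empty// -EFinM lee_fin mulr_ge0// ltW// lyapunov_gt0.
      have TUM : T - U <= 3 + L by lra.
      apply: le_trans (PB dl (T - U) z' dl0 (ltW TU) TUM) _.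
      rewrite -EFinM lee_fin.
      have ekz : expR (k * `|z'|) <= X * lyapunov c (2 * k) (s + U) z'.
        apply: le_trans (lyapunov_ge (s1 := L + 1) z' c0 k20 _); last by lra.
        by rewrite ler_expR ler_wpM2r//; lra.
      apply: (@le_trans _ _ (q * (P * (X * lyapunov c (2 * k) (s + U) z')))).
        apply: ler_pM; rewrite ?mulr_ge0 ?expR_ge0//; first by lra.
          by rewrite /T in TU *; lra.
        by rewrite ler_wpM2l.
      have l0 := lyapunov_gt0 c (2 * k) (s + U) z'.
      have : 0 <= (C + 1) * (X * (q * lyapunov c (2 * k) (s + U) z')).
        apply: mulr_ge0; first by rewrite addr_ge0.
        by apply: mulr_ge0 => //; apply: mulr_ge0; exact: ltW.
      by rewrite /w -/q; lra.
  apply: le_trans H2 _.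
  rewrite [leRHS]addeAC; apply: leeD; last by rewrite -EFinM lee_fin.
  by rewrite [leRHS]addeAC leeD2r.
Qed.

(** The growth of [g] = 1/eta^2 gives 1 <= K e^(k|z|) eta^2, which compares the potential with the
    dissipation even where eta is small. [D] may depend on eps: it serves only to make the potential
    vanish along the chain for fixed eps. *)
Lemma potential_alive_dissipation c dl : 0 <= c -> 0 < dl <= 1 -> forall eps, 0 < eps ->
  exists2 D, 0 <= D & forall s z, 0 <= s ->
  (potential_alive dl s z <= D%:E * dissipation c eps s z)%E.
Proof.
move=> c0 /andP[dl0 dl1] eps eps0.
have k20 : 0 <= 2 * k by rewrite mulr_ge0.
have [P P0 PB] := potential_growth mg g_ge0 K_ge0 k_ge0 g_growth (3 + L).
pose X := 2 * expR (c * L).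
have X0 : 0 <= X by rewrite mulr_ge0 ?expR_ge0.
have e20 : 0 < eps ^+ 2 by rewrite exprn_gt0.
have L0 := L_ge0.
have L30 : 0 <= 3 + L by lra.
exists (K * (3 + L) * P * X / eps ^+ 2) => [|s z s0].
  by rewrite divr_ge0 ?(ltW e20)// !mulr_ge0.
rewrite /potential_alive /dissipation; case: ifP => sL; last by rewrite mule0.
apply: le_trans (PB dl (2 * dl + L - s) z dl0 _ _) _; [lra|lra|].
rewrite -EFinM lee_fin exprMn.
have ekz : expR (2 * k * `|z|) <= X * lyapunov c (2 * k) s z.
  by apply: lyapunov_ge => //; exact: ltW.
have gz := g_growth z; rewrite gE in gz.
have ge0 : 0 < eta z ^+ 2 by rewrite exprn_gt0.
have etaB : 1 <= K * expR (k * `|z|) * eta z ^+ 2.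
  by rewrite -ler_pdivrMr// div1r.
have kz0 : 0 < expR (k * `|z|) by exact: expR_gt0.
apply: (@le_trans _ _ ((3 + L) * P * expR (k * `|z|) * (K * expR (k * `|z|) * eta z ^+ 2))).
  rewrite -[leLHS]mulr1; apply: ler_pM => //.
    by apply: mulr_ge0; [lra|apply: mulr_ge0 => //; exact: ltW].
  rewrite -!mulrA; apply: ler_wpM2r; first by apply: mulr_ge0 => //; exact: ltW.
  lra.
have -> : (3 + L) * P * expR (k * `|z|) * (K * expR (k * `|z|) * eta z ^+ 2) =
  (K * (3 + L) * P * eta z ^+ 2) * expR (2 * k * `|z|).
  have -> : 2 * k * `|z| = k * `|z| + k * `|z| by ring.
  by rewrite expRD; ring.
have -> : K * (3 + L) * P * X / eps ^+ 2 * (eps ^+ 2 * eta z ^+ 2 * lyapunov c (2 * k) s z) =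
  (K * (3 + L) * P * eta z ^+ 2) * (X * lyapunov c (2 * k) s z).
  by field; rewrite gt_eqF.
by apply: ler_wpM2l => //; apply: mulr_ge0; [rewrite !mulr_ge0|exact: ltW].
Qed.

End occupation_step.

(** * Convergence of the occupation sums *)

Section occupation_limit.
Context {R : realType} {d} {Xi : measurableType d} (Q : probability Xi R).
Local Notation mu := (@lebesgue_measure R).
Variables (a b : Xi -> R).
Hypotheses (ma : measurable_fun setT a) (mb : measurable_fun setT b).
Hypotheses (a01 : forall x, 0 <= a x <= 1) (b03 : forall x, 0 <= b x <= 3).
Variable m : R.
Hypothesis m_gt0 : 0 < m.
Hypothesis am : (\int[Q]_x (a x ^+ 2)%:E = m%:E)%E.
Hypothesis bm : (\int[Q]_x (b x)%:E = m%:E)%E.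
Variables (g eta : R -> R) (K k H L : R).
Hypotheses (mg : measurable_fun setT g) (meta : measurable_fun setT eta).
Hypotheses (K_ge0 : 0 <= K) (k_ge0 : 0 <= k) (L_gt0 : 0 < L).
Hypotheses (eta_gt0 : forall z, 0 < eta z) (eta_le : forall z, eta z <= H).
Hypothesis gE : forall z, g z = (eta z ^+ 2)^-1.
Hypothesis g_growth : forall y, g y <= K * expR (k * `|y|).
Hypothesis g_lip : forall y z,
  `|g y - g z| <= K * `|y - z| * expR (k * (`|z| + `|y - z|)).

Let g_ge0 y : 0 <= g y. Proof. by rewrite gE invr_ge0 exprn_ge0// ltW. Qed.
Let L_ge0 : 0 <= L. Proof. exact: ltW. Qed.

Context {d'} {Omega : measurableType d'} (P : probability Omega R).

(* Only the one-dimensional marginals of the Markov chain matter. *)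
Definition is_chain (eps : R) (S Z : nat -> Omega -> R) : Prop :=
  [/\ forall n, measurable_fun setT (S n), forall n, measurable_fun setT (Z n),
      forall n w, 0 <= S n w, forall w, S 0%N w = 0 /\ Z 0%N w = 0 &
      forall n (phi : R -> R -> \bar R), jointly_measurable phi ->
        (forall s z, 0 <= phi s z)%E ->
        (\int[P]_w phi (S n.+1 w) (Z n.+1 w) =
         \int[P]_w chain_step Q a b eta eps phi (S n w) (Z n w))%E].

Local Opaque potential.

(** Means along the chain turn the pointwise inequalities into those of the telescoping sequences,
    with w = W sqrt(dl). The Lyapunov mean starts at 1, so the total error is at most [w]. *)
Lemma chain_occupation : exists2 C, 0 <= C & forall dl, 0 < dl <= 1 ->
  exists2 eps0, 0 < eps0 & forall eps S Z, 0 < eps <= eps0 -> is_chain eps S Z ->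
  let N := (\sum_(0 <= n <oo) P [set w | (S n w < L)%R])%E in
  let e := (C * Num.sqrt dl)%:E in
  ((eps ^+ 2 * m)%:E * N <= potential g dl (2 * dl + L) 0 + e)%E /\
  (potential g dl (2 * dl + L) 0 <= (eps ^+ 2 * m)%:E * N + e)%E.
Proof.
have [c c0 [th0 th00 decr]] := lyapunov_alive_step ma mb a01 b03 m_gt0 am bm L k_ge0 eta_gt0 eta_le.
have [W W0 step] := potential_alive_step ma mb a01 b03 am bm mg K_ge0 k_ge0 L_ge0
  eta_gt0 eta_le gE g_growth g_lip c0.
have H0 : 0 < H by exact: lt_le_trans (eta_gt0 0) (eta_le 0).
exists W => // dl dl01; have [eps1 eps10 {}step] := step dl dl01.
exists (Num.min eps1 (th0 / H)); first by rewrite lt_min eps10 divr_gt0.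
move=> eps S Z /andP[eps0]; rewrite le_min => /andP[epsle1 epsle2] [mS mZ S0 SZ0 chain] N e.
have Heps : H * eps <= th0 by rewrite mulrC -ler_pdivlMr.
have {}decr := decr eps eps0 Heps.
have eps01 : 0 < eps <= eps1 by rewrite eps0.
have {}step := step eps eps01.
have [D D0 dom] := potential_alive_dissipation mg K_ge0 k_ge0 L_ge0 eta_gt0 gE g_growth c0 dl01 eps0.
set w := W * Num.sqrt dl in step e *.
have w0 : 0 <= w by rewrite mulr_ge0// sqrtr_ge0.
pose E (phi : R -> R -> \bar R) n := (\int[P]_x phi (S n x) (Z n x))%E.
have m_comp phi n : jointly_measurable phi -> measurable_fun setT (fun x => phi (S n x) (Z n x)).
  by move=> mphi; exact: jointly_measurable_comp.
have E_ge0 phi n : (forall s z, 0 <= phi s z)%E -> (0 <= E phi n)%E.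
  by move=> phi0; apply: integral_ge0 => x _; exact: phi0.
have EDl phi psi n : jointly_measurable phi -> jointly_measurable psi ->
    (forall s z, 0 <= phi s z)%E -> (forall s z, 0 <= psi s z)%E ->
    E (fun s z => phi s z + psi s z)%E n = (E phi n + E psi n)%E.
  move=> mphi mpsi phi0 psi0; rewrite /E ge0_integralD//.
  - exact: m_comp.
  - exact: m_comp.
have EZl phi (l : R) n : 0 <= l -> jointly_measurable phi -> (forall s z, 0 <= phi s z)%E ->
    E (fun s z => l%:E * phi s z)%E n = (l%:E * E phi n)%E.
  move=> l0 mphi phi0; rewrite /E ge0_integralZl_EFin//; exact: m_comp.
have Ele phi psi n : jointly_measurable phi -> jointly_measurable psi ->
    (forall s z, 0 <= phi s z)%E ->
    (forall s z, (0 <= s)%R -> (phi s z <= psi s z)%E) -> (E phi n <= E psi n)%E.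
  move=> mphi mpsi phi0 phipsi; apply: ge0_le_integral => //.
  - exact: m_comp.
  - exact: m_comp.
  - by move=> x _; exact: phipsi.
have mD (phi psi : R -> R -> \bar R) : jointly_measurable phi -> jointly_measurable psi ->
    jointly_measurable (fun s z => phi s z + psi s z)%E.
  by move=> mphi mpsi; exact: emeasurable_funD.
have mZl (phi : R -> R -> \bar R) (l : R) : jointly_measurable phi ->
    jointly_measurable (fun s z => l%:E * phi s z)%E.
  by move=> mphi; apply: emeasurable_funM => //; exact: measurable_cst.
have Dge0 (phi psi : R -> R -> \bar R) : (forall s z, 0 <= phi s z)%E -> (forall s z, 0 <= psi s z)%E ->
   (forall s z, 0 <= phi s z + psi s z)%E by move=> p1 p2 s z; exact: adde_ge0.
have Zge0 (phi : R -> R -> \bar R) (l : R) : 0 <= l -> (forall s z, 0 <= phi s z)%E ->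
   (forall s z, 0 <= l%:E * phi s z)%E by move=> l0 p1 s z; apply: mule_ge0.
have Estep phi n : jointly_measurable phi -> (forall s z, 0 <= phi s z)%E ->
   E (chain_step Q a b eta eps phi) n = E phi n.+1 by move=> mp p0; rewrite /E chain.
pose V := lyapunov_alive k L c; pose U := potential_alive g L dl.
pose G := crossing Q a b eta k L c eps; pose T := dissipation eta k L c eps.
pose I : R -> R -> \bar R := alive L.
have mV : jointly_measurable V by exact: jointly_measurable_lyapunov_alive.
have mU : jointly_measurable U by exact: jointly_measurable_potential_alive.
have mG : jointly_measurable G by exact: jointly_measurable_crossing.
have mT : jointly_measurable T by exact: jointly_measurable_dissipation.
have mI : jointly_measurable I by exact: jointly_measurable_alive.
have V0 s z : (0 <= V s z)%E by exact: lyapunov_alive_ge0.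
have U0 s z : (0 <= U s z)%E by exact: potential_alive_ge0.
have G0 s z : (0 <= G s z)%E by exact: crossing_ge0.
have T0 s z : (0 <= T s z)%E by exact: dissipation_ge0.
have I0 s z : (0 <= I s z)%E by exact: alive_ge0.
have mK phi : jointly_measurable phi -> (forall s z, 0 <= phi s z)%E ->
  jointly_measurable (chain_step Q a b eta eps phi).
  by move=> mp p0; exact: jointly_measurable_chain_step.
have K0 phi : (forall s z, 0 <= phi s z)%E -> (forall s z, 0 <= chain_step Q a b eta eps phi s z)%E.
  by move=> p0 s z; exact: chain_step_ge0.
have em0 : 0 <= eps ^+ 2 * m by rewrite mulr_ge0 ?sqr_ge0// ltW.
have decrE n : (E V n.+1 + E G n + E T n <= E V n)%E.
  rewrite -(Estep _ _ mV V0) -EDl//; [|exact: mK|exact: K0].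
  rewrite -EDl//; [|by apply: mD => //; exact: mK|by apply: Dge0 => //; exact: K0].
  apply: Ele => //.
  - by apply: (mD (fun s z => _ + _)%E) => //; apply: mD => //; exact: mK.
  - by apply: (Dge0 (fun s z => _ + _)%E) => //; apply: Dge0 => //; exact: K0.
have upperE n : (E U n.+1 + (eps ^+ 2 * m)%:E * E I n <= E U n + w%:E * E T n)%E.
  rewrite -(Estep _ _ mU U0) -!EZl// -EDl//; [|exact: mK|exact: mZl|exact: K0|exact: Zge0].
  rewrite -EDl//; [|exact: mZl|exact: Zge0].
  apply: Ele => //.
  - by apply: mD; [exact: mK|exact: mZl].
  - by apply: mD => //; exact: mZl.
  - by apply: Dge0; [exact: K0|exact: Zge0].
  - by move=> s z s0; have [] := step s z s0.
have lowerE n : (E U n <= E U n.+1 + (eps ^+ 2 * m)%:E * E I n + w%:E * E T n + w%:E * E G n)%E.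
  rewrite -(Estep _ _ mU U0) -!EZl// -EDl//; [|exact: mK|exact: mZl|exact: K0|exact: Zge0].
  rewrite -EDl//; [|by apply: mD; [exact: mK|exact: mZl]|exact: mZl|by apply: Dge0; [exact: K0|exact: Zge0]|exact: Zge0].
  rewrite -EDl//; last 4 first.
  - apply: (mD (fun s z => _ + _)%E); last exact: mZl.
    by apply: mD; [exact: mK|exact: mZl].
  - exact: mZl.
  - apply: (Dge0 (fun s z => _ + _)%E); last exact: Zge0.
    by apply: Dge0; [exact: K0|exact: Zge0].
  - exact: Zge0.
  apply: Ele => //.
  - apply: (mD (fun s z => _ + _)%E); last exact: mZl.
    apply: (mD (fun s z => _ + _)%E); last exact: mZl.
    by apply: mD; [exact: mK|exact: mZl].
  - by move=> s z s0; have [] := step s z s0.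
have domE n : (E U n <= D%:E * E T n)%E.
  rewrite -EZl//; apply: Ele => //; exact: mZl.
have mSL n : measurable [set x | S n x < L].
  have -> : [set x | S n x < L] = S n @^-1` `]-oo, L[.
    by apply/seteqP; split=> x /=; rewrite in_itv.
  by rewrite -[X in measurable X]setTI; apply: mS.
have IE n : E I n = P [set x | S n x < L].
  rewrite /E /I /alive -[RHS]mul1e -integral_cst// integral_mkcond.
  by apply: eq_integral => x _; rewrite patchE mem_setE.
have E0E phi : E phi 0%N = phi 0 0.
  rewrite /E (eq_integral (cst (phi 0 0))).
    by rewrite integral_cst// [X in (_ * X)%E]probability_setT mule1.
  by move=> x _; have [-> ->] := SZ0 x.
have VL : (E V 0%N <= 1)%E.
  rewrite E0E /V /lyapunov_alive L_gt0.
  by rewrite lyapunov00.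
(* The Lyapunov decrease propagates finiteness from the value at step 0; the dissipation, crossing
   and potential means are then finite by domination, and the argument can pass to real
   sequences. *)
have Vfin n : E V n \is a fin_num.
  rewrite ge0_fin_numE ?E_ge0//; elim: n => [|n IH]; first by rewrite (le_lt_trans VL)// ltry.
  apply: le_lt_trans IH; apply: le_trans (decrE n).
  by rewrite -addeA leeDl// adde_ge0 ?E_ge0.
have le_V n x y : (0 <= x)%E -> (0 <= y)%E -> (x + y <= E V n)%E -> x \is a fin_num.
  move=> x0 y0 xyV; rewrite ge0_fin_numE// (@le_lt_trans _ _ (E V n))//.
    by apply: le_trans xyV; rewrite leeDl.
  by rewrite -ge0_fin_numE// E_ge0.
have Tfin n : E T n \is a fin_num.
  apply: (le_V n _ (E V n.+1 + E G n)%E (E_ge0 T n T0)).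
    by apply: adde_ge0; exact: E_ge0.
  by rewrite addeC; exact: decrE.
have Gfin n : E G n \is a fin_num.
  apply: (le_V n _ (E V n.+1 + E T n)%E (E_ge0 G n G0)).
    by apply: adde_ge0; exact: E_ge0.
  by rewrite addeCA addeA; exact: decrE.
have Ufin n : E U n \is a fin_num.
  rewrite ge0_fin_numE ?E_ge0// (le_lt_trans (domE n))// -ge0_fin_numE.
    by rewrite fin_numM.
  by apply: mule_ge0; [rewrite lee_fin|exact: E_ge0].
have Ifin n : E I n \is a fin_num.
  by rewrite IE; apply: fin_num_measure.
have real_of phi : (forall n, E phi n \is a fin_num) -> (forall s z, 0 <= phi s z)%E ->
    exists2 r : nat -> R, forall n, 0 <= r n & forall n, E phi n = (r n)%:E.
  move=> phifin phi0; exists (fun n => fine (E phi n)) => n; first by rewrite fine_ge0// E_ge0.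
  by rewrite fineK.
have [rV rV0 rVE] := real_of V Vfin V0.
have [rU rU0 rUE] := real_of U Ufin U0.
have [rT rT0 rTE] := real_of T Tfin T0.
have [rG rG0 rGE] := real_of G Gfin G0.
have [rI rI0 rIE] := real_of I Ifin I0.
have decrR n : rV n.+1 + rG n + rT n <= rV n.
  by move: (decrE n); rewrite !rVE rGE rTE -!EFinD lee_fin.
have upperR n : rU n.+1 + (eps ^+ 2 * m) * rI n <= rU n + w * rT n.
  by move: (upperE n); rewrite !rUE rIE rTE -!EFinM -!EFinD lee_fin.
have lowerR n : rU n <= rU n.+1 + (eps ^+ 2 * m) * rI n + w * rT n + w * rG n.
  by move: (lowerE n); rewrite !rUE rIE rTE rGE -!EFinM -!EFinD lee_fin.
have domR n : rU n <= D * rT n.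
  by move: (domE n); rewrite rUE rTE -EFinM lee_fin.
have rV1 : rV 0%N <= 1 by move: VL; rewrite rVE lee_fin.
have U0E : (rU 0%N)%:E = potential g dl (2 * dl + L) 0.
  by rewrite -rUE E0E /U /potential_alive L_gt0 subr0.
have sumE M : (\sum_(0 <= n < M) P [set x | (S n x < L)%R] = (\sum_(0 <= n < M) rI n)%:E)%E.
  by rewrite -sumEFin; apply: eq_bigr => n _; rewrite -rIE IE.
have emp : 0 < eps ^+ 2 * m by rewrite mulr_gt0// exprn_gt0.
have Nge M : (\sum_(0 <= n < M) P [set x | (S n x < L)%R] <= N)%E.
  by apply: nneseries_lim_ge.
rewrite -U0E /e -/w; clear - w0 D0 rV0 rU0 rT0 rG0 rI0 decrR upperR lowerR domR rV1 sumE emp Nge.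
split.
- have up M : (eps ^+ 2 * m) * (\sum_(0 <= n < M) rI n) <= rU 0%N + w.
    apply: le_trans (telescope_upper rV0 rG0 rU0 w0 decrR upperR M) _.
    by rewrite lerD2l ler_piMr.
  rewrite -lee_pdivlMl// /N.
  apply: lime_le; first exact: is_cvg_nneseries.
  apply: nearW => M; rewrite sumE lee_pdivlMl// -EFinM.
  by rewrite -EFinD lee_fin up.
- apply/lee_addgt0Pr => h h0.
  have [M MB] := telescope_lower rV0 rG0 w0 D0 decrR lowerR domR h0.
  apply: (@le_trans _ _ ((eps ^+ 2 * m) * (\sum_(0 <= n < M) rI n) + w + h)%:E).
    rewrite lee_fin; apply: le_trans MB _; rewrite lerD2r lerD2l ler_piMr//.
  rewrite !EFinD leeD2r// leeD2r// EFinM -sumE.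
  by apply: lee_wpmul2l; rewrite ?lee_fin// ltW.
Qed.

End occupation_limit.

Section occupation_limit_cvg.
Context {R : realType} {d} {Xi : measurableType d} (Q : probability Xi R).
Local Notation mu := (@lebesgue_measure R).
Variables (a b : Xi -> R).
Hypotheses (ma : measurable_fun setT a) (mb : measurable_fun setT b).
Hypotheses (a01 : forall x, 0 <= a x <= 1) (b03 : forall x, 0 <= b x <= 3).
Variable m : R.
Hypothesis m_gt0 : 0 < m.
Hypothesis am : (\int[Q]_x (a x ^+ 2)%:E = m%:E)%E.
Hypothesis bm : (\int[Q]_x (b x)%:E = m%:E)%E.
Variables (g eta : R -> R) (K k H L : R).
Hypotheses (mg : measurable_fun setT g) (meta : measurable_fun setT eta).
Hypotheses (K_ge0 : 0 <= K) (k_ge0 : 0 <= k) (L_gt0 : 0 < L).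
Hypotheses (eta_gt0 : forall z, 0 < eta z) (eta_le : forall z, eta z <= H).
Hypothesis gE : forall z, g z = (eta z ^+ 2)^-1.
Hypothesis g_growth : forall y, g y <= K * expR (k * `|y|).
Hypothesis g_lip : forall y z,
  `|g y - g z| <= K * `|y - z| * expR (k * (`|z| + `|y - z|)).

Let g_ge0 y : 0 <= g y. Proof. by rewrite gE invr_ge0 exprn_ge0// ltW. Qed.
Let L_ge0 : 0 <= L. Proof. exact: ltW. Qed.

Context {d'} {Omega : measurableType d'} (P : probability Omega R).

(** The two intervals differ by ]0, dl] and ]L, L + 2 dl], and W(r, 0) stays bounded as r tends to
    0. *)
Lemma potential_truncation : exists2 C, 0 <= C & forall dl, 0 < dl <= 1 ->
  (potential g dl (2 * dl + L) 0 <= potential g 0 L 0 + (C * dl)%:E)%E /\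
  (potential g 0 L 0 <= potential g dl (2 * dl + L) 0 + (C * dl)%:E)%E.
Proof.
have [C C0 CB] := smooth_growth mg g_ge0 K_ge0 k_ge0 g_growth (2 + L).
have L0 := L_gt0.
exists (2 * C) => [|dl /andP[dl0 dl1]]; first by rewrite mulr_ge0.
have short (u v : R) : 0 <= u -> u <= v -> v <= 2 + L -> v - u <= 2 * dl ->
    (\int[mu]_(r in `]u, v]) smooth g r 0%R <= (2 * C * dl)%:E)%E.
  move=> u0 uv v2 uvdl.
  apply: (@le_trans _ _ (\int[mu]_(r in `]u, v]) C%:E)%E).
    apply: ge0_le_integral => //.
    - by move=> r _; exact: smooth_ge0.
    - by apply: measurable_funTS; exact: measurable_smooth_time.
    - move=> r /=; rewrite in_itv/= => /andP[ur rv].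
      have rM : 0 < r <= 2 + L by apply/andP; split; lra.
      by have := CB r 0 rM; rewrite normr0 mulr0 expR0 mulr1.
  rewrite integral_cst_itvoc// lee_fin.
  by have := ler_wpM2r C0 uvdl; lra.
have msm D : measurable_fun D (fun r : R => smooth g r 0).
  by apply: measurable_funTS; exact: measurable_smooth_time.
have sm0 r : (0 <= smooth g r 0)%E by exact: smooth_ge0.
have key (u v u' v' u2 v2 : R) :
    0 <= u2 -> u2 <= v2 -> v2 <= 2 + L -> v2 - u2 <= 2 * dl ->
    [disjoint `]u', v'] & `]u2, v2]] -> `]u, v] `<=` `]u', v'] `|` `]u2, v2] ->
    (potential g u v 0 <= potential g u' v' 0 + (2 * C * dl)%:E)%E.
  move=> h1 h2 h3 h4 h5 h6; apply: (@le_trans _ _ (potential g u' v' 0 + \int[mu]_(r in `]u2, v2]) smooth g r 0%R)%E).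
    rewrite /potential -ge0_integral_setU//.
      apply: (@ge0_subset_integral _ _ _ mu _ _ (measurable_itv _) (measurableU _ _ (measurable_itv _) (measurable_itv _)) _ (msm _)) => // r _; exact: sm0.
    exact: msm.
  by rewrite leeD2l// short.
split.
- apply: (key _ _ _ _ L (2 * dl + L)); [lra|lra|lra|lra| |].
    rewrite disj_set2E; apply/eqP/seteqP; split => r //=; rewrite !in_itv/= => -[/andP[_ h] /andP[h' _]]; lra.
  move=> r /=; rewrite !in_itv/= => /andP[h1 h2].
  by have [h|h] := leP r L; [left|right]; apply/andP; split; lra.
- apply: (key _ _ _ _ 0 dl); [lra|lra|lra|lra| |].
    rewrite disj_set2E; apply/eqP/seteqP; split => r //=; rewrite !in_itv/= => -[/andP[h _] /andP[_ h']]; lra.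
  move=> r /=; rewrite !in_itv/= => /andP[h1 h2].
  by have [h|h] := leP r dl; [right|left]; apply/andP; split; lra.
Qed.

Lemma potential_fin_num : potential g 0 L 0 \is a fin_num.
Proof.
have L0 := L_gt0.
have [C C0 CB] := potential_truncation.
have [D D0 DB] := potential_growth mg g_ge0 K_ge0 k_ge0 g_growth (2 + L).
have [|_ h] := CB 1; first by rewrite ltr01 lexx.
rewrite ge0_fin_numE ?potential_ge0//; apply: (le_lt_trans h).
rewrite lte_add_pinfty ?ltry//.
apply: (le_lt_trans (DB _ _ _ _ _ _)); [by []|lra|lra|exact: ltry].
Qed.

Lemma chain_occupation_cvg (N : R -> \bar R) :
  (forall eps, 0 < eps -> exists S Z, is_chain Q a b eta P eps S Z /\
     N eps = (\sum_(0 <= n <oo) P [set w | (S n w < L)%R])%E) ->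
  ((eps ^+ 2)%:E * N eps)%E @[eps --> 0^'+] --> (m^-1%:E * potential g 0 L 0)%E.
Proof.
move=> NE.
have [C C0 CB] := chain_occupation ma mb a01 b03 m_gt0 am bm mg meta K_ge0 k_ge0 L_gt0
  eta_gt0 eta_le gE g_growth g_lip P.
have [D D0 DB] := potential_truncation.
have Jfin := potential_fin_num.
move: CB DB Jfin; rewrite -(fineK potential_fin_num).
move: (fine _) => J CB DB _.
have main e : 0 < e -> exists2 eps0, 0 < eps0 & forall eps, 0 < eps <= eps0 ->
    exists2 v, ((eps ^+ 2)%:E * N eps)%E = v%:E & `|m^-1 * J - v| <= e.
  move=> e0.
  have CDp : 0 < C + D + 1 by lra.
  (* With dl = q^2 both the error sqrt(dl) of the chain and the error [dl] of the truncation are at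
     most linear in [q], and their total is at most e * m. *)
  pose q := Num.min 1 (e * m / (C + D + 1)).
  have q0 : 0 < q by rewrite lt_min ltr01 divr_gt0// mulr_gt0.
  have q1 : q <= 1 by rewrite ge_min lexx.
  have qe : (C + D) * q <= e * m.
    have : q * (C + D + 1) <= e * m by rewrite -ler_pdivlMr// ge_min lexx orbT.
    by lra.
  have dl01 : 0 < q ^+ 2 <= 1 by rewrite exprn_gt0//= expr_le1// ltW.
  have [eps0 eps00 {}CB] := CB _ dl01.
  have [U1 U2] := DB _ dl01.
  exists eps0 => // eps eps0p.
  have epsp : 0 < eps by case/andP: eps0p.
  have [S [Z [SZ ->]]] := NE eps epsp.
  have [] := CB eps S Z eps0p SZ.
  rewrite sqrtr_sqr ger0_norm ?(ltW q0)//.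
  move: U1 U2; move: (potential _ _ _ _) => V U1 U2.
  set M := (\sum_(0 <= n <oo) _)%E => B1 B2.
  have q2 : D * q ^+ 2 <= D * q by rewrite ler_wpM2l// expr2 ler_piMl// ltW.
  have M0 : (0 <= M)%E by apply: nneseries_ge0 => n _ _; exact: measure_ge0.
  have ep0 : 0 < eps ^+ 2 * m by rewrite mulr_gt0// exprn_gt0.
  have h1 : ((eps ^+ 2 * m)%:E * M <= (J + e * m)%:E)%E.
    apply: le_trans B1 _; apply: le_trans (leeD2r _ U1) _.
    by rewrite -!EFinD lee_fin; lra.
  have h2 : (J%:E <= (eps ^+ 2 * m)%:E * M + (e * m)%:E)%E.
    apply: le_trans U2 _; apply: le_trans (leeD2r _ B2) _.
    by rewrite -addeA -EFinD; apply: leeD2l; rewrite lee_fin; lra.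
  have Mfin : M \is a fin_num.
    rewrite ge0_fin_numE//; move: h1; rewrite -lee_pdivlMl// => /le_lt_trans; apply.
    by rewrite -EFinM ltry.
  move: h1 h2; rewrite -(fineK Mfin); move: (fine M) => v.
  rewrite -!EFinM -EFinD !lee_fin => h1 h2.
  exists (eps ^+ 2 * v) => //.
  rewrite -(ler_pM2r m_gt0) -[X in _ * X <= _](gtr0_norm m_gt0) -normrM mulrBl mulrAC mulVf ?gt_eqF// mul1r.
  by rewrite ler_norml; apply/andP; split; lra.
(* By [main] the values are finite near 0, so the limit may be taken in the reals. *)
apply: (@cvg_trans _ ((fine ((eps ^+ 2)%:E * N eps)%E)%:E @[eps --> 0^'+])).
  apply: near_eq_cvg.
  have [eps0 eps00 h] := main 1 ltr01.
  near=> eps; have [|v -> //] := h eps.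
  by apply/andP; split; near: eps; [exact: nbhs_right_gt|exact: nbhs_right_le].
rewrite -EFinM; apply: cvg_EFin; first by near=> eps.
apply/cvgrPdist_le => e e0.
have [eps0 eps00 h] := main e e0.
near=> eps; have [|v /= ->/=] := h eps; last by [].
by apply/andP; split; near: eps; [exact: nbhs_right_gt|exact: nbhs_right_le].
Unshelve. all: by end_near. Qed.

End occupation_limit_cvg.

(** * Regularity of the weight *)

Section weight_regularity.
Context {R : realType}.
Variables (F : R -> R) (kmin x : R).
Hypothesis F_growth : growth_function F.
Hypothesis F0_ge0 : 0 <= F 0.
Hypothesis kmin_gt0 : 0 < kmin.

Local Notation c := (expR 1 * kmin^-1 + 1).
Local Notation eta := (fun z => eta_of kmin F (x + z)).

Let F_homo : {homo F : a b / a < b}. Proof. by case: F_growth. Qed.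

Let F_le : {homo F : a b / a <= b}.
Proof. by move=> a b; rewrite le_eqVlt => /predU1P[->//|/F_homo/ltW]. Qed.

Let F_derivable z : derivable F z 1. Proof. by case: F_growth => _ []. Qed.

Let F_gt0 z : 0 < F (2 * z ^+ 2 + 1).
Proof.
apply: le_lt_trans F0_ge0 _; apply: F_homo.
by have := sqr_ge0 z; lra.
Qed.

Let c_gt0 : 0 < c.
Proof. by rewrite addr_gt0// mulr_gt0 ?expR_gt0// invr_gt0. Qed.

Lemma eta_of_gt0 z : 0 < eta_of kmin F z.
Proof. by rewrite invr_gt0 mulr_gt0// F_gt0. Qed.

Lemma eta_of_le z : eta_of kmin F z <= (c * F 1)^-1.
Proof.
have F1 : 0 < F 1 by apply: le_lt_trans F0_ge0 _; apply: F_homo.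
rewrite lef_pV2 ?posrE ?mulr_gt0// ler_pM2l//; apply: F_le.
by have := sqr_ge0 z; lra.
Qed.

Lemma measurable_eta_of : measurable_fun setT (eta_of kmin F).
Proof.
apply: measurable_fun_inv; apply: measurable_funM; first exact: measurable_cst.
apply: (measurableT_comp (f := F)); last by measurability.
apply: continuous_measurable_fun => z.
exact/differentiable_continuous/derivable1_diffP.
Qed.

Lemma eta_of_inv2 z : (eta_of kmin F z ^+ 2)^-1 = (c * F (2 * z ^+ 2 + 1)) ^+ 2.
Proof. by rewrite /eta_of exprVn invrK. Qed.

(** The exponential bounds hold for F and F' at the square of their variable, and the square root of
    2 (x + z)^2 + 1 grows at most linearly in |z|. The Lipschitz bound follows from the mean value
    theorem for [F] and the factorization of a difference of squares. *)
Lemma inv2_eta_of_regularity : exists K k, [/\ 0 <= K, 0 <= k,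
  forall y, ((eta y) ^+ 2)^-1 <= K * expR (k * `|y|) &
  forall y z, `|((eta y) ^+ 2)^-1 - ((eta z) ^+ 2)^-1| <=
    K * `|y - z| * expR (k * (`|z| + `|y - z|))].
Proof.
have [_ _ [k1 [k2 [k10 k20 Fk]]] _] := F_growth.
(* From sqrt(2 (|x| + M)^2 + 1) <= 2 (|x| + M) + 1; the part depending on M is left in e^(2 k2
   M). *)
pose A := k1 * expR (k2 * (2 * `|x| + 1)).
have A0 : 0 < A by rewrite mulr_gt0 ?expR_gt0.
have Fmax u : 0 <= u -> F u <= k1 * expR (k2 * Num.sqrt u) /\
    derive1 F u <= k1 * expR (k2 * Num.sqrt u).
  move=> u0; have := Fk (Num.sqrt u) (sqrtr_ge0 u); rewrite sqr_sqrtr//.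
  by rewrite !ge_max => /and3P[].
have su M u : 0 <= M -> 0 <= u -> u <= 2 * (`|x| + M) ^+ 2 + 1 ->
    k1 * expR (k2 * Num.sqrt u) <= A * expR (2 * k2 * M).
  move=> M0 u0 uM; rewrite /A -mulrA -expRD ler_pM2l// ler_expR.
  have x0 := normr_ge0 x.
  have : Num.sqrt u <= 2 * (`|x| + M) + 1.
    rewrite -[leRHS]ger0_norm; last by lra.
    rewrite -sqrtr_sqr ler_wsqrtr//; apply: le_trans uM _.
    have xM : 0 <= `|x| + M by lra.
    by have := sqr_ge0 (`|x| + M); rewrite sqrrD; nra.
  move=> /(ler_wpM2l (ltW k20)); lra.
have uM M z : `|z| <= M -> 2 * (x + z) ^+ 2 + 1 <= 2 * (`|x| + M) ^+ 2 + 1.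
  move=> zM; rewrite lerD2r ler_pM2l// -[leLHS]real_normK ?num_real//.
  rewrite ler_pXn2r ?nnegrE ?normr_ge0//; last first.
    by rewrite addr_ge0// (le_trans _ zM).
  by apply: le_trans (ler_normD _ _) _; rewrite lerD2l.
have u0 z : 0 <= 2 * (x + z) ^+ 2 + 1 by have := sqr_ge0 (x + z); lra.
have FM M z : `|z| <= M -> F (2 * (x + z) ^+ 2 + 1) <= A * expR (2 * k2 * M).
  move=> zM; apply: le_trans (proj1 (Fmax _ (u0 z))) _.
  by apply: su => //; [exact: le_trans zM|exact: uM].
(* As [F] increases, an upper bound on F' bounds the absolute increment. *)
have FD M a b : 0 <= M -> 0 <= a -> a <= b -> b <= 2 * (`|x| + M) ^+ 2 + 1 ->
    F b - F a <= A * expR (2 * k2 * M) * (b - a).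
  move=> M0 a0 ab bM.
  have [||t] := @MVT_segment R F (derive1 F) a b ab.
  - by move=> t _; rewrite derive1E; apply: derivableP.
  - apply: derivable_within_continuous => t _; exact: F_derivable.
  rewrite in_itv/= => /andP[ta tb] ->.
  have t0 : 0 <= t by lra.
  rewrite ler_wpM2r ?subr_ge0//; apply: le_trans (proj2 (Fmax _ t0)) _.
  by apply: su => //; lra.
(* In the Lipschitz estimate F u - F v and F u + F v each bring e^(2 k2 M), and 1 + M <= e^M
   accounts for the 1 in the exponent 4 k2 + 1; 8 is the product of the three factors 2. *)
pose K := c ^+ 2 * A ^+ 2 * (8 * (`|x| + 1)).
exists K, (4 * k2 + 1).
have x0 := normr_ge0 x.
have cA : 0 <= c ^+ 2 * A ^+ 2 by rewrite mulr_ge0 ?sqr_ge0.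
split => [||y|y z].
- by rewrite mulr_ge0//; lra.
- by lra.
- rewrite eta_of_inv2 exprMn.
  apply: (@le_trans _ _ (c ^+ 2 * (A * expR (2 * k2 * `|y|)) ^+ 2)).
    rewrite ler_wpM2l ?sqr_ge0// ler_pXn2r ?nnegrE; [exact: FM|by []|exact: ltW|].
    by apply: mulr_ge0; [exact: ltW|exact: expR_ge0].
  rewrite exprMn -expRM_natl (mulrA (c ^+ 2)).
  apply: ler_pM => //; rewrite ?expR_ge0//.
    by rewrite /K ler_peMr//; lra.
  by rewrite ler_expR; have := normr_ge0 y; lra.
- pose M := `|z| + `|y - z|.
  have M0 : 0 <= M by rewrite addr_ge0.
  have zM : `|z| <= M by rewrite lerDl.
  have yM : `|y| <= M by rewrite /M addrC -[X in `|X| <= _](subrK z) ler_normD.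
  rewrite !eta_of_inv2 -/M.
  set u := 2 * (x + y) ^+ 2 + 1; set v := 2 * (x + z) ^+ 2 + 1.
  have uE : `|u - v| <= 2 * `|y - z| * (2 * `|x| + 2 * M).
    have -> : u - v = 2 * (y - z) * (2 * x + (y + z)) by rewrite /u /v; ring.
    rewrite !normrM (ger0_norm (_ : 0 <= 2))// ler_wpM2l ?mulr_ge0//.
    apply: le_trans (ler_normD _ _) _; rewrite normrM (ger0_norm (_ : 0 <= 2))//.
    by rewrite lerD2l; apply: le_trans (ler_normD _ _) _; lra.
  have Fuv : `|F u - F v| <= A * expR (2 * k2 * M) * `|u - v|.
    have [uv|vu] := leP u v.
      rewrite distrC ger0_norm ?subr_ge0 ?F_le// [X in _ * X]distrC ger0_norm ?subr_ge0//.
      by apply: FD => //; [exact: u0|exact: uM].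
    have {}vu := ltW vu.
    rewrite ger0_norm ?subr_ge0 ?F_le// ger0_norm ?subr_ge0//.
    by apply: FD => //; [exact: u0|exact: uM].
  have Fuv2 : 0 <= F u + F v <= 2 * (A * expR (2 * k2 * M)).
    have := FM M y yM; have := FM M z zM; have := F_gt0 (x + y); have := F_gt0 (x + z).
    by rewrite -/u -/v => *; apply/andP; split; lra.
  have -> : (c * F u) ^+ 2 - (c * F v) ^+ 2 = c ^+ 2 * ((F u - F v) * (F u + F v)) by ring.
  rewrite normrM ger0_norm ?sqr_ge0// normrM [X in _ * (_ * X)]ger0_norm; last by case/andP: Fuv2.
  have e0 := expR_gt0 (2 * k2 * M).
  have Me : 2 * `|x| + 2 * M <= 2 * (`|x| + 1) * expR M.
    have h : 1 + M <= expR M by exact: expR_ge1Dx.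
    by apply: (@le_trans _ _ (2 * (`|x| + 1) * (1 + M))); [nra|rewrite ler_wpM2l//; lra].
  apply: (@le_trans _ _ (c ^+ 2 * ((A * expR (2 * k2 * M) * (2 * `|y - z| * (2 * (`|x| + 1) * expR M))) *
     (2 * (A * expR (2 * k2 * M)))))).
    rewrite ler_wpM2l ?sqr_ge0//; apply: ler_pM => //; first by case/andP: Fuv2.
      apply: le_trans Fuv _; rewrite ler_wpM2l//; first by rewrite mulr_ge0// ltW.
      by apply: le_trans uE _; rewrite ler_wpM2l// mulr_ge0.
    by case/andP: Fuv2.
  have -> : expR ((4 * k2 + 1) * M) = expR (2 * k2 * M) * expR (2 * k2 * M) * expR M.
    by rewrite -!expRD; congr expR; ring.
  by rewrite le_eqVlt; apply/orP; left; apply/eqP; rewrite /K; ring.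
Qed.

End weight_regularity.

(** * Brownian occupation integral *)

Section integral_density.
Context {d} {T : measurableType d} {R : realType}.
Variables (mu nu : {measure set T -> \bar R}) (h : T -> R).
Hypotheses (mh : measurable_fun setT h) (h0 : forall x, 0 <= h x).
Hypothesis nuE : forall E, measurable E -> nu E = (\int[mu]_(x in E) (h x)%:E)%E.
Import HBNNSimple.

(** By simple functions and monotone convergence. [nu] is specified by its values on sets because
    laws of random variables are given in that form. *)
Lemma ge0_integral_density (f : T -> \bar R) : measurable_fun setT f ->
  (forall x, 0 <= f x)%E -> (\int[nu]_x f x = \int[mu]_x (f x * (h x)%:E))%E.
Proof.
move=> mf f0.
pose s := nnsfun_approx measurableT mf.
have fE x : f x = lim ((EFin \o s n) x @[n --> \oo]).
  by apply/esym/cvg_lim => //; exact: cvg_nnsfun_approx.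
have sx x n : (0 <= (EFin \o s n) x)%E by rewrite lee_fin.
have nds x : {homo (fun n => (EFin \o s n) x) : a b / (a <= b)%N >-> (a <= b)%E}.
  by move=> a b ab; rewrite lee_fin; exact/lefP/nd_nnsfun_approx.
have ms n : measurable_fun setT (EFin \o s n).
  by apply/measurable_EFinP; exact/measurable_funP.
have mhE : measurable_fun setT (fun x => (h x)%:E) by exact/measurable_EFinP.
have -> : (\int[nu]_x f x = lim (\int[nu]_x (EFin \o s n) x @[n --> \oo]))%E.
  under eq_integral => x _ do rewrite fE.
  by apply: monotone_convergence => // x _; exact: nds.
have -> : (\int[mu]_x (f x * (h x)%:E) = lim (\int[mu]_x ((EFin \o s n) x * (h x)%:E) @[n --> \oo]))%E.
  have fh x : (f x * (h x)%:E = lim (((EFin \o s n) x * (h x)%:E) @[n --> \oo]))%E.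
    by apply/esym/cvg_lim => //; apply: cvgeZr => //; exact: cvg_nnsfun_approx.
  under eq_integral => x _ do rewrite fh.
  apply: monotone_convergence => //.
  - by move=> n; exact: emeasurable_funM.
  - by move=> n x _; apply: mule_ge0; rewrite ?lee_fin.
  - by move=> x _ a b ab; apply: lee_wpmul2r; [rewrite lee_fin|exact: nds].
congr (lim (_ @ \oo)); apply/funext => n.
rewrite /=; under eq_integral do rewrite fimfunE -fsumEFin//.
have mind r : measurable_fun setT (fun x => (r * \1_(s n @^-1` [set r]) x)%:E).
  by apply/measurable_EFinP; exact: measurable_funM.
rewrite ge0_integral_fsum//; last by move=> y x _; exact: nnfun_muleindic_ge0.
under [RHS]eq_integral => x _.
  rewrite fimfunE -fsumEFin// ge0_mule_fsuml; last by move=> y; exact: nnfun_muleindic_ge0.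
  over.
rewrite ge0_integral_fsum//; last 2 first.
- by move=> y; apply: emeasurable_funM.
- by move=> y x _; apply: mule_ge0; [exact: nnfun_muleindic_ge0|rewrite lee_fin].
apply: eq_fsbigr => r; rewrite inE => -[t _ <-].
under eq_integral do rewrite EFinM.
rewrite integralZl_indic_nnsfun//.
under [RHS]eq_integral do rewrite EFinM -muleA.
rewrite ge0_integralZl//; last 3 first.
- by apply: emeasurable_funM => //; exact/measurable_EFinP.
- by move=> x _; apply: mule_ge0; rewrite lee_fin.
- by rewrite lee_fin.
congr (_ * _)%E.
rewrite integral_indic// setIT nuE// integral_mkcond; apply: eq_integral => x _.
by rewrite patchE indicE; case: ifPn => _; rewrite ?mul1e ?mul0e.
Qed.

End integral_density.

Lemma ge0_integral_law {R : realType} d (Omega : measurableType d) d' (T : measurableType d')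
    (P : {measure set Omega -> \bar R}) (mu : {measure set T -> \bar R})
    (X : Omega -> T) (h : T -> R) :
  measurable_fun setT X -> measurable_fun setT h -> (forall y, 0 <= h y) ->
  (forall E, measurable E -> P (X @^-1` E) = \int[mu]_(y in E) (h y)%:E)%E ->
  forall f : T -> \bar R, measurable_fun setT f -> (forall y, 0 <= f y)%E ->
  (\int[P]_w f (X w) = \int[mu]_y (f y * (h y)%:E))%E.
Proof.
move=> mX mh h0 PX f mf f0.
pose Xm : {mfun Omega >-> T} := HB.pack X (isMeasurableFun.Build _ _ _ _ X mX).
rewrite -(ge0_integral_density (nu := pushforward P Xm) mh h0)//.
by rewrite [RHS]ge0_integral_pushforward// => y _; exact: f0.
Qed.

Section brownian_occupation.
Context {R : realType} {d : measure_display} {Omega : measurableType d}.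
Variable P : probability Omega R.
Variable B : R -> {RV P >-> R}.
Hypothesis brownianB : brownian_motion B.
Local Notation mu := (@lebesgue_measure R).

(* Joint measurability in time and chance comes from discretising time and
   from the continuity of the paths. *)
Let grid (n : nat) (s : R) : R := (Num.truncn (s * n.+1%:R))%:R / n.+1%:R.

Let grid_ge0 n s : 0 <= grid n s.
Proof. by rewrite divr_ge0. Qed.

Let grid_cvg s : 0 <= s -> grid n s @[n --> \oo] --> s.
Proof.
move=> s0; apply: (@squeeze_cvgr _ _ _ _ (fun n => s - n.+1%:R^-1) (fun=> s)).
- apply: nearW => n; have n0 : 0 < n.+1%:R :> R by [].
  have := truncn_itv (mulr_ge0 s0 (ltW n0)); rewrite -[(Num.truncn _).+1%:R]natr1 => /andP[h1 h2].
  rewrite /grid; apply/andP; split.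
    rewrite lerBlDr -[X in _ <= _ + X]mul1r -mulrDl ler_pdivlMr//; exact: ltW.
  by rewrite ler_pdivrMr.
- rewrite -[X in _ --> X]subr0; apply: cvgB; first exact: cvg_cst.
  exact: cvg_harmonic.
- exact: cvg_cst.
Qed.

Let measurable_grid_path n :
  measurable_fun setT (fun p : R * Omega => B (grid n (Num.max p.1 0)) p.2).
Proof.
move=> _ E mE; rewrite setTI.
pose h (s : R) : R := Num.max s 0 * n.+1%:R.
have h0 s : 0 <= h s by rewrite mulr_ge0// le_max lexx orbT.
have mh : measurable_fun setT h.
  apply: measurable_funM; last exact: measurable_cst.
  by apply: (measurable_maxr (f := id) (g := cst 0)).
have -> : (fun p : R * Omega => B (grid n (Num.max p.1 0)) p.2) @^-1` E =
  \bigcup_k ((h @^-1` `[k%:R, k.+1%:R[) `*` (B (k%:R / n.+1%:R) @^-1` E)).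
  apply/seteqP; split => [[s w] /= hE|[s w] [k _ [/= hk]]].
    exists (Num.truncn (h s)) => //; split => //=.
    by rewrite in_itv/= truncn_itv.
  by rewrite in_itv/= in hk; rewrite /grid -/(h s) (truncn_def hk).
apply: bigcup_measurable => k _; apply: measurableX.
  by rewrite -[X in measurable X]setTI; exact: mh.
by rewrite -[X in measurable X]setTI; exact: measurable_funP.
Qed.

(** Negative times are sent to 0, since paths are known to be continuous only on [Rplus], while
    Tonelli's theorem is applied over the whole line. *)
Lemma measurable_brownian_path :
  measurable_fun setT (fun p : R * Omega => B (Num.max p.1 0) p.2).
Proof.
have [_ _ _ Bc] := brownianB.
have key (p : R * Omega) : [set: R * Omega] p ->
    B (grid n (Num.max p.1 0)) p.2 @[n --> \oo] --> B (Num.max p.1 0) p.2.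
  case: p => s w _ /=.
  have m0 : Rplus (Num.max s 0) by rewrite /Rplus/= in_itv/= andbT le_max lexx orbT.
  have /subspace_continuousP/(_ _ m0) := Bc w; apply: cvg_comp.
  move=> U /=; rewrite /within/= => hU.
  have m0' : 0 <= Num.max s 0 by rewrite le_max lexx orbT.
  have := grid_cvg m0' hU; rewrite /nbhs/=.
  apply: (@filterS _ \oo _ [set n | Rplus (grid n (Num.max s 0)) -> U (grid n (Num.max s 0))]) => n /=.
  by apply; rewrite /Rplus/= in_itv/= andbT.
exact: (measurable_fun_cvg measurable_grid_path key).
Qed.

Lemma integral_brownian (g : R -> R) t : measurable_fun setT g -> (forall y, 0 <= g y) ->
  0 < t -> (\int[P]_w (g (B t w))%:E = smooth g t 0)%E.
Proof.
move=> mg g0 t0; have [B0 _ Bl _] := brownianB.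
have mB : measurable_fun setT (B t) by exact: measurable_funP.
have mheat : measurable_fun setT (fun y : R => heat t (y - 0)).
  by apply: measurable_heat; measurability.
have h0 (y : R) : 0 <= heat t (y - 0) by exact: heat_ge0.
have lawE (E : set R) : measurable E ->
    (P (B t @^-1` E) = \int[mu]_(y in E) (heat t (y - 0))%:E)%E.
  move=> mE; have t0' : (0 : R) <= 0 < t by rewrite lexx.
  transitivity (P [set w | E (B t w - B 0 w)]).
    by congr (P _); apply/seteqP; split => w /=; rewrite B0 subr0.
  by rewrite (Bl _ _ t0' E mE) subr0 /normal_prob; apply: eq_integral => y _; rewrite heatE.
rewrite (@ge0_integral_law _ _ _ _ _ P mu (B t) _ _ mheat h0 lawE (fun y => (g y)%:E)).
- by apply: eq_integral => y _; rewrite -EFinM.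
- exact: mB.
- exact/measurable_EFinP.
- by move=> y; rewrite lee_fin.
Qed.

Lemma brownian_occupation (g : R -> R) L : measurable_fun setT g -> (forall y, 0 <= g y) ->
  (\int[P]_w \int[mu]_(s in `[0%R, L]) (g (B s w))%:E = potential g 0 L 0)%E.
Proof.
move=> mg g0.
pose F (p : R * Omega) : \bar R :=
  if (0 <= p.1) && (p.1 <= L) then (g (B (Num.max p.1 0) p.2))%:E else 0%E.
have mF : measurable_fun setT F.
  apply: measurable_fun_ifT; last exact: measurable_cst.
    by apply: measurable_and; apply: measurable_fun_ler; measurability.
  apply/measurable_EFinP; exact: (measurableT_comp mg measurable_brownian_path).
have F0 p : (0 <= F p)%E by rewrite /F; case: ifP => // _; rewrite lee_fin.
transitivity (\int[P]_w \int[mu]_s F (s, w))%E.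
  apply: eq_integral => w _; rewrite [LHS]integral_mkcond; apply: eq_integral => s _.
  rewrite patchE /F mem_setE in_itv/=; case: ifP => // /andP[s0 _].
  by rewrite max_l.
transitivity (\int[mu]_s \int[P]_w F (s, w))%E.
  by rewrite (@fubini_tonelli _ _ _ _ _ mu P F mF F0).
pose G s := (\int[P]_w F (s, w))%E.
have mG : measurable_fun setT G by exact: (@measurable_fun_fubini_tonelli_F _ _ _ _ _ P F mF F0).
transitivity (\int[mu]_(s in `[0%R, L]) G s)%E.
  rewrite [RHS]integral_mkcond; apply: eq_integral => s _.
  rewrite patchE mem_setE in_itv/= -/(G s); case: ifPn => // s0L.
  by apply: integral0_eq => w _; rewrite /F/= (negbTE s0L).
(* At time 0 the law is a Dirac mass, which is not given by [heat]; that single time is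
   negligible. *)
rewrite -integral_itv_obnd_cbnd; last exact: measurable_funTS.
apply: eq_integral => s; rewrite inE/= in_itv/= => /andP[s0 sL].
rewrite -integral_brownian//; apply: eq_integral => w _.
by rewrite /F/= sL (ltW s0)/= max_l// ltW.
Qed.

End brownian_occupation.

(** * Gamma moments *)

Section gamma_integral.
Context {R : realType}.
Local Notation mu := (@lebesgue_measure R).

(** Up to a constant, e^(1 - y) times the density of the gamma law of shape 3/2 and scale 2; [G] is
    then a primitive of (1 - y) * w y on the positive half-line. *)
Let w (y : R) : R := Num.sqrt y * expR (- (3 / 2) * y).
Let G (y : R) : R := 2 / 3 * (y * w y).

Let w_ge0 y : 0 <= w y.
Proof. by rewrite /w mulr_ge0 ?sqrtr_ge0 ?expR_ge0. Qed.

Let continuous_w : continuous w.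
Proof.
move=> y; apply: continuousM; first exact: sqrt_continuous.
apply: (@continuous_comp _ _ _ (fun y : R => - (3 / 2) * y) expR); last exact: continuous_expR.
by apply: continuousM; [exact: cvg_cst|exact: cvg_id].
Qed.

Let continuous_G : continuous G.
Proof.
move=> y; rewrite /G; apply: cvgM; first exact: cvg_cst.
by apply: cvgM; [exact: cvg_id|exact: continuous_w].
Qed.

Let continuous_lo : continuous (fun y : R => (1 - y) * w y).
Proof.
move=> y; apply: cvgM; last exact: continuous_w.
by apply: cvgB; [exact: cvg_cst|exact: cvg_id].
Qed.

Let continuous_hi : continuous (fun y : R => (y - 1) * w y).
Proof.
move=> y; apply: cvgM; last exact: continuous_w.
by apply: cvgB; [exact: cvg_id|exact: cvg_cst].
Qed.

Let is_derive_G (y : R) : 0 < y -> is_derive y 1 G ((1 - y) * w y).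
Proof.
move=> y0; have Ds := is_derive1_sqrt y0.
have De : is_derive y 1 (fun y : R => expR (- (3 / 2) * y)) (- (3 / 2) * expR (- (3 / 2) * y)).
  by apply: is_derive_eq; rewrite /GRing.scale/=; ring.
have q0 : 0 < Num.sqrt y by rewrite sqrtr_gt0.
have qq : y = Num.sqrt y * Num.sqrt y by rewrite -expr2 sqr_sqrtr// ltW.
rewrite /G /w; apply: is_derive_eq; rewrite /GRing.scale/=.
move: (expR _) => e; move: q0 qq; move: (Num.sqrt y) => q q0 ->.
by field; rewrite gt_eqF.
Qed.

Let derivable_G (y : R) : 0 < y -> derivable G y 1.
Proof. by move=> /is_derive_G []. Qed.

Let derive_G (y : R) : 0 < y -> derive1 G y = (1 - y) * w y.
Proof. by move=> y0; rewrite derive1E; have /@derive_val := is_derive_G y0. Qed.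

Let G_cvg : G y @[y --> +oo] --> 0.
Proof.
(* For y >= 1, y sqrt(y) <= y^2 <= 16 e^(y/2), and 2/3 of 16 is below 11. *)
apply: (@squeeze_cvgr _ _ _ _ (cst 0) (fun y => 11 * expR (- y))).
- near=> y; have y1 : 1 <= y by near: y; exact: nbhs_pinfty_ge.
  have y0 : 0 <= y by exact: le_trans ler01 y1.
  have w0 := w_ge0 y; apply/andP; split; first by rewrite /G !mulr_ge0.
  have q1 : Num.sqrt y <= y.
    rewrite -[leRHS]ger0_norm// -sqrtr_sqr ler_wsqrtr// expr2 ler_peMr//.
  have e1 : y / 4 <= expR (y / 4) by have := expR_ge1Dx (y / 4); lra.
  have e2 : y ^+ 2 <= 16 * expR (y / 2).
    have -> : expR (y / 2) = expR (y / 4) ^+ 2 by rewrite -expRM_natl; congr expR; lra.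
    have y4 : 0 <= y / 4 by lra.
    by have := ler_pM y4 y4 e1 e1; rewrite -!expr2; lra.
  have -> : expR (- y) = expR (y / 2) * expR (- (3 / 2) * y) by rewrite -expRD; congr expR; lra.
  rewrite /G /w !mulrA ler_wpM2r ?expR_ge0//.
  by have := ler_wpM2l y0 q1; have := expR_ge0 (y / 2); rewrite -expr2; lra.
- exact: cvg_cst.
- by rewrite -[X in _ --> X](mulr0 11); apply: cvgMr; exact: cvgr_expR.
Unshelve. all: by end_near. Qed.

(* The difference of the integrands is the derivative of [G], which vanishes at
   both ends; splitting at [1] keeps every integrand nonnegative. *)
Lemma integral_sqrt_expR_moment :
  (\int[mu]_(y in `]0%R, +oo[) (Num.sqrt y * expR (- (3 / 2) * y))%:E =
   \int[mu]_(y in `]0%R, +oo[) (y * (Num.sqrt y * expR (- (3 / 2) * y)))%:E)%E.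
Proof.
have G0 : G 0 = 0 by rewrite /G mul0r mulr0.
change (\int[mu]_(y in `]0%R, +oo[) (w y)%:E = \int[mu]_(y in `]0%R, +oo[) (y * w y)%:E)%E.
clearbody G; clearbody w.
have mw : measurable_fun setT w by apply: continuous_measurable_fun; exact: continuous_w.
have myw : measurable_fun setT (fun y : R => y * w y) by measurability.
have lo : (\int[mu]_(y in `[0%R, 1%R]) ((1 - y) * w y)%:E = (G 1)%:E)%E.
  rewrite (@continuous_FTC2 _ _ G)//.
  - by rewrite G0 sube0.
  - exact: continuous_subspaceT.
  - split=> [y||].
    + by rewrite in_itv/= => /andP[y0 _]; exact: derivable_G.
    + exact/cvg_at_right_filter/continuous_G.
    + exact/cvg_at_left_filter/continuous_G.
  - by move=> y; rewrite in_itv/= => /andP[y0 _]; exact: derive_G.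
have hi : (\int[mu]_(y in `[1%R, +oo[) ((y - 1) * w y)%:E = (G 1)%:E)%E.
  have cNG : continuous (\- G) by move=> y; apply: continuousN; exact: continuous_G.
  rewrite (@ge0_continuous_FTC2y _ _ (\- G) 1 (- 0))//.
  - by rewrite oppr0 sub0e -EFinN/= opprK.
  - by move=> y y1; rewrite mulr_ge0 ?subr_ge0.
  - exact: continuous_subspaceT.
  - by apply: cvgN; exact: G_cvg.
  - by move=> y y1; apply: derivableN; apply: derivable_G; lra.
  - exact/cvg_at_right_filter/cNG.
  - move=> y; rewrite in_itv/= andbT => y1.
    have y0 : 0 < y by lra.
    rewrite derive1E; have /@derive_val -> := is_deriveN (is_derive_G y0); lra.
have split01 (f : R -> R) : (forall y, 0 <= y -> 0 <= f y) -> measurable_fun setT f ->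
    (\int[mu]_(y in `]0%R, +oo[) (f y)%:E =
     \int[mu]_(y in `[0%R, 1%R]) (f y)%:E + \int[mu]_(y in `[1%R, +oo[) (f y)%:E)%E.
  move=> f0 mf; have mfE : measurable_fun setT (EFin \o f) by exact/measurable_EFinP.
  rewrite integral_itv_obnd_cbnd; last exact: measurable_funTS.
  rewrite -[in X in (_ + X)%E]integral_itv_obnd_cbnd; last exact: measurable_funTS.
  have -> : `[0%R, +oo[%classic = `[0%R, 1%R] `|` `]1%R, +oo[ :> set R.
    by rewrite -itv_bndbnd_setU// bnd_simp.
  rewrite ge0_integral_setU//.
  - exact: measurable_funTS.
  - by move=> y; rewrite /= !in_itv/= lee_fin => -[/andP[y0 _]|/andP[y1 _]]; apply: f0; lra.
  - by rewrite disj_set2E; apply/eqP/seteqP; split => y //=; rewrite !in_itv/= => -[/andP[_ h] /andP[h' _]]; lra.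
rewrite (split01 w)// (split01 (fun y : R => y * w y))//; last by move=> y y0; exact: mulr_ge0.
have mD (D : set R) (f : R -> R) : measurable_fun setT f -> measurable_fun D (EFin \o f).
  by move=> mf; apply: measurable_funTS; exact/measurable_EFinP.
have -> : (\int[mu]_(y in `[0%R, 1%R]) (w y)%:E =
    \int[mu]_(y in `[0%R, 1%R]) (y * w y)%:E + (G 1)%:E)%E.
  rewrite -lo -ge0_integralD//; last 4 first.
  - by move=> y /=; rewrite in_itv/= => /andP[y0 _]; rewrite lee_fin mulr_ge0.
  - exact: mD.
  - by move=> y /=; rewrite in_itv/= => /andP[_ y1]; rewrite lee_fin mulr_ge0// subr_ge0.
  - by apply: mD; measurability.
  by apply: eq_integral => y _; rewrite -EFinD; congr EFin; lra.
rewrite -addeA; congr (_ + _)%E.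
rewrite -hi -ge0_integralD//; last 4 first.
- by move=> y /=; rewrite in_itv/= => /andP[y1 _]; rewrite lee_fin mulr_ge0// subr_ge0.
- by apply: mD; measurability.
- by move=> y _; rewrite lee_fin.
- exact: mD.
by apply: eq_integral => y _; rewrite -EFinD; congr EFin; lra.
Qed.

End gamma_integral.

Lemma gamma_density_ge0 {R : realType} (k theta y : R) : 0 <= gamma_density k theta y.
Proof.
rewrite /gamma_density; apply: divr_ge0; first by rewrite mulr_ge0 ?powR_ge0 ?expR_ge0.
apply: mulr_ge0; last exact: powR_ge0.
by apply: Rintegral_ge0 => t _; rewrite mulr_ge0 ?powR_ge0 ?expR_ge0.
Qed.

Lemma measurable_gamma_density {R : realType} (k theta : R) :
  measurable_fun setT (gamma_density k theta).
Proof.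
have mp : measurable_fun setT (fun y : R => y `^ (k - 1)) by exact: measurable_powR.
rewrite /gamma_density; apply: measurable_funM; last exact: measurable_cst.
apply: measurable_funM; first exact: mp.
by apply: measurable_fun_expR; measurability.
Qed.

Section gamma_law_theory.
Context {R : realType} {d} {Omega : measurableType d} (P : probability Omega R).
Variable A : {RV P >-> R}.
Local Notation mu := (@lebesgue_measure R).

Lemma gamma_law_integral k theta (f : R -> \bar R) : gamma_law P k theta A ->
  measurable_fun setT f -> (forall y, 0 <= f y)%E ->
  (\int[P]_w f (A w) = \int[mu]_(y in `]0%R, +oo[) (f y * (gamma_density k theta y)%:E))%E.
Proof.
move=> lawA mf f0.
pose h (y : R) := if 0 < y then gamma_density k theta y else 0.
have h0 y : 0 <= h y by rewrite /h; case: ifP => // _; exact: gamma_density_ge0.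
have mh : measurable_fun setT h.
  apply: measurable_fun_ifT; [|exact: measurable_gamma_density|exact: measurable_cst].
  by apply: measurable_fun_ltr; [exact: measurable_cst|exact: measurable_id].
have mA : measurable_fun setT A by exact: measurable_funP.
have lawE (E : set R) : measurable E -> (P (A @^-1` E) = \int[mu]_(y in E) (h y)%:E)%E.
  move=> mE; rewrite lawA// setIC integral_mkcondl.
  apply: eq_integral => y _; rewrite patchE mem_setE in_itv/= andbT /h.
  by case: ifP.
rewrite (@ge0_integral_law _ _ _ _ _ P mu A _ mA mh h0 lawE f mf f0).
rewrite [RHS]integral_mkcond; apply: eq_integral => y _.
by rewrite patchE mem_setE in_itv/= andbT /h; case: ifP => // _; rewrite mule0.
Qed.

Lemma gamma_law_gt0 k theta : gamma_law P k theta A -> {ae P, forall w, 0 < A w}.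
Proof.
move=> lawA; exists (A @^-1` `]-oo, 0]); split.
- by rewrite -[X in measurable X]setTI; exact: measurable_funP.
- rewrite lawA; last exact: measurable_itv.
  rewrite (_ : _ `&` _ = set0) ?integral_set0//.
  apply/seteqP; split => y //=; rewrite !in_itv/= andbT => -[h1 h2].
  by move: h1; rewrite leNgt h2.
- by move=> w /= /negP; rewrite -leNgt in_itv.
Qed.

Hypothesis gammaA : gamma_law P (3 / 2) 2 A.

Let c : R := (Gamma_fun (3 / 2) * 2 `^ (3 / 2))^-1 * expR 1.

Let c_ge0 : 0 <= c.
Proof.
rewrite mulr_ge0 ?expR_ge0// invr_ge0 mulr_ge0 ?powR_ge0//.
by apply: Rintegral_ge0 => t _; rewrite mulr_ge0 ?powR_ge0 ?expR_ge0.
Qed.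

Let densityE y : 0 < y ->
  expR (1 - y) * gamma_density (3 / 2) 2 y = c * (Num.sqrt y * expR (- (3 / 2) * y)).
Proof.
move=> y0; rewrite /gamma_density.
have -> : 3 / 2 - 1 = 2^-1 :> R by lra.
rewrite powR12_sqrt ?ltW// /c.
have -> : expR (- (3 / 2) * y) = expR (- y / 2) * expR (- y).
  by rewrite -expRD; congr expR; lra.
by rewrite expRD; ring.
Qed.

(** An integral over the line rather than an expectation, so that mu can be given before any
    probability space. *)
Definition gamma_exp_moment : R :=
  fine (\int[mu]_(y in `]0%R, +oo[) (expR (1 - y) * gamma_density (3 / 2) 2 y)%:E)%E.

(** On the positive half-line the integrand is at most e times the density, so the moment is finite
    and [fine] loses nothing. *)
Lemma gamma_exp_momentE : (\int[P]_w (expR (1 - A w))%:E = gamma_exp_moment%:E)%E.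
Proof.
have mexp : measurable_fun setT (fun y : R => (expR (1 - y))%:E).
  by apply/measurable_EFinP; apply: measurable_fun_expR; measurability.
have exp0 y : (0 <= (expR (1 - y))%:E :> \bar R)%E by rewrite lee_fin expR_ge0.
rewrite (gamma_law_integral gammaA mexp exp0).
under eq_integral do rewrite -EFinM.
rewrite /gamma_exp_moment fineK// ge0_fin_numE; last first.
  by apply: integral_ge0 => y _; rewrite lee_fin mulr_ge0 ?expR_ge0 ?gamma_density_ge0.
apply: (@le_lt_trans _ _ (\int[P]_w (expR 1)%:E)%E); last first.
  by rewrite integral_cst// [X in (_ * X)%E]probability_setT mule1 ltry.
rewrite (gamma_law_integral (f := fun=> (expR 1)%:E) gammaA)//.
apply: ge0_le_integral => //.
- by move=> y _; rewrite lee_fin mulr_ge0 ?expR_ge0 ?gamma_density_ge0.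
- apply: measurable_funTS; apply/measurable_EFinP; apply: measurable_funM.
    by apply: measurable_fun_expR; measurability.
  exact: measurable_gamma_density.
- apply: measurable_funTS; apply: emeasurable_funM; first exact: measurable_cst.
  by apply/measurable_EFinP; exact: measurable_gamma_density.
- move=> y /=; rewrite in_itv/= andbT => y0.
  rewrite -EFinM lee_fin ler_wpM2r ?gamma_density_ge0// ler_expR; lra.
Qed.

Lemma gamma_exp_moment_gt0 : 0 < gamma_exp_moment.
Proof.
have mexp : measurable_fun setT (fun w => (expR (1 - A w))%:E).
  apply/measurable_EFinP; apply: measurable_fun_expR.
  by apply: measurable_funB; [exact: measurable_cst|exact: measurable_funP].
rewrite lt_neqAle -lee_fin -gamma_exp_momentE; apply/andP; split; last first.
  by apply: integral_ge0 => w _; rewrite lee_fin expR_ge0.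
rewrite eq_sym; apply/eqP => m0.
have : (\int[P]_w `|(expR (1 - A w))%:E| = 0)%E.
  rewrite (eq_integral (fun w => (expR (1 - A w))%:E)) ?gamma_exp_momentE ?m0// => w _.
  by rewrite /= ger0_norm ?expR_ge0.
move=> /(ae_eq_integral_abs _ measurableT mexp) [E [mE PE0 sE]].
(* The exponential never vanishes, so a null set containing the points where it is nonzero is the
   whole space. *)
have ET : E = setT.
  apply/seteqP; split => w // _; apply: sE => /= /(_ I) /eqP.
  by rewrite eqe gt_eqF// expR_gt0.
by move: PE0; rewrite ET [LHS]probability_setT => /eqP; rewrite onee_eq0.
Qed.

Lemma gamma_mul_exp_moment :
  (\int[P]_w (Num.max (A w * expR (1 - A w)) 0)%:E = gamma_exp_moment%:E)%E.
Proof.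
rewrite -gamma_exp_momentE.
have mexp : measurable_fun setT (fun y : R => (expR (1 - y))%:E).
  by apply/measurable_EFinP; apply: measurable_fun_expR; measurability.
have exp0 y : (0 <= (expR (1 - y))%:E :> \bar R)%E by rewrite lee_fin expR_ge0.
rewrite (gamma_law_integral gammaA mexp exp0).
pose f (y : R) : \bar R := (Num.max (y * expR (1 - y)) 0)%:E.
have mf : measurable_fun setT f.
  apply/measurable_EFinP; apply: (measurable_maxr (g := cst 0)) => //.
  apply: measurable_funM => //; apply: measurable_fun_expR; by measurability.
have f0 y : (0 <= f y)%E by rewrite lee_fin le_max lexx orbT.
rewrite (gamma_law_integral gammaA mf f0).
have mw : measurable_fun setT (fun y : R => Num.sqrt y * expR (- (3 / 2) * y)).
  by apply: measurable_funM; [exact: measurable_fun_sqrt|apply: measurable_fun_expR; measurability].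
transitivity (\int[mu]_(y in `]0%R, +oo[) (c%:E * (y * (Num.sqrt y * expR (- (3 / 2) * y)))%:E))%E.
  apply: eq_integral => y; rewrite inE/= in_itv/= andbT => y0.
  rewrite /f max_l; last by rewrite mulr_ge0 ?expR_ge0// ltW.
  by rewrite -!EFinM -mulrA densityE//; congr EFin; ring.
transitivity (\int[mu]_(y in `]0%R, +oo[) (c%:E * (Num.sqrt y * expR (- (3 / 2) * y))%:E))%E; last first.
  by apply: eq_integral => y; rewrite inE/= in_itv/= andbT => y0; rewrite -!EFinM densityE.
rewrite !ge0_integralZl_EFin//.
- by rewrite integral_sqrt_expR_moment.
- by apply: measurable_funTS; exact/measurable_EFinP.
- by move=> y /=; rewrite in_itv/= andbT => y0; rewrite lee_fin !mulr_ge0 ?sqrtr_ge0 ?expR_ge0// ltW.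
- by apply: measurable_funTS; apply/measurable_EFinP; apply: measurable_funM.
Qed.

End gamma_law_theory.

(** * Markov property of the skeleton *)

Section independent_integral.
Context {R : realType} {d} {Omega : measurableType d} (P : probability Omega R).
Context {d1 d2} {T1 : measurableType d1} {T2 : measurableType d2}.
Variables (X : Omega -> T1) (Y : Omega -> T2) (C : set Omega).
Hypotheses (mX : measurable_fun setT X) (mY : measurable_fun setT Y) (mC : measurable C).
Hypothesis XYC : forall D E, measurable D -> measurable E ->
  (P (X @^-1` D `&` Y @^-1` E `&` C) = P C * (P (X @^-1` D) * P (Y @^-1` E)))%E.

(** Given [C], the pair has the product of the unconditional laws: [XYC] says so on rectangles,
    which determine the product measure. Normalization by P C forces the null case apart. *)
Lemma integral_independent_pair (F : T1 * T2 -> \bar R) :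
  measurable_fun setT F -> (forall q, 0 <= F q)%E ->
  (\int[P]_w (F (X w, Y w) * (\1_C w)%:E) =
   P C * \int[P]_w \int[P]_w' F (X w, Y w'))%E.
Proof.
move=> mF F0.
pose Xm : {mfun Omega >-> T1} := HB.pack X (isMeasurableFun.Build _ _ _ _ X mX).
pose Ym : {mfun Omega >-> T2} := HB.pack Y (isMeasurableFun.Build _ _ _ _ Y mY).
have mXY : measurable_fun setT (fun w => (X w, Y w)) by apply/measurable_fun_pairP.
pose XYm : {mfun Omega >-> (T1 * T2)%type} :=
  HB.pack (fun w => (X w, Y w)) (isMeasurableFun.Build _ _ _ _ _ mXY).
pose nu : {measure set Omega -> \bar R} := mrestr P mC.
have m1C : measurable_fun setT (\1_C : Omega -> R) by exact: measurable_indic.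
have nuE E : measurable E -> nu E = (\int[P]_(w in E) (\1_C w)%:E)%E.
  by move=> mE; rewrite integral_indic// setIC.
have mFXY : measurable_fun setT (fun w => F (X w, Y w)) by exact: (measurableT_comp mF mXY).
have -> : (\int[P]_w (F (X w, Y w) * (\1_C w)%:E) = \int[nu]_w F (X w, Y w))%E.
  by rewrite -(ge0_integral_density (nu := nu) m1C _ nuE).
have [PC0|PC0] := eqVneq (P C) 0%E.
  rewrite PC0 mul0e (ge0_integral_density (nu := nu) (mu := P) m1C)//.
  apply: (@eq_trans _ _ (\int[P]_w (cst 0%E w))%E); last by rewrite integral0.
  apply: ae_eq_integral => //.
    by apply: emeasurable_funM => //; exact/measurable_EFinP.
  exists C; split => // w /= wC; apply: contrapT => nC; apply: wC => _.
  by rewrite indicE memNset// mule0.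
have PCfin : P C \is a fin_num by exact: fin_num_measure.
have p0 : 0 < fine (P C) by rewrite fine_gt0// lt0e PC0 measure_ge0 ltey_eq PCfin.
have k0 : 0 <= (fine (P C))^-1 by rewrite invr_ge0 ltW.
pose k : {nonneg R} := NngNum k0.
pose m'0 : {measure set (T1 * T2) -> \bar R} := mscale k (pushforward nu XYm).
pose m' := m'0 mXY.
have rect D E : measurable D -> measurable E ->
    m' (D `*` E) = (distribution P Xm D * distribution P Ym E)%E.
  move=> mD mE.
  have -> : m' (D `*` E) = ((fine (P C))^-1%:E * P (X @^-1` D `&` Y @^-1` E `&` C))%E by [].
  by rewrite XYC// muleA -[in X in (_ * X * _)%E](fineK PCfin) -EFinM mulVf ?gt_eqF// mul1e.
have -> : (\int[nu]_w F (X w, Y w) = P C * \int[m']_q F q)%E.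
  rewrite ge0_integral_mscale// muleA -[in X in (X * _)%E](fineK PCfin) -EFinM.
  by rewrite mulfV ?gt_eqF// mul1e ge0_integral_pushforward.
congr (_ * _)%E.
rewrite (@eq_measure_integral _ _ _ _ (distribution P Xm \x distribution P Ym)%E m'); last first.
  by move=> B mB _; apply/esym/product_measure_unique.
rewrite fubini_tonelli1// /fubini_F.
have mG : measurable_fun setT (fun x => \int[distribution P Ym]_y F (x, y))%E.
  exact: measurable_fun_fubini_tonelli_F.
have G0 x : (0 <= \int[distribution P Ym]_y F (x, y))%E by exact: integral_ge0.
rewrite ge0_integral_pushforward//.
apply: eq_integral => w _ /=; rewrite ge0_integral_pushforward//.
by apply: measurableT_comp mF _; exact: measurable_pair1.
Qed.

End independent_integral.

Section skeleton_markov.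
Context {R : realType} {d} {Omega : measurableType d} (P : probability Omega R).
Variables (A Z : nat -> {RV P >-> R}).
Hypothesis noise : skeleton_noise A Z.
Variables (eta : R -> R) (eps : R).
Hypotheses (meta : measurable_fun setT eta) (eta_gt0 : forall z, 0 < eta z) (eps_gt0 : 0 < eps).

Let S n w := skeleton_s eta eps 0 (A ^~ w) (Z ^~ w) n.
Let X n w := skeleton_x eta eps 0 (A ^~ w) (Z ^~ w) n.
Let V n w : R * R := (S n w, X n w).

Definition skeleton_next (v : R * R) (al c : R) : R * R :=
  (v.1 + eps ^+ 2 * eta v.2 ^+ 2 * expR (1 - al),
   v.2 + c * eta v.2 * (eps * Num.sqrt (al * expR (1 - al)))).

(* [phi] is applied at a multiple of [expR (1 - al)], where its logarithm is [al]. *)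
Lemma phi_skeleton_step y al :
  phi eps (skeleton_step eta eps y al / eta y ^+ 2) = eps * Num.sqrt (al * expR (1 - al)).
Proof.
have e0 : eps != 0 by rewrite gt_eqF.
have h0 : eta y != 0 by rewrite gt_eqF.
have x0 : expR (1 - al) != 0 by rewrite gt_eqF// expR_gt0.
have -> : skeleton_step eta eps y al / eta y ^+ 2 = eps ^+ 2 * expR (1 - al).
  by rewrite /skeleton_step; field.
rewrite /phi.
have -> : eps ^+ 2 * expR 1 / (eps ^+ 2 * expR (1 - al)) = expR al.
  rewrite invfM mulrACA mulfV ?expf_neq0// mul1r -expRN -expRD; congr expR; lra.
by rewrite expRK -mulrA sqrtrM ?sqr_ge0// sqrtr_sqr gtr0_norm// [al * _]mulrC.
Qed.

Let V_S n w : V n.+1 w = skeleton_next (V n w) (A n w) (Z n w).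
Proof.
rewrite /V /S /X /skeleton_next/= phi_skeleton_step /skeleton_s big_ord_recr/=.
by [].
Qed.

Let measurable_next d' (T : measurableType d') (f : T -> R * R) (g h : T -> R) :
  measurable_fun setT f -> measurable_fun setT g -> measurable_fun setT h ->
  measurable_fun setT (fun x => skeleton_next (f x) (g x) (h x)).
Proof.
move=> mf mg mh.
have mf1 : measurable_fun setT (fun x => (f x).1) by exact: measurableT_comp.
have mf2 : measurable_fun setT (fun x => (f x).2) by exact: measurableT_comp.
have me : measurable_fun setT (fun x => eta (f x).2) by exact: measurableT_comp.
have mx : measurable_fun setT (fun x => expR (1 - g x)).
  by apply: measurable_fun_expR; measurability.
have ms : measurable_fun setT (fun x => Num.sqrt (g x * expR (1 - g x))).
  by apply: measurable_fun_sqrt; exact: measurable_funM.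
by apply/measurable_fun_pairP; split; rewrite /comp/=; measurability.
Qed.

Let mA n : measurable_fun setT (A n). Proof. exact: measurable_funP. Qed.
Let mZ n : measurable_fun setT (Z n). Proof. exact: measurable_funP. Qed.

Let mV n : measurable_fun setT (V n).
Proof.
elim: n => [|n IH].
  rewrite (_ : V 0 = cst (0, 0)); first exact: measurable_cst.
  by apply/funext => w; rewrite /V /S /X /skeleton_s big_ord0.
rewrite (_ : V n.+1 = fun w => skeleton_next (V n w) (A n w) (Z n w)).
  exact: measurable_next.
by apply/funext => w; rewrite V_S.
Qed.

Let Y (i : nat + nat) : Omega -> R := match i with inl n => A n : Omega -> R | inr n => Z n end.
(** The indices of the noise variables not yet used in the construction of the state [V n]. *)
Let late n (i : nat + nat) := match i with inl k => (n <= k)%N | inr k => (n <= k)%N end.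
Let cylinder (J : seq (nat + nat)) (E : nat + nat -> set R) :=
  [set w | forall i, i \in J -> E i (Y i w)].

Let mY i : measurable_fun setT (Y i). Proof. by case: i => n. Qed.

Let preimage_measurable d' (T : measurableType d') (f : Omega -> T) E :
  measurable_fun setT f -> measurable E -> measurable (f @^-1` E).
Proof. by move=> mf mE; rewrite -[X in measurable X]setTI; exact: mf. Qed.

Let measurable_cylinder J E : (forall i, measurable (E i)) -> measurable (cylinder J E).
Proof.
move=> mE; rewrite (_ : cylinder J E = \big[setI/setT]_(i <- J) (Y i @^-1` E i)).
  by apply: bigsetI_measurable => i _; exact: preimage_measurable.
rewrite -bigcap_seq; apply/seteqP; split => w /= h i; exact: h.
Qed.

(** Independence of the present state from the future noise, tested on events with finitely many
    coordinates, the form in which [mutually_independent] is given. *)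
Let independent n := forall D J E, measurable D -> uniq J -> all (late n) J ->
  (forall i, measurable (E i)) ->
  (P (V n @^-1` D `&` cylinder J E) = P (V n @^-1` D) * P (cylinder J E))%E.

Let half (c : R) : Prop := c = 1 \/ c = -1.

Let P_Z n c : half c -> P (Z n @^-1` [set c]) = (2^-1)%:E.
Proof. by have [_ /(_ n)[h1 h2] _] := noise; case=> ->. Qed.

Let cylinder_prod J E : uniq J -> (forall i, measurable (E i)) ->
  (P (cylinder J E) = \prod_(i <- J) P (Y i @^-1` E i))%E.
Proof. by have [_ _ h] := noise => uJ mE; rewrite /cylinder (h J E uJ mE). Qed.

(* Fixing the value of the sign [Z n] puts it in the conditioning event, so that
   only the pair of [V n] and [A n] has to be compared with a product measure. *)
Let step_integral n c F J E : independent n -> half c -> uniq J -> all (late n.+1) J ->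
  (forall i, measurable (E i)) -> measurable_fun setT F -> (forall q, 0 <= F q)%E ->
  (\int[P]_w (F (V n w, A n w) * (\1_(cylinder J E `&` Z n @^-1` [set c]) w)%:E) =
   P (cylinder J E) * (2^-1)%:E * \int[P]_w \int[P]_w' F (V n w, A n w'))%E.
Proof.
move=> indep hc uJ lJ mE mF F0.
have mc : measurable [set c] by exact: measurable_set1.
(* Overrides [E] at the index [n] only, asking [A n] to be in [B] and [Z n] to equal [c], so that
   these events become cylinders of noise late for [n]. *)
pose E' (B : set R) i : set R := match i with
  | inl k => if k == n then B else E i | inr k => if k == n then [set c] else E i end.
have mE' B : measurable B -> forall i, measurable (E' B i).
  by move=> mB [k|k] /=; case: ifP.
have nA : inl n \notin J by apply/negP => /(allP lJ); rewrite /= ltnn.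
have nZ : inr n \notin J by apply/negP => /(allP lJ); rewrite /= ltnn.
have uJ1 : uniq (inr n :: J) by rewrite /= nZ.
have uJ2 : uniq (inl n :: inr n :: J) by rewrite /= nZ uJ inE/= nA.
have lJ2 : all (late n) (inl n :: inr n :: J).
  by rewrite /= !leqnn/=; apply: sub_all lJ => -[k|k] /=; exact: ltnW.
have E'J B i : i \in J -> E' B i = E i.
  case: i => k kJ /=; case: eqP => // kn; move: kJ; rewrite kn ?(negbTE nA) ?(negbTE nZ)//.
have cyl1 : cylinder J E `&` Z n @^-1` [set c] = cylinder (inr n :: J) (E' setT).
  apply/seteqP; split => [w [/= h1 h2] i|w /= h].
    rewrite inE => /predU1P[->/=|iJ]; first by rewrite eqxx.
    by rewrite E'J//; exact: h1.
  split; first by move=> i iJ; rewrite -(E'J setT)//; apply: h; rewrite inE iJ orbT.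
  by have := h (inr n) (mem_head _ _); rewrite /= eqxx.
have cyl2 B : A n @^-1` B `&` (cylinder J E `&` Z n @^-1` [set c]) =
    cylinder (inl n :: inr n :: J) (E' B).
  apply/seteqP; split => [w [/= h0 [h1 h2]] i|w /= h].
    rewrite !inE => /or3P[/eqP ->/=|/eqP ->/=|iJ]; rewrite ?eqxx//.
    by rewrite E'J//; exact: h1.
  split; first by have := h (inl n) (mem_head _ _); rewrite /= eqxx.
  split; first by move=> i iJ; rewrite -(E'J B)//; apply: h; rewrite !inE iJ !orbT.
  have nJ : inr n \in [:: inl n, inr n & J] by rewrite !inE eqxx orbT.
  by have := h _ nJ; rewrite /= eqxx.
have prodJ B : (\prod_(i <- J) P (Y i @^-1` E' B i) = P (cylinder J E))%E.
  rewrite cylinder_prod//; rewrite big_seq [RHS]big_seq; apply: eq_bigr => i iJ.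
  by rewrite E'J.
have PC : P (cylinder J E `&` Z n @^-1` [set c]) = (P (cylinder J E) * (2^-1)%:E)%E.
  rewrite cyl1 cylinder_prod ?big_cons//; last exact: mE'.
  by rewrite prodJ [in LHS]/= eqxx P_Z// muleC.
rewrite -PC; apply: integral_independent_pair => //.
  by rewrite cyl1; apply: measurable_cylinder; exact: mE'.
move=> D B mD mB.
rewrite -setIA cyl2 indep//; last exact: mE'.
rewrite cylinder_prod//; last exact: mE'.
rewrite !big_cons prodJ [in LHS]/= !eqxx P_Z// PC.
by rewrite (muleC (2^-1)%:E) muleA muleC.
Qed.

Let neq1N1 : (1 : R) <> -1.
Proof. by move/eqP; rewrite -subr_eq0 opprK; apply/negP; rewrite gt_eqF//; lra. Qed.

Let Z_half n : {ae P, forall w, half (Z n w)}.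
Proof.
exists (~` (Z n @^-1` [set 1] `|` Z n @^-1` [set -1])); split.
- by apply: measurableC; apply: measurableU; apply: preimage_measurable.
- rewrite probability_setC; last by apply: measurableU; apply: preimage_measurable.
  rewrite measureU; [|exact: preimage_measurable|exact: preimage_measurable|].
    have e : (P (Z n @^-1` [set 1%R]) + P (Z n @^-1` [set (-1)%R]) = 1)%E.
      by rewrite !P_Z; [rewrite -EFinD; congr EFin; lra|by right|by left].
    by transitivity (1 - (P (Z n @^-1` [set 1%R]) + P (Z n @^-1` [set (-1)%R])))%E => //; rewrite e subee.
  by apply/seteqP; split => w //= [-> /neq1N1].
- by move=> w /= h [h'|h']; apply: h; [left|right].
Qed.

(** The event is split by the sign of the step, each value having probability 1/2. The later noise
    factors out, which carries independence to the next state. *)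
Let next_integral n phi J E : independent n -> uniq J -> all (late n.+1) J ->
  (forall i, measurable (E i)) -> measurable_fun setT phi -> (forall v, 0 <= phi v)%E ->
  (\int[P]_w (phi (V n.+1 w) * (\1_(cylinder J E) w)%:E) =
   P (cylinder J E) * \int[P]_w \int[P]_w' ((2^-1)%:E *
     (phi (skeleton_next (V n w) (A n w') 1) + phi (skeleton_next (V n w) (A n w') (-1)))))%E.
Proof.
move=> indep uJ lJ mE mphi phi0.
pose F (c : R) (q : (R * R) * R) := phi (skeleton_next q.1 q.2 c).
have mF c : measurable_fun setT (F c).
  apply: (measurableT_comp mphi); apply: measurable_next.
  - exact: measurable_fst.
  - exact: measurable_snd.
  - exact: measurable_cst.
have F0 c q : (0 <= F c q)%E by exact: phi0.
have mC := measurable_cylinder J mE.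
have mCc c : measurable (cylinder J E `&` Z n @^-1` [set c]).
  by apply: measurableI => //; exact: preimage_measurable.
have mVA c : measurable_fun setT (fun w => F c (V n w, A n w)).
  exact: (measurableT_comp (mF c) (measurable_fun_pair (mV n) (mA n))).
have mFC c : measurable_fun setT
    (fun w => F c (V n w, A n w) * (\1_(cylinder J E `&` Z n @^-1` [set c]) w)%:E)%E.
  apply: emeasurable_funM => //; apply/measurable_EFinP; exact: measurable_indic.
have FC0 c w : (0 <= F c (V n w, A n w) * (\1_(cylinder J E `&` Z n @^-1` [set c]) w)%:E)%E.
  by apply: mule_ge0; rewrite ?lee_fin.
transitivity (\int[P]_w (F 1%R (V n w, A n w) * (\1_(cylinder J E `&` Z n @^-1` [set 1%R]) w)%:E +
   F (-1)%R (V n w, A n w) * (\1_(cylinder J E `&` Z n @^-1` [set (-1)%R]) w)%:E))%E.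
  apply: ae_eq_integral => //.
  - apply: emeasurable_funM; first exact: measurableT_comp.
    by apply/measurable_EFinP; exact: measurable_indic.
  - exact: emeasurable_funD.
  have := Z_half n; apply: filterS => w hZ _.
  have n11 := neq1N1.
  rewrite /F/= V_S !indicE !in_setI.
  case: hZ => Zw; rewrite Zw.
    by rewrite (mem_set (A := Z n @^-1` [set 1%R]))// (memNset (A := Z n @^-1` [set (-1)%R])) ?andbT ?andbF ?mule0 ?adde0//= Zw.
  by rewrite (memNset (A := Z n @^-1` [set 1%R])) ?(mem_set (A := Z n @^-1` [set (-1)%R])) ?andbT ?andbF ?mule0 ?add0e//= Zw => /esym.
rewrite ge0_integralD//.
rewrite !step_integral//; [|by right|by left].
have mG c : measurable_fun setT (fun w => \int[P]_w' F c (V n w, A n w'))%E.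
  pose H (q : Omega * Omega) := F c (V n q.1, A n q.2).
  have mH : measurable_fun setT H.
    apply: (measurableT_comp (mF c)); apply/measurable_fun_pairP; split; rewrite /comp/=.
      by apply: (measurableT_comp (mV n)).
    by apply: (measurableT_comp (mA n)).
  exact: (@measurable_fun_fubini_tonelli_F _ _ _ _ _ P H mH (fun q => F0 c _)).
have G0 c w : (0 <= \int[P]_w' F c (V n w, A n w'))%E by exact: integral_ge0.
have dist (p q x y : \bar R) : (0 <= x -> 0 <= y -> p * q * x + p * q * y = p * (q * (x + y)))%E.
  by move=> x0 y0; rewrite muleA ge0_muleDr.
rewrite dist; [|exact: integral_ge0|exact: integral_ge0].
congr (_ * _)%E.
rewrite -ge0_integralD// -ge0_integralZl_EFin//; last 2 first.
- by move=> w _; apply: adde_ge0.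
- exact: emeasurable_funD.
apply: eq_integral => w _.
have mFw c : measurable_fun setT (fun w' => F c (V n w, A n w')).
  by apply: (measurableT_comp (mF c)); apply/measurable_fun_pairP; split; rewrite /comp/=.
rewrite -ge0_integralD// -ge0_integralZl_EFin//.
- by move=> w' _; apply: adde_ge0.
- exact: emeasurable_funD.
Qed.

(** By induction: [next_integral] for the indicator of [D] is used with the given cylinder and with
    the trivial one, and the common factor is the law of the next state. *)
Let independentP n : independent n.
Proof.
elim: n => [|n IH] D J E mD uJ lJ mE.
  have [D0|D0] := pselect (D (0, 0)).
    rewrite (_ : V 0 @^-1` D = setT) ?setTI ?probability_setT ?mul1e//.
    by apply/seteqP; split => w // _; rewrite /= /V /S /X /skeleton_s big_ord0.
  rewrite (_ : V 0 @^-1` D = set0) ?set0I ?measure0 ?mul0e//.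
  by apply/seteqP; split => w //; rewrite /= /V /S /X /skeleton_s big_ord0.
pose phi (v : R * R) : \bar R := (\1_D v)%:E.
have mphi : measurable_fun setT phi by apply/measurable_EFinP; exact: measurable_indic.
have phi0 v : (0 <= phi v)%E by rewrite lee_fin.
have mC := measurable_cylinder J mE.
have mVD : measurable (V n.+1 @^-1` D) by exact: preimage_measurable.
have -> : P (V n.+1 @^-1` D `&` cylinder J E) = (\int[P]_w (phi (V n.+1 w) * (\1_(cylinder J E) w)%:E))%E.
  rewrite -[X in P X]setIT -integral_indic//; last exact: measurableI.
  by apply: eq_integral => w _; rewrite indicI/= EFinM.
rewrite next_integral// muleC; congr (_ * _)%E.
have := next_integral IH (isT : uniq [::]) (isT : all (late n.+1) [::]) mE mphi phi0.
rewrite (_ : cylinder [::] E = setT); last by apply/seteqP; split.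
rewrite probability_setT mul1e => <-.
rewrite -[X in P X]setIT -integral_indic//.
by apply: eq_integral => w _; rewrite indicT mule1.
Qed.

(** The noise [A n] is replaced by [A 0], which has the same law, so that one kernel serves all
    steps. *)
Lemma skeleton_markov n (phi : R * R -> \bar R) :
  measurable_fun setT phi -> (forall v, 0 <= phi v)%E ->
  (\int[P]_w phi (S n.+1 w, X n.+1 w) = \int[P]_w \int[P]_w' ((2^-1)%:E *
     (phi (skeleton_next (S n w, X n w) (A 0%N w') 1) +
      phi (skeleton_next (S n w, X n w) (A 0%N w') (-1)))))%E.
Proof.
move=> mphi phi0.
have := next_integral (@independentP n) (isT : uniq [::]) (isT : all (late n.+1) [::])
  (fun _ => measurableT : measurable (setT : set R)) mphi phi0.
rewrite (_ : cylinder [::] _ = setT); last by apply/seteqP; split.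
rewrite probability_setT mul1e => h.
transitivity (\int[P]_w (phi (V n.+1 w) * (\1_setT w)%:E))%E.
  by apply: eq_integral => w _; rewrite indicT mule1.
rewrite h; apply: eq_integral => w _.
have [gammaA _ _] := noise.
pose f (y : R) : \bar R := ((2^-1)%:E * (phi (skeleton_next (S n w, X n w) y 1) +
      phi (skeleton_next (S n w, X n w) y (-1))))%E.
have mf : measurable_fun setT f.
  apply: emeasurable_funM; first exact: measurable_cst.
  by apply: emeasurable_funD; apply: (measurableT_comp mphi); apply: measurable_next.
have f0 y : (0 <= f y)%E by apply: mule_ge0; rewrite ?lee_fin//; exact: adde_ge0.
by rewrite -/(f _) (gamma_law_integral (gammaA n) mf f0) (gamma_law_integral (gammaA 0%N) mf f0).
Qed.

Lemma measurable_skeleton_s n : measurable_fun setT (S n).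
Proof. by have := mV n => /measurable_fun_pairP[]. Qed.

Lemma measurable_skeleton_x n : measurable_fun setT (X n).
Proof. by have := mV n => /measurable_fun_pairP[]. Qed.

End skeleton_markov.

(** Translating eta reduces to a start at 0, where the Lyapunov function equals 1. *)
Lemma skeleton_x_shift {R : realType} (eta : R -> R) (eps x : R) (a z : nat -> R) n :
  skeleton_x eta eps x a z n = x + skeleton_x (fun y => eta (x + y)) eps 0 a z n.
Proof. by elim: n => [|n IH] /=; rewrite ?addr0// -IH /skeleton_step -IH addrA -IH. Qed.

Lemma skeleton_s_shift {R : realType} (eta : R -> R) (eps x : R) (a z : nat -> R) n :
  skeleton_s eta eps x a z n = skeleton_s (fun y => eta (x + y)) eps 0 a z n.
Proof.
apply: eq_bigr => k _.
by rewrite /skeleton_U /skeleton_step skeleton_x_shift.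
Qed.

Section skeleton_chain.
Context {R : realType} {d} {Omega : measurableType d} (P : probability Omega R).
Variables (A Z : nat -> {RV P >-> R}).
Hypothesis noise : skeleton_noise A Z.

(* [A 0] is almost surely positive; the truncation in [jump_time], and the
   convention that [sqrt] vanishes on negative numbers in [jump_size], make the
   bounds hold everywhere. *)
Definition jump_size (w : Omega) : R := Num.sqrt (A 0%N w * expR (1 - A 0%N w)).
Definition jump_time (w : Omega) : R := expR (1 - Num.max (A 0%N w) 0).

Let gammaA : gamma_law P (3 / 2) 2 (A 0%N). Proof. by have [/(_ 0%N)] := noise. Qed.

Let mA : measurable_fun setT (A 0%N). Proof. exact: measurable_funP. Qed.

Lemma measurable_jump_size : measurable_fun setT jump_size.
Proof.
apply: measurable_fun_sqrt; apply: measurable_funM => //.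
by apply: measurable_fun_expR; apply: measurable_funB => //; exact: measurable_cst.
Qed.

Lemma measurable_jump_time : measurable_fun setT jump_time.
Proof.
apply: measurable_fun_expR; apply: measurable_funB; first exact: measurable_cst.
exact: (measurable_maxr (f := A 0%N) (g := cst 0)).
Qed.

(** A e^(1 - A) <= 1 is the inequality 1 + u <= e^u at u = A - 1. *)
Lemma jump_size_bound w : 0 <= jump_size w <= 1.
Proof.
rewrite sqrtr_ge0/= -sqrtr1 ler_wsqrtr//.
have -> : 1 - A 0%N w = - (A 0%N w - 1) by ring.
rewrite expRN -[leRHS](mulfV (lt0r_neq0 (expR_gt0 (A 0%N w - 1)))).
rewrite ler_wpM2r ?invr_ge0 ?expR_ge0//.
by have := expR_ge1Dx (A 0%N w - 1); lra.
Qed.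

Lemma jump_time_bound w : 0 <= jump_time w <= 3.
Proof.
rewrite expR_ge0/=.
apply: (@le_trans _ _ (expR 1)).
  by rewrite ler_expR lerBlDr lerDl le_max lexx orbT.
(* (7/8)^8 > 1/3, hence e < 3. *)
have e8 : 7 / 8 <= expR (- (1 / 8)) :> R by have := expR_ge1Dx (- (1 / 8) : R); lra.
have e0 : 0 <= 7 / 8 :> R by lra.
have : (7 / 8) ^+ 8 <= expR (- (1 / 8)) ^+ 8 :> R by rewrite lerXn2r// nnegrE ?expR_ge0.
rewrite -expRM_natl.
have -> : 8%:R * - (1 / 8) = - 1 :> R by lra.
rewrite expRN => h.
have {}h : 3^-1 <= (expR 1)^-1 :> R by apply: le_trans h; rewrite !exprS expr0; lra.
by rewrite -lef_pV2 ?posrE ?expR_gt0.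
Qed.

Lemma integral_jump_size2 : (\int[P]_w (jump_size w ^+ 2)%:E = (@gamma_exp_moment R)%:E)%E.
Proof.
rewrite -(gamma_mul_exp_moment gammaA); apply: eq_integral => w _; congr EFin.
rewrite /jump_size; have [h|h] := leP 0 (A 0%N w * expR (1 - A 0%N w)).
  by rewrite sqr_sqrtr// max_l.
by rewrite ltr0_sqrtr// expr0n.
Qed.

Lemma integral_jump_time : (\int[P]_w (jump_time w)%:E = (@gamma_exp_moment R)%:E)%E.
Proof.
rewrite -(gamma_exp_momentE gammaA); apply: ae_eq_integral => //.
- by apply/measurable_EFinP; exact: measurable_jump_time.
- apply/measurable_EFinP; apply: measurable_fun_expR.
  by apply: measurable_funB => //; exact: measurable_cst.
- have := gamma_law_gt0 gammaA; apply: filterS => w w0 _.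
  by rewrite /jump_time max_l// ltW.
Qed.

Variables (eta : R -> R) (eps : R).
Hypotheses (meta : measurable_fun setT eta) (eta_gt0 : forall z, 0 < eta z) (eps_gt0 : 0 < eps).

Lemma skeleton_s_nondecreasing x (al z : nat -> R) :
  nondecreasing_seq (skeleton_s eta eps x al z).
Proof.
apply/nondecreasing_seqP => n; rewrite /skeleton_s big_ord_recr/= lerDl.
by rewrite mulr_ge0 ?expR_ge0// mulr_ge0// sqr_ge0.
Qed.

Lemma skeleton_is_chain : is_chain P jump_size jump_time eta P eps
  (fun n w => skeleton_s eta eps 0 (A ^~ w) (Z ^~ w) n)
  (fun n w => skeleton_x eta eps 0 (A ^~ w) (Z ^~ w) n).
Proof.
split.
- exact: measurable_skeleton_s.
- exact: measurable_skeleton_x.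
- move=> n w; have := skeleton_s_nondecreasing 0 (A ^~ w) (Z ^~ w) (leq0n n).
  by rewrite {1}/skeleton_s big_ord0.
- by move=> w; rewrite /skeleton_s big_ord0.
move=> n phi mphi phi0.
have phi0' (v : R * R) : (0 <= phi v.1 v.2)%E by exact: phi0.
apply: (eq_trans (skeleton_markov noise meta eta_gt0 eps_gt0 n mphi phi0')).
apply: eq_integral => w _; rewrite /chain_step /average_step.
move: (skeleton_s _ _ _ _ _ _) (skeleton_x _ _ _ _ _ _) => s z.
have mjs := measurable_jump_size.
have mjt := measurable_jump_time.
have mx : measurable_fun setT (fun w' => expR (1 - A 0%N w')).
  by apply: measurable_fun_expR; apply: measurable_funB => //; exact: measurable_cst.
apply: ae_eq_integral => //=.
- apply: emeasurable_funM; first exact: measurable_cst.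
  by apply: emeasurable_funD; apply: jointly_measurable_comp mphi _ _;
    rewrite -?/(jump_size _); measurability.
- apply: emeasurable_funM; first exact: measurable_cst.
  by apply: emeasurable_funD; apply: jointly_measurable_comp mphi _ _; measurability.
have := gamma_law_gt0 gammaA; apply: filterS => w' w'0 _.
have tE : s + eps ^+ 2 * eta z ^+ 2 * expR (1 - A 0%N w') = s + jump_time w' * (eps * eta z) ^+ 2.
  by rewrite /jump_time max_l ?ltW//; ring.
rewrite tE -/(jump_size w').
have -> : z + 1 * eta z * (eps * jump_size w') = z + jump_size w' * (eps * eta z) by ring.
by have -> : z + -1 * eta z * (eps * jump_size w') = z - jump_size w' * (eps * eta z) by ring.
Qed.

End skeleton_chain.

(** * First passage *)

Section counting.
Context {R : realType}.

(** For a nondecreasing sequence the first passage index counts the earlier terms, all below the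
    level; if the level is never reached, both sides are infinite. *)
Lemma ereal_inf_first_passage (s : nat -> R) (L : R) : nondecreasing_seq s ->
  (ereal_inf [set (n%:R : R)%:E | n in [set n | (L <= s n)%R]] =
   \sum_(0 <= n <oo) (\1_[set r | (r < L)%R] (s n) : R)%:E)%E.
Proof.
move=> s_nd.
have ind n : \1_[set r | (r < L)%R] (s n) = ((s n < L)%R)%:R :> R by rewrite indicE mem_setE.
have [[n0 Ln0]|none] := pselect (exists n, L <= s n).
  have [N LN Nmin] := ex_minnP (ex_intro (fun n => L <= s n) n0 Ln0).
  have sumN M : (N <= M)%N -> (\sum_(0 <= n < M) (\1_[set r | (r < L)%R] (s n) : R)%:E = (N%:R)%:E)%E.
    move=> NM; rewrite (big_cat_nat _ NM)//= [X in (_ + X)%E]big1_seq ?adde0; last first.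
      move=> n /andP[_]; rewrite mem_index_iota => /andP[Nn _].
      by rewrite ind ltNge (le_trans LN)// s_nd.
    rewrite big_nat (eq_bigr (fun=> 1%E)); last first.
      move=> n /andP[_ nN]; rewrite ind ltNge; case: (leP L (s n)) => // /Nmin.
      by rewrite leqNgt nN.
    by rewrite -big_nat sumEFin big_const_nat subn0 iter_addr_0.
  have -> : (\sum_(0 <= n <oo) (\1_[set r | (r < L)%R] (s n) : R)%:E = (N%:R)%:E)%E.
    apply: lim_near_cst => //; exists N => // M /= NM; exact: sumN.
  apply/eqP; rewrite eq_le; apply/andP; split.
    by apply: ereal_inf_lbound; exists N.
  by apply/ereal_infP => _ [n Ln <-]; rewrite lee_fin ler_nat; exact: Nmin.
have sL n : s n < L by rewrite ltNge; apply/negP => h; apply: none; exists n.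
have -> : [set n | (L <= s n)%R] = set0.
  by apply/seteqP; split => n //= Ln; apply: none; exists n.
rewrite image_set0 ereal_inf0; apply/esym/cvg_lim => //.
have sumM M : (\sum_(0 <= n < M) (\1_[set r | (r < L)%R] (s n) : R)%:E = (M%:R)%:E)%E.
  rewrite (eq_bigr (fun=> 1%E)) ?sumEFin ?big_const_nat ?subn0 ?iter_addr_0//.
  by move=> n _; rewrite ind sL.
under eq_fun do rewrite sumM.
by apply/cvgeryP; exact: cvgr_idn.
Qed.

(** Expresses the mean through the probabilities of being below the level, the form in which the
    chain estimates count steps. *)
Lemma integral_number_of_points {d} {Omega : measurableType d} (P : probability Omega R)
    (A Z : nat -> {RV P >-> R}) (eta : R -> R) (eps x L : R) :
  (forall n, measurable_fun setT (fun w => skeleton_s eta eps x (A ^~ w) (Z ^~ w) n)) ->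
  (\int[P]_w number_of_points eta eps x L (A ^~ w) (Z ^~ w) =
   \sum_(0 <= n <oo) P [set w | (skeleton_s eta eps x (A ^~ w) (Z ^~ w) n < L)%R])%E.
Proof.
move=> mS.
have mSL n : measurable [set w | skeleton_s eta eps x (A ^~ w) (Z ^~ w) n < L].
  rewrite (_ : [set w | _] = (fun w => skeleton_s eta eps x (A ^~ w) (Z ^~ w) n) @^-1` `]-oo, L[).
    by rewrite -[X in measurable X]setTI; apply: mS.
  by apply/seteqP; split=> w /=; rewrite in_itv.
transitivity (\int[P]_w \sum_(0 <= n <oo)
    (\1_[set w | (skeleton_s eta eps x (A ^~ w) (Z ^~ w) n < L)%R] w)%:E)%E.
  apply: eq_integral => w _; rewrite /number_of_points ereal_inf_first_passage//.
  exact: skeleton_s_nondecreasing.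
rewrite integral_nneseries//.
- by apply: eq_eseriesr => n _; rewrite integral_indic// setIT.
- by move=> n; apply/measurable_EFinP; exact: measurable_indic.
Qed.

End counting.

Theorem theorem3p13 (R : realType) (sigma m : R -> R -> R)
    (f : R -> R -> R) (rho F : R -> R) (kmin : R)
    (hf : class_C11 f) (hrho : time_change rho) (hF : growth_function F)
    (hB : assumption_B rho kmin) :
  exists mu : R, 0 < mu /\
  forall (T x : R), 0 <= T -> growth_bound T f F ->
  forall (d : measure_display) (Omega : measurableType d)
    (P : probability Omega R) (Fil : R -> set (set Omega))
    (W B X : R -> {RV P >-> R}),
  sde_solution Fil W T sigma m X ->
  brownian_motion B ->
  {ae P, forall w, forall t, 0 <= t <= T -> X t w = f t (x + B (rho t) w)} ->
  forall (d' : measure_display) (Omega' : measurableType d')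
    (P' : probability Omega' R) (A Z : nat -> {RV P' >-> R})
    (y : R -> R -> Omega' -> R),
  skeleton_noise A Z ->
  (forall eps t w, 0 < eps -> 0 <= t <= T -> y eps t w =
     skeleton_approx f rho (eta_of kmin F) eps x (A ^~ w) (Z ^~ w) t) ->
  ((eps ^+ 2)%:E *
     \int[P']_w number_of_points (eta_of kmin F) eps x (rho T)
                  (A ^~ w) (Z ^~ w))%E @[eps --> 0^'+] -->
  (mu%:E * \int[P]_w \int[lebesgue_measure]_(s in `[0%R, rho T])
     (((eta_of kmin F (x + B s w)) ^+ 2)^-1)%:E)%E.
Proof.
(* The moment is known to be positive only once a gamma variable is given. *)
exists (if 0 < @gamma_exp_moment R then (@gamma_exp_moment R)^-1 else 1).
split; first by case: ifP => //; rewrite invr_gt0.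
move=> T x T0 fF d Omega P Fil W B X _ brownianB _ d' Omega' P' A Z y noise _.
have gammaA : gamma_law P' (3 / 2) 2 (A 0%N) by have [/(_ 0%N)] := noise.
have m_gt0 := gamma_exp_moment_gt0 gammaA; rewrite m_gt0.
have [kmin_gt0 _] := hB.
(* The growth bound at t = z = 0 places [F 0] above an absolute value. *)
have F0 : 0 <= F 0.
  have := fF 0 0; rewrite lexx T0 expr0n/= => /(_ isT).
  by apply: le_trans; rewrite le_max normr_ge0.
have rhoT : 0 <= rho T.
  have [rho_homo _ rho0 _] := hrho.
  move: T0; rewrite le_eqVlt => /predU1P[<-|T0]; first by rewrite rho0.
  have Rplus_ge0 t : 0 <= t -> t \in Rplus by move=> t0; rewrite inE /Rplus/= in_itv/= andbT.
  rewrite -[leLHS]rho0; apply/ltW/rho_homo => //; apply: Rplus_ge0 => //.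
  exact: ltW.
pose eta z := eta_of kmin F (x + z).
pose g z := (eta z ^+ 2)^-1.
have eta_gt0 z : 0 < eta z by exact: eta_of_gt0.
have meta : measurable_fun setT eta.
  apply: (measurableT_comp (measurable_eta_of kmin hF)).
  by apply: measurable_funD; [exact: measurable_cst|exact: measurable_id].
have mg : measurable_fun setT g by apply: measurable_fun_inv; exact: measurable_funX.
have g_ge0 z : 0 <= g z by rewrite invr_ge0 sqr_ge0.
have [K [k [K0 k0 g_growth g_lip]]] := inv2_eta_of_regularity kmin x hF F0.
rewrite (brownian_occupation brownianB (rho T) mg g_ge0).
have sE eps n w : skeleton_s (eta_of kmin F) eps x (A ^~ w) (Z ^~ w) n =
    skeleton_s eta eps 0 (A ^~ w) (Z ^~ w) n by exact: skeleton_s_shift.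
have NE eps : 0 < eps ->
    (\int[P']_w number_of_points (eta_of kmin F) eps x (rho T) (A ^~ w) (Z ^~ w) =
     \sum_(0 <= n <oo) P' [set w | (skeleton_s eta eps 0 (A ^~ w) (Z ^~ w) n < rho T)%R])%E.
  move=> eps0; rewrite integral_number_of_points.
    by apply: eq_eseriesr => n _; congr (P' _); apply/seteqP; split => w /=; rewrite sE.
  move=> n; rewrite (_ : (fun w => _) = (fun w => skeleton_s eta eps 0 (A ^~ w) (Z ^~ w) n)).
    exact: measurable_skeleton_s.
  by apply/funext => w; exact: sE.
(* When rho(T) = 0 the level is reached at index 0 and the time interval is degenerate, so both
   sides vanish; otherwise the chain starts strictly below the level. *)
move: rhoT; rewrite le_eqVlt => /predU1P[rhoT|rhoT].
  rewrite potential_empty -?rhoT// mule0.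
  apply: (@cvg_trans _ (cst 0%E eps @[eps --> 0^'+])); last exact: cvg_cst.
  apply: near_eq_cvg; near=> eps.
  rewrite rhoT NE// eseries0 ?mule0// => n _ _.
  rewrite -rhoT (_ : [set w | _] = set0) ?measure0//.
  apply/seteqP; split => w //=; rewrite ltNge.
  have := skeleton_s_nondecreasing eta eps 0 (A ^~ w) (Z ^~ w) (leq0n n).
  by rewrite {1}/skeleton_s big_ord0 => ->.
apply: (chain_occupation_cvg (measurable_jump_size A) (measurable_jump_time A)
  (jump_size_bound A) (jump_time_bound A) m_gt0 (integral_jump_size2 noise)
  (integral_jump_time noise) mg meta K0 k0 rhoT eta_gt0 (fun z => eta_of_le hF F0 kmin_gt0 (x + z))
  (fun=> erefl) g_growth g_lip) => eps eps0.
exists (fun n w => skeleton_s eta eps 0 (A ^~ w) (Z ^~ w) n),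
  (fun n w => skeleton_x eta eps 0 (A ^~ w) (Z ^~ w) n).
by split; [exact: skeleton_is_chain|exact: NE].
Unshelve. all: by end_near. Qed.
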